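(* Let $c,L>0$, let $\phi\in\Phi_c$ with constant $\kappa_\phi\in(0,1)$, and assume that $\widehat\phi$ is $\mathcal C^1$-smooth on $[-c,c]$. Let $\Lambda\subseteq\mathbb{R}$ and $A,B>0$ be such that $$A\|f\|_2^2\le\int_0^L\sum_{\lambda\in\Lambda}|(f*\phi_t)(\lambda)|^2\,\mathrm{d}t\le B\|f\|_2^2\qquad\text{for all }f\in PW_c.$$ Let $c_{\phi,L}=\frac{2(\kappa_\phi^{2L}-1)}{\pi^2\ln\kappa_\phi}$ and let $C_{\phi,L}<\infty$ be a constant such that $$\int_0^L|(\operatorname{sinc}(c\,\cdot)*\phi_t)(x)|^2\,\mathrm{d}t\le\frac{C_{\phi,L}}{1+x^2}\qquad\text{for all }x\in\mathbb{R}.$$ Then for every $R\ge\max\left(\frac\pi c,\ \frac{8c}{\pi}\frac BA\frac{C_{\phi,L}}{c_{\phi,L}}\right)$ and every $a\in\mathbb{R}$ we have $[a-R,a+R]\cap\Lambda\ne\emptyset$. Further, $$D^-(\Lambda)\ge\min\left(\frac{c}{2\pi},\ \frac{\pi}{16c}\frac AB\frac{c_{\phi,L}}{C_{\phi,L}}\right)\qquad\text{and}\qquad D^+(\Lambda)\le 4\frac{B}{c_{\phi,L}}.$$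
   Context: The Fourier transform is $\widehat f(\xi)=\int_{\mathbb{R}}f(x)e^{-ix\xi}\,\mathrm{d}x$, and $PW_c=\{f\in L^2(\mathbb{R}):\operatorname{supp}\widehat f\subseteq[-c,c]\}$ (elements identified with continuous representatives). The class of kernels is $$\Phi_c=\{\phi\in L^1(\mathbb{R}):\ \exists\,\kappa_\phi>0 \text{ with } \kappa_\phi\le\widehat\phi(\xi)\le 1 \text{ for } |\xi|\le c,\ \widehat\phi(0)=1\}.$$ For $f\in PW_c$, $t\ge0$, $f*\phi_t\in PW_c$ denotes the function with Fourier transform $\widehat f(\xi)\widehat\phi(\xi)^t$. $\operatorname{sinc}(x)=\frac{\sin x}x$, $\operatorname{sinc}(0)=1$. (If $\phi\in\Phi_c$ and $\widehat\phi$ is $\mathcal C^1$-smooth on $[-c,c]$, then a finite constant $C_{\phi,L}$ with $\int_0^L|(\operatorname{sinc}(c\,\cdot)*\phi_t)(x)|^2\,\mathrm{d}t\le\frac{C_{\phi,L}}{1+x^2}$ for all $x\in\mathbb{R}$ exists.) The Beurling densities are $$D^-(\Lambda)=\liminf_{r\to\infty}\inf_{x\in\mathbb{R}}\frac{\#(\Lambda\cap[x-r,x+r])}{2r},\qquad D^+(\Lambda)=\limsup_{r\to\infty}\sup_{x\in\mathbb{R}}\frac{\#(\Lambda\cap[x-r,x+r])}{2r}.$$ *)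

(* Defs.v *)
From HB Require Import structures.
From mathcomp Require Import all_boot all_order all_algebra.
From mathcomp Require Import all_classical all_reals all_analysis.
From mathcomp Require Import complex.

Set Implicit Arguments.
Unset Strict Implicit.
Unset Printing Implicit Defensive.
Import Order.TTheory GRing.Theory Num.Theory.
Import numFieldNormedType.Exports.

Local Open Scope classical_set_scope.
Local Open Scope ring_scope.
Local Open Scope complex_scope.

Section Defs.
Context {R : realType}.
Implicit Types (f g h phi : R -> R[i]) (c t x r xi kappa : R) (p : \bar R).

Local Notation mu := (@lebesgue_measure R).
Local Notation Re := (@complex.Re R).
Local Notation Im := (@complex.Im R).

(** ** Complex-valued Lebesgue spaces on the line *)

Definition Lp_norm p f : \bar R :=
  'N[mu]_p [EFin \o (@Normc.normc R \o f)]%E.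

Definition Lp_space p : set (R -> R[i]) :=
  [set f : R -> R[i] | [/\ measurable_fun setT (Re \o f), measurable_fun setT (Im \o f)
             & (Lp_norm p f < +oo)%E]].

(** ** Fourier transform, [fourier f xi = \int f(x) exp(- i x xi) dx] *)

Definition expi x : R[i] := cos x +i* sin x.

Definition Cintegral f : R[i] :=
  (\int[mu]_x Re (f x)) +i* (\int[mu]_x Im (f x)).

(* Meaningful for [f] in L^1 only. *)
Definition fourier f xi : R[i] :=
  Cintegral (fun x => f x * expi (- (x * xi))).

(* [g] is (a representative of) the Fourier transform of [f] in L^2: the
   transform on L^2 is the continuous extension of [fourier] from the dense
   subspace L^1 `&` L^2, i.e. its graph is the L^2-closure of the graph of
   [fourier] on that subspace.  Both functions are determined up to a.e.
   equality. *)
Definition L2_fourier f g : Prop :=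
  [/\ Lp_space 2%:E f, Lp_space 2%:E g &
    exists f_ : nat -> R -> R[i],
      [/\ forall n, Lp_space 1%:E (f_ n) /\ Lp_space 2%:E (f_ n),
          Lp_norm 2%:E (fun x => f_ n x - f x) @[n --> \oo] --> 0%E
        & Lp_norm 2%:E (fun xi => fourier (f_ n) xi - g xi) @[n --> \oo]
            --> 0%E]].

(* The elements are the continuous representatives themselves.  The inclusion
   of the (essential) support of the transform in [-c, c] means that the
   transform vanishes almost everywhere off [-c, c]. *)
Definition PW c : set (R -> R[i]) :=
  [set f : R -> R[i] | continuous (f : R -> R[i]^o) /\
    exists2 g, L2_fourier f g & {ae mu, forall xi, c < `|xi| -> g xi = 0}].

(** ** Kernels *)

(* The order of [R[i]] is the partial one: [a <= b] forces [b - a] to be a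
   nonnegative real, so the transform is real-valued on [-c, c]. *)
Definition kernel_bound c kappa phi : Prop :=
  forall xi, `|xi| <= c -> kappa%:C <= fourier phi xi <= 1.

Definition Phi c : set (R -> R[i]) :=
  [set phi : R -> R[i] | [/\ Lp_space 1%:E phi,
                 exists2 kappa, 0 < kappa & kernel_bound c kappa phi
               & fourier phi 0 = 1]].

(* Continuous differentiability on the closed interval [-c, c], with one-sided
   derivatives at the end points. *)
Definition C1_on c f : Prop :=
  exists2 d : R -> R[i]^o, {within `[- c, c], continuous d} &
    forall xi, xi \in `[- c, c] ->
      ((f eta - f xi) / (eta - xi)%:C : R[i]^o)
        @[eta --> within (`[- c, c] `\ xi) (nbhs xi)] --> d xi.

(* [f * phi_t], for [f] in [PW c] and [phi] in [Phi c]: the unique element of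
   [PW c] whose transform is that of [f] times the [t]-th power of that of
   [phi].  The latter is a positive real on [-c, c], so that taking its real
   part before the power loses nothing; off [-c, c] the transform of [f]
   vanishes a.e. *)
Definition conv_pow c phi f t : R -> R[i] :=
  xget (fun=> 0) [set h : R -> R[i] | PW c h /\
    exists2 g, L2_fourier f g &
      L2_fourier h (fun xi => g xi * ((Re (fourier phi xi)) `^ t)%:C)].

Definition sinc x : R := if x == 0 then 1 else sin x / x.

(** ** Beurling densities *)

Definition point_density (Lambda : set R) r x : \bar R :=
  (counting (Lambda `&` `[(x - r)%R, (x + r)%R]) * ((2 * r)^-1)%:E)%E.

Definition lower_density (Lambda : set R) : \bar R :=
  limf_einf (fun r => ereal_inf (range (point_density Lambda r)))
    (pinfty_nbhs R).

Definition upper_density (Lambda : set R) : \bar R :=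
  limf_esup (fun r => ereal_sup (range (point_density Lambda r)))
    (pinfty_nbhs R).

End Defs.

(* Main.v *)
(* The frame inequality is tested on the translates sinc (c (x - a)).  The energy
   \int_0^L |(sinc (c .) * phi_t) (y)|^2 dt is at most C / (1 + y^2).  For
   |y| <= pi / 2c it is at least c_phiL: the cosines of the inverse Fourier
   integral are nonnegative and the transform of phi is at least kappa, so that
   (sinc (c .) * phi_t) (y) >= kappa^t sinc (c y) >= kappa^t 2 / pi.  The upper
   frame bound thus allows at most B (pi / c) / c_phiL sampling points per
   interval of length pi / c.  If [a - r, a + r] contained no point, summing the
   decay over shells of width pi / c outside it would contradict the lower frame
   bound.  Covering and packing by such intervals give the densities.

   The facts on the L^2 Fourier transform all come from pairing with
   exp (- eps |x|), whose transform is the Poisson kernel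
   2 eps / (eps^2 + z^2), and letting eps tend to 0. *)

Require Import Defs.
From HB Require Import structures.
From mathcomp Require Import all_boot all_order all_algebra.
From mathcomp Require Import all_classical all_reals all_analysis.
From mathcomp Require Import measurable_realfun.
From mathcomp Require Import complex.
From mathcomp Require Import ring lra.

Set Implicit Arguments.
Unset Strict Implicit.
Unset Printing Implicit Defensive.
Import Order.TTheory GRing.Theory Num.Theory.
Import numFieldNormedType.Exports.

Local Open Scope classical_set_scope.
Local Open Scope ring_scope.
Local Open Scope complex_scope.

(** [conv_pow] is a chosen element of a set defined through L^2 limits, so nothing can be estimated
    before it is identified on the test functions. The candidate is [kernel_sinc], the inverse
    Fourier integral of the band-limited function (pi / c) psi^t, where psi is the real part of the
    transform of phi. It must be shown to have that transform in the L^2 sense and to be the only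
    continuous function that does. Uniqueness rests on a Bessel inequality, for which any finite
    constant serves; existence rests on dominated convergence, the damping by [exp_weight] making
    the approximants integrable. Real cosine and sine transforms carry all of this, the complex
    transform being assembled from them.

    The constant 8 c / pi: the squared norm of sinc (c .) is pi / c, of which the lower bound pi /
    (2 c) is used. With N = B (pi / c) / c_phiL points per interval of length h = pi / c, two
    intervals per shell and 2 / (h r) for the sum over shells, the points beyond distance r carry
    energy below 4 N C / (h r) = 4 B C / (c_phiL r). This is at most A pi / (2 c) once r reaches the
    threshold. *)

Lemma integral_le d (T : measurableType d) (R : realType)
    (m : {measure set T -> \bar R}) (D : set T) (f g : T -> \bar R) :
  (forall x, D x -> 0 <= f x)%E -> (forall x, D x -> f x <= g x)%E ->
  (\int[m]_(x in D) f x <= \int[m]_(x in D) g x)%E.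
Proof.
move=> f0 fg.
have fgD x : ((f \_ D) x <= (g \_ D) x)%E by exact: lee_restrict.
have fD0 x : (0 <= (f \_ D) x)%E by exact: erestrict_ge0.
rewrite [leLHS]integral_mkcond [leRHS]integral_mkcond !ge0_integralTE//; last first.
  by move=> x; exact: le_trans (fgD x).
(* A simple function below [f] is also below [g], so the suprema compare. This covers integrands
   such as the sum over [Lambda], whose measurability in t is unknown. *)
apply: le_ereal_sup => _ /= [h hf <-]; exists h => // x.
exact: le_trans (hf x) (fgD x).
Qed.

(** * Lebesgue integration on the line *)

Section lebesgue_line.
Context {R : realType}.
Local Notation mu := (@lebesgue_measure R).
Local Notation int f := (mu.-integrable [set: R] (EFin \o f)).
Implicit Types (f g w : R -> R) (a : R).

(** The pushforward formula settles nonnegative functions, and positive and negative parts the rest.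
    It serves both translations and the reflection. *)
Lemma integral_preserving (phi : measurableTypeR R -> measurableTypeR R)
    (f : R -> \bar R) :
  measurable_fun setT phi ->
  (forall A, measurable A -> pushforward mu phi A = mu A) ->
  measurable_fun setT f ->
  (\int[mu]_x f (phi x) = \int[mu]_x f x)%E.
Proof.
move=> mphi phiE mf.
have H (h : R -> \bar R) : measurable_fun setT h -> (forall x, 0 <= h x)%E ->
    (\int[mu]_x h (phi x) = \int[mu]_x h x)%E.
  move=> mh h0.
  rewrite -[LHS]/(integral mu setT (h \o phi)) -(preimage_setT phi).
  rewrite -ge0_integral_pushforward//.
  by apply: eq_measure_integral => A mA _; exact: phiE.
rewrite [LHS]integralE [RHS]integralE; congr (_ - _)%E.
- rewrite -(H f^\+%E); [|exact: measurable_funepos|by []].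
  by apply: eq_integral => x _; rewrite !funeposE.
- rewrite -(H f^\-%E); [|exact: measurable_funeneg|by []].
  by apply: eq_integral => x _; rewrite !funenegE.
Qed.

Lemma integrable_preserving (phi : measurableTypeR R -> measurableTypeR R)
    (f : R -> R) :
  measurable_fun setT phi ->
  (forall A, measurable A -> pushforward mu phi A = mu A) ->
  int f -> int (f \o phi).
Proof.
move=> mphi phiE /integrableP[mf foo]; apply/integrableP; split.
  by apply: (measurableT_comp mf).
rewrite (@integral_preserving phi (fun x => `|(f x)%:E|%E))//.
exact: measurableT_comp.
Qed.

Lemma lebesgue_measure_shift a (A : set R) : measurable A ->
  pushforward mu (fun x : measurableTypeR R => x + a : measurableTypeR R) A = mu A.
Proof.
move=> mA.
have mphi : measurable_fun setT (fun x : measurableTypeR R => x + a : measurableTypeR R).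
  exact: (measurable_funD (@measurable_id _ R _) (@measurable_cst _ _ R R _ _)).
apply/esym/(@lebesgue_measure_unique _ (pushforward mu _)) => //= _ [[u v]] _ <-.
rewrite /pushforward.
rewrite (_ : _ @^-1` _ = `](u - a), (v - a)]%classic); last first.
  by apply/seteqP; split => x /=; rewrite !in_itv/= ltrBlDr lerBrDr.
rewrite !lebesgue_measure_itv/= !lte_fin ltrD2r.
by case: ifPn => // _; rewrite -!EFinB; congr EFin; ring.
Qed.

Lemma integral_shift (f : R -> \bar R) a : measurable_fun setT f ->
  (\int[mu]_x f (x + a)%R = \int[mu]_x f x)%E.
Proof.
move=> mf; apply: (@integral_preserving (fun x => x + a)) => //.
  exact: (measurable_funD (@measurable_id _ R _) (@measurable_cst _ _ R R _ _)).
exact: lebesgue_measure_shift.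
Qed.

Lemma integral_oppr (f : R -> \bar R) : measurable_fun setT f ->
  (\int[mu]_x f (- x)%R = \int[mu]_x f x)%E.
Proof.
move=> mf; apply: (@integral_preserving (fun x => - x)) => //.
  exact: oppr_measurable.
exact: lebesgue_measureN.
Qed.

Lemma integrable_shift f a : int f -> int (fun x => f (x + a)).
Proof.
apply: (@integrable_preserving (fun x => x + a)) => //.
  exact: (measurable_funD (@measurable_id _ R _) (@measurable_cst _ _ R R _ _)).
exact: lebesgue_measure_shift.
Qed.

Lemma Rintegral_shift f a : measurable_fun setT f ->
  \int[mu]_x f (x + a) = \int[mu]_x f x.
Proof.
move=> mf; rewrite /Rintegral (@integral_shift (EFin \o f))//.
exact/measurable_EFinP.
Qed.

Lemma Rintegral_oppr f : measurable_fun setT f ->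
  \int[mu]_x f (- x) = \int[mu]_x f x.
Proof.
move=> mf; rewrite /Rintegral (@integral_oppr (EFin \o f))//.
exact/measurable_EFinP.
Qed.

Lemma Rintegral_odd f : int f -> (forall x, f (- x) = - f x) ->
  \int[mu]_x f x = 0.
Proof.
move=> intf fN; suff : \int[mu]_x f x = - \int[mu]_x f x by lra.
rewrite -[LHS]Rintegral_oppr; last by apply/measurable_EFinP; exact: measurable_int intf.
under eq_Rintegral do rewrite fN -mulN1r.
by rewrite RintegralZl// mulN1r.
Qed.

Lemma integrable_bounded_mul f w (M : R) : int f -> measurable_fun setT w ->
  (forall x, `|w x| <= M) -> int (fun x => f x * w x).
Proof.
move=> intf mw wM; apply: (@le_integrable _ _ _ mu setT _ _ (fun x => (M * f x)%:E)) => //.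
- apply/measurable_EFinP; apply: measurable_funM => //.
  by apply/measurable_EFinP; exact: measurable_int intf.
- move=> x _ /=; rewrite lee_fin !normrM mulrC ler_wpM2r//.
  by rewrite (le_trans (wM x))// ler_norm.
- by have := integrableZl measurableT M intf.
Qed.

Lemma measurable_integrable f : int f -> measurable_fun setT f.
Proof. by move=> intf; apply/measurable_EFinP; exact: measurable_int intf. Qed.

Lemma integrable_le f g : int g -> measurable_fun setT f ->
  (forall x, `|f x| <= g x) -> int f.
Proof.
move=> intg mf fg; apply: (@le_integrable _ _ _ mu setT _ _ (EFin \o g)) => //.
  exact/measurable_EFinP.
by move=> x _ /=; rewrite lee_fin (le_trans (fg x))// ler_norm.
Qed.

Lemma ge0_integrable f : measurable_fun setT f -> (forall x, 0 <= f x) ->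
  (\int[mu]_x (f x)%:E < +oo)%E -> int f.
Proof.
move=> mf f0 foo; apply/integrableP; split; first exact/measurable_EFinP.
by under eq_integral do rewrite /= ger0_norm//.
Qed.

Lemma EFin_Rintegral f : int f -> (\int[mu]_x f x)%:E = (\int[mu]_x (f x)%:E)%E.
Proof. by move=> intf; rewrite /Rintegral fineK//; exact: integrable_fin_num. Qed.

End lebesgue_line.

(** * Cosine and sine transforms *)

Section trig_transform.
Context {R : realType}.
Local Notation mu := (@lebesgue_measure R).
Local Notation int f := (mu.-integrable [set: R] (EFin \o f)).
Implicit Types (a b e u : R -> R).

(** Fubini: the function a(x) b(y) k(x, y) is dominated by M |a(x)| |b(y)|, integrable on the
    plane. *)
Lemma Rintegral_kernel_exchange a b (k : R * R -> R) (M : R) :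
  int a -> int b -> measurable_fun setT k -> (forall z, `|k z| <= M) ->
  \int[mu]_x (a x * \int[mu]_y (b y * k (x, y))) =
  \int[mu]_y (b y * \int[mu]_x (a x * k (x, y))).
Proof.
move=> ia ib mk kM.
have M0 : 0 <= M by exact: le_trans (normr_ge0 _) (kM (0, 0)).
have ma := measurable_integrable ia; have mb := measurable_integrable ib.
pose F (z : measurableTypeR R * measurableTypeR R) : R := a z.1 * (b z.2 * k z).
have mF : measurable_fun setT F.
  apply: measurable_funM; first exact: (measurableT_comp ma).
  by apply: measurable_funM => //; exact: (measurableT_comp mb).
have mk1 x : measurable_fun setT (fun y => k (x, y)).
  exact: (measurableT_comp mk).
have mk2 y : measurable_fun setT (fun x => k (x, y)).
  exact: (measurableT_comp mk).
have i1 x : int (fun y => b y * k (x, y)) by exact: integrable_bounded_mul (mk1 x) _.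
have i2 y : int (fun x => a x * k (x, y)) by exact: integrable_bounded_mul (mk2 y) _.
have iF : ((mu \x mu)%E).-integrable setT (EFin \o F).
  apply/integrable12ltyP; first exact/measurable_EFinP.
  apply: (@le_lt_trans _ _ (\int[mu]_x (`|a x| * (M * \int[mu]_y `|b y|))%:E)%E).
    apply: integral_le => [x _|x _]; first exact: integral_ge0.
    rewrite (_ : (_ * (M * _))%:E = \int[mu]_y (`|a x| * (M * `|b y|))%:E)%E.
      apply: integral_le => y _; first exact: abse_ge0.
      rewrite /F /= lee_fin !normrM ler_wpM2l// [leRHS]mulrC ler_wpM2l//.
    rewrite -EFin_Rintegral; last first.
      have ib' : int (fun y => `|b y|) by exact: integrable_norm ib.
      have := integrableZl measurableT (`|a x| * M) ib'.
      by apply: eq_integrable => // y _ /=; rewrite -EFinM mulrA.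
    congr EFin; under [RHS]eq_Rintegral do rewrite mulrA.
    by rewrite RintegralZl//; [rewrite mulrA|exact: integrable_norm ib].
  have ia' : int (fun y => `|a y|) by exact: integrable_norm ia.
  have := integrableZl measurableT (M * \int[mu]_y `|b y|) ia'.
  move=> /integrableP[_]; apply: le_lt_trans.
  apply: integral_le => x _; first by rewrite lee_fin !mulr_ge0// Rintegral_ge0.
  by rewrite -EFinM /= lee_fin mulrC ler_norm.
have := Fubini iF.
rewrite /F /= => FE.
apply: (congr1 fine).
transitivity (\int[mu]_x \int[mu]_y (a x * (b y * k (x, y)))%:E)%E.
  apply: eq_integral => x _; rewrite EFinM EFin_Rintegral//.
  by rewrite -(integralZl measurableT (i1 x)); exact: eq_integral.
rewrite FE; apply: eq_integral => y _; rewrite EFinM EFin_Rintegral//.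
by rewrite -(integralZl measurableT (i2 y)); apply: eq_integral => x _; rewrite -EFinM/= mulrCA.
Qed.

(* [e] stands for [cos] or [sin]. *)
Definition trig_transform e u xi : R := \int[mu]_x (u x * e (x * xi)).
Local Notation tr := trig_transform.

Variable e : R -> R.
Hypotheses (ce : continuous e) (e1 : forall x, `|e x| <= 1).

Let me : measurable_fun setT e.
Proof. exact: continuous_measurable_fun. Qed.

Lemma measurable_trig_scale xi : measurable_fun setT (fun x : R => e (x * xi)).
Proof. by apply: (measurableT_comp me); exact: measurable_funM. Qed.

Lemma integrable_trig u xi : int u -> int (fun x => u x * e (x * xi)).
Proof. by move=> iu; exact: integrable_bounded_mul (measurable_trig_scale _) _. Qed.

Lemma trig_transform_le u xi : int u -> `|tr e u xi| <= \int[mu]_x `|u x|.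
Proof.
move=> iu; apply: le_trans (le_normr_Rintegral _ (integrable_trig xi iu)) _ => //.
apply: le_Rintegral => //; first exact: integrable_norm (integrable_trig xi iu).
  exact: integrable_norm iu.
by move=> x _; rewrite normrM ler_piMr.
Qed.

Lemma continuous_trig_transform u : int u -> continuous (tr e u).
Proof.
move=> iu xi.
have xiI : xi \in `](xi - 1), (xi + 1)[%classic.
  by rewrite inE/= in_itv/=; apply/andP; split; lra.
apply: (@continuity_under_integral _ _ _ mu (fun xi x => u x * e (x * xi)) setT
  measurableT (xi - 1) (xi + 1) _ _ (fun x => `|u x|)) => //.
- by move=> x _; exact: integrable_trig.
- apply: aeW => x _ t _; apply: continuousM; first exact: cvg_cst.
  apply: continuous_comp; last exact: ce.
  by apply: continuousM; [exact: cvg_cst|exact: cvg_id].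
- exact: integrable_norm iu.
- by move=> x _; apply: aeW => y _; rewrite normrM ler_piMr.
Qed.

Lemma measurable_trig_transform u : int u -> measurable_fun setT (tr e u).
Proof. by move=> iu; apply: continuous_measurable_fun; exact: continuous_trig_transform. Qed.

(** The multiplication formula, by symmetry of the kernel e(x y). Passing from a transform to a
    Poisson average always goes through it. *)
Lemma trig_transform_exchange a b : int a -> int b ->
  \int[mu]_x (a x * tr e b x) = \int[mu]_x (b x * tr e a x).
Proof.
move=> ia ib; rewrite /trig_transform.
have mk : measurable_fun setT (fun z : R * R => e (z.1 * z.2)).
  by apply: (measurableT_comp me); exact: measurable_funM.
transitivity (\int[mu]_x (a x * \int[mu]_y (b y * e (x * y)))).
  by apply: eq_Rintegral => x _; congr (_ * _); apply: eq_Rintegral => y _; rewrite mulrC [in LHS]mulrC (mulrC y).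
exact: (@Rintegral_kernel_exchange a b (fun z => e (z.1 * z.2)) 1 ia ib mk).
Qed.

Lemma trig_transformB a b xi : int a -> int b ->
  tr e (fun x => a x - b x) xi = tr e a xi - tr e b xi.
Proof.
move=> ia ib; rewrite /trig_transform.
under eq_Rintegral do rewrite mulrBl.
by rewrite RintegralB//; exact: integrable_trig.
Qed.

End trig_transform.

(** * The Poisson kernel as the transform of a two-sided exponential *)

Section poisson_kernel.
Context {R : realType}.
Local Notation mu := (@lebesgue_measure R).
Local Notation int f := (mu.-integrable [set: R] (EFin \o f)).
Local Notation tr := trig_transform.
Implicit Types (f F : R -> R).

Lemma is_derive_continuous F f : (forall x : R, is_derive x (1 : R) F (f x)) -> continuous F.
Proof.
by move=> dF x; apply: differentiable_continuous; apply/derivable1_diffP; apply: ex_derive.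
Qed.

Lemma integral_FTC2 F f (a b : R) : a < b -> continuous f ->
  (forall x : R, is_derive x (1 : R) F (f x)) ->
  (\int[mu]_(x in `[a, b]) (f x)%:E = (F b - F a)%:E)%E.
Proof.
move=> ab cf dF; have cF := is_derive_continuous dF.
rewrite EFinB; apply: continuous_FTC2 => //.
- exact: continuous_subspaceT.
- split=> [x _| |]; first exact: ex_derive.
  + by apply: cvg_at_right_filter; exact: cF.
  + by apply: cvg_at_left_filter; exact: cF.
- by move=> x _; rewrite derive1E derive_val.
Qed.

Lemma ge0_even_integral_FTC2y F f (l : R) :
  (forall x, 0 <= f x) -> continuous f -> (forall x, f (- x) = f x) ->
  (forall x : R, 0 <= x -> is_derive x (1 : R) F (f x)) -> F x @[x --> +oo%R] --> l ->
  (\int[mu]_x (f x)%:E = (2 * (l - F 0))%:E)%E.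
Proof.
move=> f0 cf fN dF Fl.
rewrite ge0_symfun_integralT//; last by move=> x; rewrite /= fN.
rewrite EFinM; congr (_ * _)%E; rewrite -set_itvcy EFinB.
apply: ge0_continuous_FTC2y => //.
- exact: continuous_subspaceT.
- by move=> x x0; have := dF x (ltW x0) => ?; exact: ex_derive.
- have := dF 0 (lexx _) => ?.
  have : {for 0, continuous F}.
    by apply: differentiable_continuous; apply/derivable1_diffP; apply: ex_derive.
  by move=> ?; exact: cvg_at_right_filter.
- move=> x; rewrite in_itv/= andbT => x0.
  by have := dF x (ltW x0) => ?; rewrite derive1E derive_val.
Qed.

Definition exp_weight (eps x : R) : R := expR (- (eps * `|x|)).
Definition poisson (eps z : R) : R := 2 * eps / (eps ^+ 2 + z ^+ 2).

Lemma continuous_exp_weight eps : continuous (exp_weight eps).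
Proof.
move=> x; apply: continuous_comp; last exact: continuous_expR.
by apply: continuousN; apply: continuousM; [exact: cvg_cst|exact: norm_continuous].
Qed.

Lemma exp_weight_gt0 eps x : 0 < exp_weight eps x.
Proof. exact: expR_gt0. Qed.

Lemma exp_weightN eps x : exp_weight eps (- x) = exp_weight eps x.
Proof. by rewrite /exp_weight normrN. Qed.

Variable eps : R.
Hypothesis eps0 : 0 < eps.

Lemma exp_weight_le1 x : exp_weight eps x <= 1.
Proof. by rewrite /exp_weight -expR0 ler_expR oppr_le0 mulr_ge0// ltW. Qed.

Lemma poisson_denom_gt0 z : 0 < eps ^+ 2 + z ^+ 2.
Proof. by rewrite ltr_pwDl ?exprn_gt0 ?sqr_ge0. Qed.

Lemma poisson_gt0 z : 0 < poisson eps z.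
Proof. by rewrite divr_gt0 ?poisson_denom_gt0// mulr_gt0. Qed.

Lemma poissonN z : poisson eps (- z) = poisson eps z.
Proof. by rewrite /poisson sqrrN. Qed.

Lemma poisson_le z : poisson eps z <= 2 / eps.
Proof.
rewrite /poisson ler_pdivrMr ?poisson_denom_gt0// -mulrA ler_pM2l//.
rewrite mulrDr expr2 mulKf ?gt_eqF// lerDl mulr_ge0// ?sqr_ge0// invr_ge0 ltW//.
Qed.

(** Adding 1 to the cosine makes the integrand nonnegative, so the fundamental theorem on the
    half-line applies before integrability is known; integrability is then read off from the finite
    value. *)
Lemma integral_exp_weight_cos1 z :
  (\int[mu]_x (exp_weight eps x * (1 + cos (x * z)))%:E =
   (2 / eps + poisson eps z)%:E)%E.
Proof.
pose D := eps ^+ 2 + z ^+ 2.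
have D0 : D != 0 by rewrite gt_eqF// poisson_denom_gt0.
have e0 : eps != 0 by rewrite gt_eqF.
(* The second summand is the real part of exp ((- eps + i z) x) / (- eps + i z), an antiderivative
   of exp (- eps x) cos (x z); the first one integrates exp (- eps x). *)
pose F x := expR (- (eps * x)) *
  (- eps^-1 + (z * sin (x * z) - eps * cos (x * z)) / D).
transitivity ((2 * (0 - F 0))%:E); last first.
  congr EFin; rewrite /F !mulr0 !mul0r oppr0 expR0 sin0 cos0 /poisson -/D.
  by field; rewrite D0 e0.
apply: ge0_even_integral_FTC2y.
- by move=> x; apply: mulr_ge0; [exact/ltW/exp_weight_gt0|have := cos_geN1 (x * z); lra].
- move=> x; apply: continuousM; first exact: continuous_exp_weight.
  apply: continuousD; first exact: cvg_cst.
  apply: continuous_comp; last exact: continuous_cos.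
  by apply: continuousM; [exact: cvg_id|exact: cvg_cst].
- by move=> x; rewrite exp_weightN mulNr cosN.
- move=> x x0; rewrite /exp_weight ger0_norm// /F.
  apply: is_derive_eq.
  rewrite /GRing.scale/= /GRing.scale/=.
  rewrite /D; field; rewrite e0.
  by rewrite andbT; exact: D0.
(* [M] bounds the oscillating factor of [F], so [F] is squeezed to 0 at infinity. *)
- pose M := eps^-1 + (`|z| + eps) / D.
  have DD : 0 < D by exact: poisson_denom_gt0.
  have ex0 : expR (- (eps * x)) @[x --> +oo] --> 0.
    apply: (cvg_comp (fun x => eps * x) (fun y => expR (- y))); last exact: cvgr_expR.
    by apply: gt0_cvgMry => //; exact: cvg_id.
  have Mx0 (s : R) : s * expR (- (eps * x)) @[x --> +oo] --> 0.
    by rewrite -[X in _ --> X](mulr0 s); apply: cvgM => //; exact: cvg_cst.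
  apply: (@squeeze_cvgr _ _ _ _ (fun x => - M * expR (- (eps * x)))
            (fun x => M * expR (- (eps * x)))); [|exact: Mx0|exact: Mx0].
  apply: nearW => x; rewrite /F mulNr -ler_norml normrM (ger0_norm (expR_ge0 _)) mulrC.
  rewrite ler_wpM2r ?expR_ge0//.
  apply: (le_trans (ler_normD _ _)); apply: lerD.
    by rewrite normrN ger0_norm// invr_ge0 ltW.
  rewrite normrM normfV (ger0_norm (ltW DD)) ler_wpM2r ?invr_ge0 ?(ltW DD)//.
  rewrite (le_trans (ler_normB _ _))// !normrM (ger0_norm (ltW eps0)).
  apply: lerD; first by rewrite ler_piMr// ler_norml sin_geN1 sin_le1.
  by rewrite ler_piMr// ?(ltW eps0)// ler_norml cos_geN1 cos_le1.
Qed.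

Lemma measurable_exp_weight : measurable_fun setT (exp_weight eps).
Proof. by apply: continuous_measurable_fun; exact: continuous_exp_weight. Qed.

Lemma integrable_exp_weight_cos1 z : int (fun x => exp_weight eps x * (1 + cos (x * z))).
Proof.
apply: ge0_integrable.
- apply: measurable_funM; first exact: measurable_exp_weight.
  apply: measurable_funD => //; apply: (measurable_trig_scale (@continuous_cos R)).
- by move=> x; apply: mulr_ge0; [exact/ltW/exp_weight_gt0|have := cos_geN1 (x * z); lra].
- by rewrite integral_exp_weight_cos1 ltry.
Qed.

Lemma integrable_exp_weight : int (exp_weight eps).
Proof.
apply: (integrable_le (integrable_exp_weight_cos1 0)); first exact: measurable_exp_weight.
move=> x; rewrite mulr0 cos0 ger0_norm ?(ltW (exp_weight_gt0 _ _))//.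
by have := exp_weight_gt0 eps x; lra.
Qed.

Lemma Rintegral_exp_weight : \int[mu]_x exp_weight eps x = 2 / eps.
Proof.
have := integral_exp_weight_cos1 0.
have i1 := integrable_exp_weight_cos1 0.
rewrite -EFin_Rintegral// => -[].
rewrite (_ : 2 / eps + poisson eps 0 = 2 * (2 / eps)); last first.
  by rewrite /poisson expr0n/= addr0; field; rewrite gt_eqF.
have -> : \int[mu]_x (exp_weight eps x * (1 + cos (x * 0))) =
          2 * \int[mu]_x exp_weight eps x.
  rewrite -RintegralZl//; last exact: integrable_exp_weight.
  by apply: eq_Rintegral => x _; rewrite mulr0 cos0 mulrC.
lra.
Qed.

Lemma normr_cos_le1 (x : R) : `|cos x| <= 1.
Proof. by rewrite ler_norml cos_geN1 cos_le1. Qed.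

Lemma normr_sin_le1 (x : R) : `|sin x| <= 1.
Proof. by rewrite ler_norml sin_geN1 sin_le1. Qed.

Lemma cos_transform_exp_weight z : tr cos (exp_weight eps) z = poisson eps z.
Proof.
have := integral_exp_weight_cos1 z.
rewrite -EFin_Rintegral; last exact: integrable_exp_weight_cos1.
move=> -[]; under eq_Rintegral do rewrite mulrDr mulr1.
rewrite RintegralD//; last 2 first.
  exact: integrable_exp_weight.
  exact: (integrable_trig (@continuous_cos R) normr_cos_le1 z integrable_exp_weight).
by rewrite Rintegral_exp_weight => /addrI.
Qed.

Lemma sin_transform_exp_weight z : tr sin (exp_weight eps) z = 0.
Proof.
apply: Rintegral_odd.
  exact: (integrable_trig (@continuous_sin R) normr_sin_le1 z integrable_exp_weight).
by move=> x; rewrite exp_weightN mulNr sinN mulrN.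
Qed.

Lemma continuous_poisson : continuous (poisson eps).
Proof.
have : continuous (fun z : R => 2 * eps * (eps ^+ 2 + z ^+ 2)^-1); last by [].
move=> z; apply: cvgM; first exact: cvg_cst.
apply: cvgV; first by rewrite gt_eqF// poisson_denom_gt0.
apply: cvgD; first exact: cvg_cst.
exact: exprn_continuous.
Qed.

Lemma measurable_poisson : measurable_fun setT (poisson eps).
Proof. by apply: continuous_measurable_fun; exact: continuous_poisson. Qed.

(** An antiderivative is 2 atan (z / eps), with limit pi at infinity and value 0 at 0. *)
Lemma integral_poisson : (\int[mu]_z (poisson eps z)%:E = (2 * pi)%:E)%E.
Proof.
have e0 : eps != 0 by rewrite gt_eqF.
transitivity ((2 * (pi - 2 * atan (eps^-1 * 0)))%:E : \bar R); last first.
  by rewrite mulr0 atan0 mulr0 subr0.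
apply: (@ge0_even_integral_FTC2y (fun z => 2 * atan (eps^-1 * z))).
- by move=> z; rewrite ltW// poisson_gt0.
- exact: continuous_poisson.
- exact: poissonN.
- move=> z _; apply: is_derive_eq.
  rewrite /GRing.scale/= /poisson.
  have : eps ^+ 2 + z ^+ 2 != 0 by rewrite gt_eqF// poisson_denom_gt0.
  by move=> D0; field; rewrite D0 e0.
- rewrite (_ : pi = 2 * (pi / 2)); last by field.
  apply: cvgM; first exact: cvg_cst.
  apply: (cvg_comp (fun z => eps^-1 * z) atan); last exact: cvgy_atan.
  by apply: gt0_cvgMry; [rewrite invr_gt0|exact: cvg_id].
Qed.

Lemma integrable_poisson : int (poisson eps).
Proof.
apply: ge0_integrable; first exact: measurable_poisson.
  by move=> z; rewrite ltW// poisson_gt0.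
by rewrite integral_poisson ltry.
Qed.

End poisson_kernel.

(** * A Bessel inequality for the cosine and sine transforms *)

Section bessel.
Context {R : realType}.
Local Notation mu := (@lebesgue_measure R).
Local Notation int f := (mu.-integrable [set: R] (EFin \o f)).
Local Notation tr := trig_transform.
Implicit Types (u e : R -> R).

(** The transform of the damped wave e(s y) is half the sum of two translated Poisson kernels for
    the cosine and half their difference for the sine. Domination by the half sum is common to both
    and is what Schur's test uses. *)
Definition poisson_dominated e := forall eps x y : R, 0 < eps ->
  `|tr e (fun s => exp_weight eps s * e (s * y)) x| <=
    (poisson eps (x - y) + poisson eps (x + y)) / 2.

(** The product formulas turn cos cos and sin sin into combinations of cos (s (x - y)) and cos (s (x
    + y)); [k] is 1 for the cosine and -1 for the sine. *)
Let exp_weight_cos_sum (eps x y k : R) : 0 < eps ->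
  int (fun s => exp_weight eps s * cos (s * (x - y)) +
     k * (exp_weight eps s * cos (s * (x + y)))) /\
  \int[mu]_s (exp_weight eps s * cos (s * (x - y)) +
     k * (exp_weight eps s * cos (s * (x + y)))) =
  poisson eps (x - y) + k * poisson eps (x + y).
Proof.
move=> e0.
have iw z : int (fun s => exp_weight eps s * cos (s * z)).
  exact: (integrable_trig (@continuous_cos R) (@normr_cos_le1 R) z (integrable_exp_weight e0)).
have kiw : int (fun s => k * (exp_weight eps s * cos (s * (x + y)))).
  by have := integrableZl measurableT k (iw (x + y)).
split; first by have := integrableD measurableT (iw (x - y)) kiw.
by rewrite RintegralD// RintegralZl// -!cos_transform_exp_weight.
Qed.

Lemma cos_transform_weight_cos (eps x y : R) : 0 < eps ->
  tr cos (fun s => exp_weight eps s * cos (s * y)) x =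
    (poisson eps (x - y) + poisson eps (x + y)) / 2.
Proof.
move=> e0; rewrite -(mul1r (poisson _ (x + y))).
have [ic <-] := exp_weight_cos_sum x y 1 e0.
rewrite -RintegralZr//; apply: eq_Rintegral => s _.
by rewrite mulrBr mulrDr cosB cosD; field.
Qed.

Lemma sin_transform_weight_sin (eps x y : R) : 0 < eps ->
  tr sin (fun s => exp_weight eps s * sin (s * y)) x =
    (poisson eps (x - y) - poisson eps (x + y)) / 2.
Proof.
move=> e0; rewrite -(mulN1r (poisson eps (x + y))).
have [ic <-] := exp_weight_cos_sum x y (- 1) e0.
rewrite -RintegralZr//; apply: eq_Rintegral => s _.
by rewrite mulrBr mulrDr cosB cosD; field.
Qed.

Lemma poisson_dominated_cos : poisson_dominated cos.
Proof.
move=> eps x y e0; rewrite cos_transform_weight_cos// ger0_norm//.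
by rewrite divr_ge0// addr_ge0// ltW// poisson_gt0.
Qed.

Lemma poisson_dominated_sin : poisson_dominated sin.
Proof.
move=> eps x y e0; rewrite sin_transform_weight_sin//.
have := poisson_gt0 e0 (x - y); have := poisson_gt0 e0 (x + y).
rewrite ler_norml => h1 h2; apply/andP; split; lra.
Qed.

Variable e : R -> R.
Hypotheses (ce : continuous e) (e1 : forall x, `|e x| <= 1).
Hypothesis eP : poisson_dominated e.

Let int_sqr u : \bar R := (\int[mu]_x (u x ^+ 2)%:E)%E.

Let kernel (eps y x : R) := (poisson eps (x - y) + poisson eps (x + y)) / 2.

Let kernel_ge0 eps y x : 0 < eps -> 0 <= kernel eps y x.
Proof. by move=> e0; rewrite divr_ge0// addr_ge0// ltW// poisson_gt0. Qed.

Let mkernel eps : 0 < eps -> measurable_fun setT (fun z : R * R => kernel eps z.1 z.2).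
Proof.
move=> e0; apply: measurable_funM => //; apply: measurable_funD.
  by apply: (measurableT_comp (measurable_poisson e0)); exact: measurable_funB.
by apply: (measurableT_comp (measurable_poisson e0)); exact: measurable_funD.
Qed.

Let integral_kernel eps y : 0 < eps ->
  (\int[mu]_x (kernel eps y x)%:E = (2 * pi)%:E)%E.
Proof.
move=> e0.
have mP a : measurable_fun setT (fun x : R => (poisson eps (x + a))%:E).
  apply/measurable_EFinP; apply: (measurableT_comp (measurable_poisson e0)).
  exact: measurable_funD.
have P0 x a : (0 <= (poisson eps (x + a))%:E)%E by rewrite lee_fin ltW// poisson_gt0.
have shiftP a : (\int[mu]_x (poisson eps (x + a))%:E = (2 * pi)%:E)%E.
  rewrite (@integral_shift _ (EFin \o poisson eps)) ?integral_poisson//.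
  by apply/measurable_EFinP; exact: measurable_poisson.
under eq_integral do rewrite /kernel mulrC EFinM EFinD.
rewrite ge0_integralZl//; last 2 first.
- exact: emeasurable_funD (mP _) (mP _).
- by move=> x _; rewrite adde_ge0.
rewrite ge0_integralD//; [|exact: mP|exact: mP].
transitivity ((2^-1)%:E * ((2 * pi)%:E + (2 * pi)%:E) : \bar R)%E.
  by congr (_ * (_ + _))%E; exact: shiftP.
by rewrite -EFinD -EFinM; congr EFin; field.
Qed.

(** Schur's test: |u(y) u(x)| is at most the mean of u(y)^2 and u(x)^2. In each half the kernel is
    integrated over the other variable and contributes its mass 2 pi; Tonelli and the symmetry of
    the kernel make the two halves equal. *)
Let kernel_tonelli u eps : measurable_fun setT u -> 0 < eps ->
  (\int[mu]_y \int[mu]_x (`|u y| * (`|u x| * kernel eps y x))%:E <=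
   (2 * pi)%:E * int_sqr u)%E.
Proof.
move=> mu_ e0.
pose f1 (z : R * R) := (2^-1 * (u z.1 ^+ 2 * kernel eps z.1 z.2))%:E.
pose f2 (z : R * R) := (2^-1 * (u z.2 ^+ 2 * kernel eps z.1 z.2))%:E.
have mf1 : measurable_fun setT f1.
  apply/measurable_EFinP; apply: measurable_funM => //; apply: measurable_funM; last exact: mkernel.
  by apply: measurable_funX; exact: (measurableT_comp mu_).
have mf2 : measurable_fun setT f2.
  apply/measurable_EFinP; apply: measurable_funM => //; apply: measurable_funM; last exact: mkernel.
  by apply: measurable_funX; exact: (measurableT_comp mu_).
have f10 z : (0 <= f1 z)%E by rewrite /f1 lee_fin; apply: mulr_ge0; rewrite ?invr_ge0//; apply: mulr_ge0; [exact: sqr_ge0|exact: kernel_ge0].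
have f20 z : (0 <= f2 z)%E by rewrite /f2 lee_fin; apply: mulr_ge0; rewrite ?invr_ge0//; apply: mulr_ge0; [exact: sqr_ge0|exact: kernel_ge0].
have mu2 : measurable_fun setT (fun y => (u y ^+ 2)%:E).
  by apply/measurable_EFinP; exact: measurable_funX.
have E1 : (\int[mu]_y \int[mu]_x f1 (y, x) = pi%:E * int_sqr u)%E.
  rewrite /int_sqr -ge0_integralZl//; last 2 first.
  - by move=> x _; rewrite lee_fin sqr_ge0.
  - by rewrite lee_fin pi_ge0.
  apply: eq_integral => y _; rewrite /f1 /=.
  under eq_integral do rewrite mulrA EFinM.
  rewrite ge0_integralZl//.
  - by rewrite integral_kernel// -!EFinM; congr EFin; field.
  - apply/measurable_EFinP; apply: (measurableT_comp (mkernel e0) (g := fun x => (y, x))).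
    exact: measurable_pair1.
  - by move=> x _; rewrite lee_fin kernel_ge0.
  - by rewrite lee_fin mulr_ge0 ?sqr_ge0.
have E2 : (\int[mu]_y \int[mu]_x f2 (y, x) = pi%:E * int_sqr u)%E.
  rewrite (@fubini_tonelli _ _ _ _ _ mu mu f2 mf2 f20) -E1.
  apply: eq_integral => x _; apply: eq_integral => y _; rewrite /f1 /f2 /kernel /=.
  by rewrite -(poissonN _ (y - x)) opprB (addrC y).
apply: (@le_trans _ _ (\int[mu]_y \int[mu]_x (f1 (y, x) + f2 (y, x)))%E).
  apply: integral_le => y _.
    by apply: integral_ge0 => x _; rewrite lee_fin; apply: mulr_ge0 => //; apply: mulr_ge0 => //; exact: kernel_ge0.
  apply: integral_le => x _; first by rewrite lee_fin; apply: mulr_ge0 => //; apply: mulr_ge0 => //; exact: kernel_ge0.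
  rewrite /f1 /f2 -EFinD lee_fin /=; move: (kernel_ge0 y x e0); set k := kernel _ _ _ => k0.
  have : `|u y| * `|u x| <= 2^-1 * u y ^+ 2 + 2^-1 * u x ^+ 2.
    rewrite -(real_normK (num_real (u y))) -(real_normK (num_real (u x))).
    by have := sqr_ge0 (`|u y| - `|u x|); rewrite sqrrB; lra.
  by move=> /(ler_wpM2r k0); rewrite mulrDl !mulrA.
rewrite (_ : (2 * pi)%:E * int_sqr u = pi%:E * int_sqr u + pi%:E * int_sqr u)%E; last first.
  by rewrite -ge0_muleDl ?lee_fin ?pi_ge0// -EFinD; congr (_%:E * _)%E; ring.
rewrite -{1}E1 -{1}E2 -ge0_integralD//.
- apply: integral_le => y _; first by apply: integral_ge0 => x _; rewrite adde_ge0.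
  rewrite ge0_integralD//.
  + by apply: (measurableT_comp mf1); exact: measurable_pair1.
  + by apply: (measurableT_comp mf2); exact: measurable_pair1.
- by move=> y _; apply: integral_ge0.
- exact: (@measurable_fun_fubini_tonelli_F _ _ _ _ _ mu f1 mf1 f10).
- by move=> y _; apply: integral_ge0.
- exact: (@measurable_fun_fubini_tonelli_F _ _ _ _ _ mu f2 mf2 f20).
Qed.

(** With A the damped transform of u, the left side is the pairing of A with the transform of u. One
    exchange turns it into the pairing of u with the transform of A; a second one writes that
    transform as the integral of u against the transform of a damped wave, which the kernel
    dominates. *)
Let damped_bessel u eps : int u -> 0 < eps ->
  (\int[mu]_xi (tr e u xi ^+ 2 * exp_weight eps xi)%:E <= (2 * pi)%:E * int_sqr u)%E.
Proof.
move=> iu e0.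
have mu_ := measurable_integrable iu.
have mU := measurable_trig_transform ce e1 iu.
pose A xi := exp_weight eps xi * tr e u xi.
have iA : int A.
  exact: integrable_bounded_mul (integrable_exp_weight e0) mU (fun xi => trig_transform_le ce e1 xi iu).
have AUE : (\int[mu]_xi (tr e u xi ^+ 2 * exp_weight eps xi)%:E =
   (\int[mu]_xi (A xi * tr e u xi))%:E)%E.
  rewrite EFin_Rintegral; last first.
    exact: integrable_bounded_mul iA mU (fun xi => trig_transform_le ce e1 xi iu).
  by apply: eq_integral => x _; congr EFin; rewrite /A; ring.
rewrite AUE trig_transform_exchange//.
have trA y : `|tr e A y| <= \int[mu]_x (`|u x| * kernel eps y x).
  have iw : int (fun s => exp_weight eps s * e (s * y)).
    exact: integrable_trig (integrable_exp_weight e0).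
  have -> : tr e A y = \int[mu]_x (u x * tr e (fun s => exp_weight eps s * e (s * y)) x).
    rewrite -trig_transform_exchange//; apply: eq_Rintegral => s _.
    by rewrite /A; ring.
  have mk : measurable_fun setT (fun x => kernel eps y x).
    by apply: (measurableT_comp (mkernel e0) (g := fun x => (y, x))); exact: measurable_pair1.
  have ik : int (fun x => `|u x| * kernel eps y x).
    apply: (@integrable_bounded_mul _ _ _ (2 / eps)) => //; first exact: integrable_norm iu.
    move=> x; rewrite ger0_norm ?kernel_ge0// /kernel.
    by have := poisson_le e0 (x - y); have := poisson_le e0 (x + y); lra.
  have ib : int (fun x => u x * tr e (fun s => exp_weight eps s * e (s * y)) x).
    exact: integrable_bounded_mul iu (measurable_trig_transform ce e1 iw) (fun xi => trig_transform_le ce e1 xi iw).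
  apply: (le_trans (le_normr_Rintegral _ ib)) => //.
  apply: le_Rintegral => //; first exact: integrable_norm ib.
  by move=> x _; rewrite normrM ler_wpM2l//; exact: eP.
have iub : int (fun y => u y * tr e A y).
  exact: integrable_bounded_mul iu (measurable_trig_transform ce e1 iA) (fun xi => trig_transform_le ce e1 xi iA).
apply: le_trans (kernel_tonelli mu_ e0).
apply: (@le_trans _ _ (`|\int[mu]_x (u x * tr e A x)|%:E)%E).
  by rewrite lee_fin ler_norm.
rewrite EFin_normr_Rintegral//; apply: (le_trans (le_abse_integral _ _ _)) => //.
  exact: measurable_int iub.
apply: integral_le => y _ /=; first by rewrite lee_fin.
have mk : measurable_fun setT (fun x => kernel eps y x).
  by apply: (measurableT_comp (mkernel e0) (g := fun x => (y, x))); exact: measurable_pair1.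
have ik : int (fun x => `|u x| * kernel eps y x).
  apply: (@integrable_bounded_mul _ _ _ (2 / eps)) => //; first exact: integrable_norm iu.
  move=> x; rewrite ger0_norm ?kernel_ge0// /kernel.
  by have := poisson_le e0 (x - y); have := poisson_le e0 (x + y); lra.
under eq_integral do rewrite EFinM.
rewrite integralZl// -EFin_Rintegral// -EFinM lee_fin normrM.
by apply: ler_wpM2l => //; exact: trA.
Qed.

(* Damped by [exp_weight eps], the square of the transform of [u] integrates to
   a quadratic form in [u] dominated by a symmetric kernel of total mass 2 pi in
   each variable; Schur's test bounds it, uniformly in [eps]. *)
Lemma trig_transform_bessel u : int u ->
  (\int[mu]_xi (tr e u xi ^+ 2)%:E <= (2 * pi)%:E * \int[mu]_x (u x ^+ 2)%:E)%E.
Proof.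
move=> iu.
have mU := measurable_trig_transform ce e1 iu.
(* The weights with eps = 1 / (n + 1) increase to 1, so monotone convergence removes the damping
   while the bound stays the same. *)
pose g (n : nat) xi := (tr e u xi ^+ 2 * exp_weight n.+1%:R^-1 xi)%:E.
have gU xi : limn (g ^~ xi) = (tr e u xi ^+ 2)%:E.
  apply/cvg_lim => //; apply/cvg_EFin; first exact: nearW.
  rewrite -[X in _ --> X]mulr1; apply: cvgM; first exact: cvg_cst.
  rewrite /exp_weight -[X in _ --> X]expR0.
  apply: continuous_cvg; first exact: continuous_expR.
  rewrite -[X in _ --> X]oppr0; apply: cvgN.
  rewrite -[X in _ --> X](mul0r `|xi|); apply: cvgM; last exact: cvg_cst.
  exact: cvg_harmonic.
under eq_integral do rewrite -gU.
rewrite monotone_convergence//.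
- apply: lime_le; last first.
    by apply: nearW => n; apply: damped_bessel => //; rewrite invr_gt0.
  apply: ereal_nondecreasing_is_cvgn => m n mn; apply: integral_le => x _.
    by rewrite lee_fin mulr_ge0 ?sqr_ge0// ltW// exp_weight_gt0.
  rewrite lee_fin ler_wpM2l ?sqr_ge0// ler_expR lerN2 ler_wpM2r//.
  by rewrite lef_pV2 ?posrE// ler_nat.
- move=> n; apply/measurable_EFinP; apply: measurable_funM; first exact: measurable_funX.
  exact: measurable_exp_weight.
- by move=> n x _; rewrite lee_fin mulr_ge0 ?sqr_ge0// ltW// exp_weight_gt0.
- move=> x _ m n mn.
  rewrite lee_fin ler_wpM2l ?sqr_ge0// ler_expR lerN2 ler_wpM2r//.
  by rewrite lef_pV2 ?posrE// ler_nat.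
Qed.

End bessel.

(** * The Fourier transform on L^2 *)

Section complex_square_norm.
Context {R : realType}.
Local Notation mu := (@lebesgue_measure R).
Local Notation int f := (mu.-integrable [set: R] (EFin \o f)).
Local Notation tr := trig_transform.
Local Notation Re := (@complex.Re R).
Local Notation Im := (@complex.Im R).
Implicit Types (f g h : R -> R[i]).

(** Convergence to 0 for nonnegative extended reals, in a form where infinite early terms are
    harmless and domination passes through directly. *)
Definition vanishing (u : nat -> \bar R) : Prop :=
  forall e : R, 0 < e -> \forall n \near \oo, (u n <= e%:E)%E.

Lemma vanishing_le2 (u v w : nat -> \bar R) (k : R) : 0 <= k ->
  (forall n, (w n <= k%:E * (u n + v n))%E) ->
  vanishing u -> vanishing v -> vanishing w.
Proof.
move=> k0 wuv u0 v0 e e0.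
have e'0 : 0 < e / (2 * (k + 1)) by rewrite divr_gt0// mulr_gt0// ltr_wpDl.
near=> n; apply: (le_trans (wuv n)).
apply: (@le_trans _ _ (k%:E * (e / (2 * (k + 1)) + e / (2 * (k + 1)))%:E)%E).
  rewrite lee_wpmul2l// EFinD leeD//; near: n; [exact: u0|exact: v0].
rewrite -EFinM lee_fin (_ : k * _ = e * (k / (k + 1))); last first.
  by field; rewrite gt_eqF// ltr_wpDl.
by rewrite ler_piMr ?(ltW e0)// ler_pdivrMr ?ltr_wpDl// mul1r lerDl.
Unshelve. all: end_near. Qed.

Lemma vanishing_le (u w : nat -> \bar R) (k : R) : 0 <= k ->
  (forall n, (w n <= k%:E * u n)%E) -> vanishing u -> vanishing w.
Proof.
move=> k0 wu u0; apply: (@vanishing_le2 u (fun=> 0%E) w k) => //.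
  by move=> n; rewrite adde0.
by move=> e e0; apply: nearW => n; rewrite lee_fin ltW.
Qed.

Lemma vanishing_cst_eq0 (x : \bar R) : (0 <= x)%E -> vanishing (fun=> x) -> x = 0%E.
Proof.
move=> x0 vx; apply/eqP; rewrite eq_le x0 andbT.
apply/lee_addgt0Pr => e e0; rewrite add0e.
by have [n _ /(_ n (leqnn n))] := vx e e0.
Qed.

Lemma vanishingP (u : nat -> \bar R) : (forall n, (0 <= u n)%E) ->
  u @ \oo --> 0%E <-> vanishing u.
Proof.
move=> u0; split=> [ucvg e e0|uv].
  have := ucvg; move=> /fine_cvgP[ufin /cvgrPdist_le /(_ e e0) ue].
  near=> n; rewrite -(@fineK _ (u n)); last by near: n.
  have : `|0 - fine (u n)| <= e by near: n.
  by rewrite sub0r normrN lee_fin; apply: le_trans; exact: ler_norm.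
have ufin : \forall n \near \oo, u n \is a fin_num.
  near=> n; rewrite ge0_fin_numE//; apply: (@le_lt_trans _ _ 1%:E); last exact: ltry.
  by near: n; exact: uv.
apply/fine_cvgP; split => //; apply/cvgrPdist_le => e e0.
near=> n; rewrite /= sub0r normrN ger0_norm ?fine_ge0//.
rewrite -lee_fin fineK; last by near: n.
by near: n; exact: uv.
Unshelve. all: end_near. Qed.

(** The square of the L^2 norm; working with squares keeps every estimate an inequality between
    integrals. *)
Definition sqnorm f : \bar R :=
  (\int[mu]_x (Re (f x) ^+ 2 + Im (f x) ^+ 2)%:E)%E.

Lemma sqnorm_ge0 f : (0 <= sqnorm f)%E.
Proof. by apply: integral_ge0 => x _; rewrite lee_fin addr_ge0// sqr_ge0. Qed.

Lemma normc_sqr (z : R[i]) : Normc.normc z ^+ 2 = Re z ^+ 2 + Im z ^+ 2.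
Proof. by case: z => a b /=; rewrite sqr_sqrtr// addr_ge0// sqr_ge0. Qed.

Lemma normc_ge0 (z : R[i]) : 0 <= Normc.normc z.
Proof. by case: z => a b /=; exact: sqrtr_ge0. Qed.

Lemma normr_Re_le (z : R[i]) : `|Re z| <= Normc.normc z.
Proof.
rewrite -(ler_pXn2r (n := 2))// ?nnegrE ?normc_ge0// normc_sqr real_normK ?num_real//.
by rewrite lerDl sqr_ge0.
Qed.

Lemma normr_Im_le (z : R[i]) : `|Im z| <= Normc.normc z.
Proof.
rewrite -(ler_pXn2r (n := 2))// ?nnegrE ?normc_ge0// normc_sqr real_normK ?num_real//.
by rewrite lerDr sqr_ge0.
Qed.

Lemma normc_le_ReIm (z : R[i]) : Normc.normc z <= `|Re z| + `|Im z|.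
Proof.
rewrite -(ler_pXn2r (n := 2))// ?nnegrE ?normc_ge0 ?addr_ge0// normc_sqr.
rewrite sqrrD !real_normK ?num_real//.
by have : 0 <= `|Re z| * `|Im z| by []; lra.
Qed.

Lemma Lp_norm2E f : Lp_norm 2%:E f = sqrte (sqnorm f).
Proof.
rewrite /Lp_norm Lnorm.unlock poweR12_sqrt; last first.
  by apply: integral_ge0 => x _; exact: poweR_ge0.
congr sqrte; apply: eq_integral => x _ /=.
by rewrite powR_mulrn// real_normK ?num_real// normc_sqr.
Qed.

Lemma Lp_norm2_sqr f : (Lp_norm 2%:E f ^+ 2 = sqnorm f)%E.
Proof. by rewrite Lp_norm2E sqr_sqrte// sqnorm_ge0. Qed.

Lemma Lp_norm2_cvg0P (F : nat -> R -> R[i]) :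
  Lp_norm 2%:E (F n) @[n --> \oo] --> 0%E <-> vanishing (sqnorm \o F).
Proof.
rewrite vanishingP; last by move=> n; rewrite Lp_norm2E sqrte_ge0.
split=> v e e0.
- have s0 : 0 < Num.sqrt e by rewrite sqrtr_gt0.
  have := v _ s0; apply: filterS => n; rewrite Lp_norm2E.
  by rewrite -[(Num.sqrt e)%:E]/(sqrte e%:E) lee_sqrt// ?sqnorm_ge0// lee_fin ltW.
- have s0 : 0 < e ^+ 2 by rewrite exprn_gt0.
  have := v _ s0; apply: filterS => n /= sn; rewrite Lp_norm2E.
  rewrite -[e]ger0_norm ?(ltW e0)// -sqrtr_sqr -[(Num.sqrt _)%:E]/(sqrte (e ^+ 2)%:E).
  by rewrite lee_sqrt// ?sqnorm_ge0// lee_fin ltW.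
Qed.

Definition measurableC f := measurable_fun setT (Re \o f) /\ measurable_fun setT (Im \o f).

Lemma measurable_normc f : measurableC f ->
  measurable_fun setT (@Normc.normc R \o f).
Proof.
move=> [mRe mIm].
rewrite (_ : _ \o _ = fun x => Num.sqrt ((Re \o f) x ^+ 2 + (Im \o f) x ^+ 2)); last first.
  by apply/funext => x /=; case: (f x).
have ms : measurable_fun setT (@Num.sqrt R).
  by apply: continuous_measurable_fun; exact: sqrt_continuous.
apply: (measurableT_comp ms).
by apply: measurable_funD; exact: measurable_funX.
Qed.

Lemma Lp_space2P f : Lp_space 2%:E f <-> measurableC f /\ (sqnorm f < +oo)%E.
Proof.
have E : (Lp_norm 2%:E f < +oo <-> sqnorm f < +oo)%E.
  by rewrite Lp_norm2E; case: (sqnorm f) (sqnorm_ge0 f) => [r| |]; rewrite ?ltry.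
by split=> [[mRe mIm /E]|[[mRe mIm] /E]].
Qed.

Lemma Lp_space1P f : Lp_space 1%:E f <-> int (Re \o f) /\ int (Im \o f).
Proof.
split=> [[mRe mIm]|[iRe iIm]].
- rewrite /Lp_norm Lnorm1 => foo.
  have iN : int (@Normc.normc R \o f).
    apply: ge0_integrable; first exact: measurable_normc.
      by move=> x; exact: normc_ge0.
    apply: le_lt_trans foo; apply: integral_le => x _.
      by rewrite lee_fin normc_ge0.
    by rewrite /= lee_fin ler_norm.
  split; apply: (integrable_le iN) => // x; [exact: normr_Re_le|exact: normr_Im_le].
- have [mRe mIm] := (measurable_integrable iRe, measurable_integrable iIm).
  split=> //; rewrite /Lp_norm Lnorm1.
  have iRI : int (fun x => `|Re (f x)| + `|Im (f x)|).
    by have := integrableD measurableT (integrable_norm iRe) (integrable_norm iIm).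
  move/integrableP : iRI => [_]; apply: le_lt_trans; apply: integral_le => x _.
    exact: abse_ge0.
  rewrite /= lee_fin ger0_norm ?normc_ge0// ger0_norm ?addr_ge0//.
  exact: normc_le_ReIm.
Qed.

Lemma ReB (z w : R[i]) : Re (z - w) = Re z - Re w.
Proof. by case: z; case: w. Qed.

Lemma ImB (z w : R[i]) : Im (z - w) = Im z - Im w.
Proof. by case: z; case: w. Qed.

Lemma measurableCB f g : measurableC f -> measurableC g -> measurableC (fun x => f x - g x).
Proof.
move=> [fR fI] [gR gI]; split.
- rewrite (_ : _ \o _ = (Re \o f) \- (Re \o g)); first exact: measurable_funB.
  by apply/funext => x /=; rewrite ReB.
- rewrite (_ : _ \o _ = (Im \o f) \- (Im \o g)); first exact: measurable_funB.
  by apply/funext => x /=; rewrite ImB.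
Qed.

Lemma measurable_sqnorm f : measurableC f ->
  measurable_fun setT (fun x => (Re (f x) ^+ 2 + Im (f x) ^+ 2)%:E).
Proof.
move=> [mR mI]; apply/measurable_EFinP; apply: measurable_funD.
  exact: (measurable_funX 2 mR).
exact: (measurable_funX 2 mI).
Qed.

(** (a - b)^2 <= 2 a^2 + 2 b^2 pointwise. This weak triangle inequality is enough to carry limits
    equal to 0. *)
Lemma sqnormB_le f g h : measurableC g -> measurableC h ->
  (forall x, f x = g x - h x) -> (sqnorm f <= 2%:E * (sqnorm g + sqnorm h))%E.
Proof.
move=> mg mh fE.
have mg2 := measurable_sqnorm mg; have mh2 := measurable_sqnorm mh.
have p0 (k : R -> R[i]) x : (0 <= (Re (k x) ^+ 2 + Im (k x) ^+ 2)%:E)%E.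
  by rewrite lee_fin addr_ge0// sqr_ge0.
rewrite /sqnorm -ge0_integralD//.
rewrite -ge0_integralZl//; last 2 first.
- exact: emeasurable_funD.
- by move=> x _; rewrite adde_ge0.
apply: integral_le => x _; first exact: p0.
rewrite -EFinD -EFinM lee_fin fE ReB ImB.
have := sqr_ge0 (Re (g x) + Re (h x)); have := sqr_ge0 (Im (g x) + Im (h x)).
rewrite !sqrrD !sqrrN; lra.
Qed.

Lemma Re_fourier f xi : Lp_space 1%:E f ->
  Re (fourier f xi) = tr cos (Re \o f) xi + tr sin (Im \o f) xi.
Proof.
move=> /Lp_space1P[iR iI] /=.
rewrite /trig_transform -RintegralD//=; last 2 first.
- exact: (integrable_trig (@continuous_cos R) (@normr_cos_le1 R)).
- exact: (integrable_trig (@continuous_sin R) (@normr_sin_le1 R)).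
apply: eq_Rintegral => x _; rewrite /expi cosN sinN.
by case: (f x) => a b /=; rewrite mulrN opprK.
Qed.

Lemma Im_fourier f xi : Lp_space 1%:E f ->
  Im (fourier f xi) = tr cos (Im \o f) xi - tr sin (Re \o f) xi.
Proof.
move=> /Lp_space1P[iR iI] /=.
rewrite /trig_transform -RintegralB//=; last 2 first.
- exact: (integrable_trig (@continuous_cos R) (@normr_cos_le1 R)).
- exact: (integrable_trig (@continuous_sin R) (@normr_sin_le1 R)).
apply: eq_Rintegral => x _; rewrite /expi cosN sinN.
by case: (f x) => a b /=; rewrite mulrN addrC.
Qed.

Lemma measurable_fourier f : Lp_space 1%:E f -> measurableC (fourier f).
Proof.
move=> f1; have /Lp_space1P[iR iI] := f1.
have mc u : int u -> measurable_fun setT (tr cos u).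
  exact: (measurable_trig_transform (@continuous_cos R) (@normr_cos_le1 R)).
have ms u : int u -> measurable_fun setT (tr sin u).
  exact: (measurable_trig_transform (@continuous_sin R) (@normr_sin_le1 R)).
split.
- rewrite (_ : _ \o _ = tr cos (Re \o f) \+ tr sin (Im \o f)).
    by apply: measurable_funD; [exact: mc|exact: ms].
  by apply/funext => xi; exact: Re_fourier.
- rewrite (_ : _ \o _ = tr cos (Im \o f) \- tr sin (Re \o f)).
    by apply: measurable_funB; [exact: mc|exact: ms].
  by apply/funext => xi; exact: Im_fourier.
Qed.

Lemma Lp_space1B f g : Lp_space 1%:E f -> Lp_space 1%:E g ->
  Lp_space 1%:E (fun x => f x - g x).
Proof.
move=> /Lp_space1P[fR fI] /Lp_space1P[gR gI]; apply/Lp_space1P; split.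
- have := integrableB measurableT fR gR; apply: eq_integrable => // x _ /=.
  by rewrite ReB EFinB.
- have := integrableB measurableT fI gI; apply: eq_integrable => // x _ /=.
  by rewrite ImB EFinB.
Qed.

Lemma fourierB f g xi : Lp_space 1%:E f -> Lp_space 1%:E g ->
  fourier (fun x => f x - g x) xi = fourier f xi - fourier g xi.
Proof.
move=> f1 g1; have fg1 := Lp_space1B f1 g1.
have /Lp_space1P[fR fI] := f1; have /Lp_space1P[gR gI] := g1.
apply/eqP; rewrite eq_complex ReB ImB; apply/andP; split; apply/eqP.
- rewrite !Re_fourier//.
  rewrite (_ : Re \o _ = fun x => (Re \o f) x - (Re \o g) x); last first.
    by apply/funext => x /=; rewrite ReB.
  rewrite (_ : Im \o _ = fun x => (Im \o f) x - (Im \o g) x); last first.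
    by apply/funext => x /=; rewrite ImB.
  rewrite (trig_transformB (@continuous_cos R) (@normr_cos_le1 R))//.
  by rewrite (trig_transformB (@continuous_sin R) (@normr_sin_le1 R))//; ring.
- rewrite !Im_fourier//.
  rewrite (_ : Re \o _ = fun x => (Re \o f) x - (Re \o g) x); last first.
    by apply/funext => x /=; rewrite ReB.
  rewrite (_ : Im \o _ = fun x => (Im \o f) x - (Im \o g) x); last first.
    by apply/funext => x /=; rewrite ImB.
  rewrite (trig_transformB (@continuous_cos R) (@normr_cos_le1 R))//.
  by rewrite (trig_transformB (@continuous_sin R) (@normr_sin_le1 R))//; ring.
Qed.

Lemma sqnormE f : measurableC f -> (sqnorm f =
  \int[mu]_x (Re (f x) ^+ 2)%:E + \int[mu]_x (Im (f x) ^+ 2)%:E)%E.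
Proof.
move=> [mR mI]; rewrite -ge0_integralD//.
- by move=> x _; rewrite lee_fin sqr_ge0.
- by apply/measurable_EFinP; exact: (measurable_funX 2 mR).
- by move=> x _; rewrite lee_fin sqr_ge0.
- by apply/measurable_EFinP; exact: (measurable_funX 2 mI).
Qed.

(** Real and imaginary part of the transform are each a sum of two real transforms up to sign.
    Squaring costs a factor 2, and each real function enters through its cosine and its sine
    transform, each with constant 2 pi; hence 8 pi. *)
Lemma fourier_bessel f : Lp_space 1%:E f ->
  (sqnorm (fourier f) <= (8 * pi)%:E * sqnorm f)%E.
Proof.
move=> f1; have /Lp_space1P[iR iI] := f1.
have mR := measurable_integrable iR; have mI := measurable_integrable iI.
have bc u : int u -> (\int[mu]_xi (tr cos u xi ^+ 2)%:E <= (2 * pi)%:E * \int[mu]_x (u x ^+ 2)%:E)%E.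
  exact: (trig_transform_bessel (@continuous_cos R) (@normr_cos_le1 R) (@poisson_dominated_cos R)).
have bs u : int u -> (\int[mu]_xi (tr sin u xi ^+ 2)%:E <= (2 * pi)%:E * \int[mu]_x (u x ^+ 2)%:E)%E.
  exact: (trig_transform_bessel (@continuous_sin R) (@normr_sin_le1 R) (@poisson_dominated_sin R)).
have mc u : int u -> measurable_fun setT (fun x => (tr cos u x ^+ 2)%:E).
  move=> iu; apply/measurable_EFinP; apply: measurable_funX.
  exact: (measurable_trig_transform (@continuous_cos R) (@normr_cos_le1 R)).
have ms u : int u -> measurable_fun setT (fun x => (tr sin u x ^+ 2)%:E).
  move=> iu; apply/measurable_EFinP; apply: measurable_funX.
  exact: (measurable_trig_transform (@continuous_sin R) (@normr_sin_le1 R)).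
have p0 (u : R -> R) x : (0 <= (u x ^+ 2)%:E)%E by rewrite lee_fin sqr_ge0.
pose a := (\int[mu]_x (Re (f x) ^+ 2)%:E)%E; pose b := (\int[mu]_x (Im (f x) ^+ 2)%:E)%E.
(* Sum of the squares of the four real transforms; twice [S] dominates the squared modulus of the
   transform of [f]. *)
pose S x := (((tr cos (Re \o f) x ^+ 2)%:E + (tr sin (Re \o f) x ^+ 2)%:E) +
  ((tr cos (Im \o f) x ^+ 2)%:E + (tr sin (Im \o f) x ^+ 2)%:E))%E.
have b2 u : int u -> (\int[mu]_x ((tr cos u x ^+ 2)%:E + (tr sin u x ^+ 2)%:E) <=
    (4 * pi)%:E * \int[mu]_x (u x ^+ 2)%:E)%E.
  move=> iu; rewrite (_ : 4 * pi = 2 * (2 * pi)) ?EFinM -?muleA; last by ring.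
  rewrite [X in (_ <= _ * X)%E]muleA -EFinM ge0_integralD//; [|exact: mc|exact: ms].
  by rewrite mule_natl mule2n; apply: leeD; [exact: bc|exact: bs].
have SE : (\int[mu]_x S x <= (4 * pi)%:E * sqnorm f)%E.
  rewrite sqnormE// -/a -/b /S ge0_integralD//; last 4 first.
  - by move=> x _; rewrite adde_ge0//; exact: p0.
  - by apply: emeasurable_funD; [exact: mc|exact: ms].
  - by move=> x _; rewrite adde_ge0//; exact: p0.
  - by apply: emeasurable_funD; [exact: mc|exact: ms].
  have a0 : (0 <= a)%E by apply: integral_ge0 => x _; exact: (p0 (Re \o f)).
  have b0 : (0 <= b)%E by apply: integral_ge0 => x _; exact: (p0 (Im \o f)).
  by rewrite (ge0_muleDr _ a0 b0); apply: leeD; exact: b2.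
have -> : ((8 * pi)%:E * sqnorm f = 2%:E * ((4 * pi)%:E * sqnorm f))%E.
  by rewrite muleA -EFinM; congr (_%:E * _)%E; ring.
apply: (@le_trans _ _ (2%:E * \int[mu]_x S x)%E); last by rewrite lee_wpmul2l.
rewrite -ge0_integralZl//; last 2 first.
- apply: emeasurable_funD; apply: emeasurable_funD; [exact: mc|exact: ms|exact: mc|exact: ms].
- by move=> x _; rewrite !adde_ge0//; exact: p0.
apply: integral_le => x _; first by rewrite lee_fin addr_ge0// sqr_ge0.
rewrite /S -!EFinD -EFinM lee_fin Re_fourier// Im_fourier//.
set A := tr cos _ x; set B := tr sin _ x; set C := tr cos _ x; set D := tr sin _ x.
have := sqr_ge0 (A - B); have := sqr_ge0 (C + D).
rewrite !sqrrD !sqrrN; lra.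
Qed.

End complex_square_norm.

(** * L^2 transforms of differences, null functions and translates *)

Section L2_fourier_theory.
Context {R : realType}.
Local Notation mu := (@lebesgue_measure R).
Local Notation int f := (mu.-integrable [set: R] (EFin \o f)).
Local Notation Re := (@complex.Re R).
Local Notation Im := (@complex.Im R).
Implicit Types (f g h : R -> R[i]).

Lemma Lp_space2B f g : Lp_space 2%:E f -> Lp_space 2%:E g ->
  Lp_space 2%:E (fun x => f x - g x).
Proof.
move=> /Lp_space2P[mf foo] /Lp_space2P[mg goo]; apply/Lp_space2P.
split; first exact: measurableCB.
apply: (le_lt_trans (sqnormB_le mf mg (fun=> erefl))).
by rewrite lte_mul_pinfty// lte_add_pinfty.
Qed.

(** The differences of the approximants approximate. Through this, uniqueness questions reduce to
    transforms of null functions. *)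
Lemma L2_fourierB f1 g1 f2 g2 : L2_fourier f1 g1 -> L2_fourier f2 g2 ->
  L2_fourier (fun x => f1 x - f2 x) (fun xi => g1 xi - g2 xi).
Proof.
move=> [Lf1 Lg1 [F1 [LF1 /Lp_norm2_cvg0P F1f /Lp_norm2_cvg0P F1g]]].
move=> [Lf2 Lg2 [F2 [LF2 /Lp_norm2_cvg0P F2f /Lp_norm2_cvg0P F2g]]].
have mC f : Lp_space 2%:E f -> measurableC f by move=> /Lp_space2P[].
split; [exact: Lp_space2B|exact: Lp_space2B|].
exists (fun n x => F1 n x - F2 n x); split.
- by move=> n; split; [apply: Lp_space1B; [exact: (LF1 n).1|exact: (LF2 n).1]|
     apply: Lp_space2B; [exact: (LF1 n).2|exact: (LF2 n).2]].
- apply/Lp_norm2_cvg0P; apply: (vanishing_le2 (k := 2) _ _ F1f F2f) => // n /=.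
  apply: sqnormB_le.
  + by apply: measurableCB; apply: mC => //; exact: (LF1 n).2.
  + by apply: measurableCB; apply: mC => //; exact: (LF2 n).2.
  + by move=> x; ring.
- apply/Lp_norm2_cvg0P; apply: (vanishing_le2 (k := 2) _ _ F1g F2g) => // n /=.
  have mF1 := measurable_fourier (LF1 n).1; have mF2 := measurable_fourier (LF2 n).1.
  apply: sqnormB_le.
  + by apply: measurableCB => //; exact: mC.
  + by apply: measurableCB => //; exact: mC.
  + by move=> x; rewrite fourierB; [ring|exact: (LF1 n).1|exact: (LF2 n).1].
Qed.

Lemma sqnormN f : sqnorm (fun x => 0 - f x) = sqnorm f.
Proof. by apply: eq_integral => x _; rewrite ReB ImB !sub0r !sqrrN. Qed.

Lemma measurableC_cst (z : R[i]) : measurableC (fun=> z).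
Proof. by split; exact: measurable_cst. Qed.

(** If f is null, its approximants tend to 0 in L^2; by the Bessel inequality so do their
    transforms, whose limit is g. Hence an L^2 transform is determined almost everywhere by its
    function. *)
Lemma L2_fourier_eq0 f g : L2_fourier f g -> sqnorm f = 0%E -> sqnorm g = 0%E.
Proof.
move=> [/Lp_space2P[mf _] /Lp_space2P[mg _] [F [LF /Lp_norm2_cvg0P Ff /Lp_norm2_cvg0P Fg]]] f0.
have mF n : measurableC (F n) by have /Lp_space2P[] := (LF n).2.
have mFF n := measurable_fourier (LF n).1.
have mNf : measurableC (fun x => 0 - f x).
  by apply: measurableCB => //; exact: measurableC_cst.
have F0 : vanishing (sqnorm \o F).
  apply: (vanishing_le (k := 2) _ _ Ff) => // n /=.
  rewrite -[X in (_ <= _ * X)%E]adde0 -f0 -(sqnormN f).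
  by apply: sqnormB_le => //; [exact: measurableCB|move=> x; ring].
have FF0 : vanishing (fun n => sqnorm (fourier (F n))).
  apply: (vanishing_le (k := 8 * pi) _ _ F0); first by rewrite mulr_ge0// pi_ge0.
  by move=> n; apply: fourier_bessel; exact: (LF n).1.
apply: vanishing_cst_eq0; first exact: sqnorm_ge0.
apply: (vanishing_le2 (k := 2) _ _ FF0 Fg) => // n /=.
by apply: sqnormB_le => //; [exact: measurableCB|move=> x; ring].
Qed.

Lemma expiD (x y : R) : expi (x + y) = expi x * expi y.
Proof.
rewrite /expi cosD sinD; apply/eqP; rewrite eq_complex /= eqxx/=.
by apply/eqP; ring.
Qed.

Lemma normc_expi (x : R) : Normc.normc (expi x) = 1.
Proof. by rewrite /expi /= cos2Dsin2 sqrtr1. Qed.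

Lemma sqnorm_mul_expi g (w : R -> R) : sqnorm (fun x => g x * expi (w x)) = sqnorm g.
Proof.
apply: eq_integral => x _.
by rewrite -!normc_sqr Normc.normcM normc_expi mulr1.
Qed.

Lemma measurableC_mul_expi g a : measurableC g -> measurableC (fun x => g x * expi (a * x)).
Proof.
move=> [mR mI].
have mc : measurable_fun setT (fun x : R => cos (a * x)).
  apply: (measurableT_comp (continuous_measurable_fun (@continuous_cos R))).
  exact: measurable_funM.
have ms : measurable_fun setT (fun x : R => sin (a * x)).
  apply: (measurableT_comp (continuous_measurable_fun (@continuous_sin R))).
  exact: measurable_funM.
split.
- rewrite (_ : _ \o _ = fun x => (Re \o g) x * cos (a * x) - (Im \o g) x * sin (a * x)).
    by apply: measurable_funB; exact: measurable_funM.
  by apply/funext => x /=; case: (g x).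
- rewrite (_ : _ \o _ = fun x => (Re \o g) x * sin (a * x) + (Im \o g) x * cos (a * x)).
    by apply: measurable_funD; exact: measurable_funM.
  by apply/funext => x /=; case: (g x).
Qed.

Lemma measurable_shift (u : R -> R) (a : R) : measurable_fun setT u ->
  measurable_fun setT (fun x : R => u (x + a)).
Proof. by move=> mu_; apply: (measurableT_comp mu_); exact: measurable_funD. Qed.

Lemma sqnorm_shift f a : measurableC f -> sqnorm (fun x => f (x + a)) = sqnorm f.
Proof. by move=> mf; exact: (integral_shift a (measurable_sqnorm mf)). Qed.

Lemma measurableC_shift f a : measurableC f -> measurableC (fun x => f (x + a)).
Proof. by move=> [mR mI]; split; [exact: (measurable_shift a mR)|exact: (measurable_shift a mI)]. Qed.

Lemma Lp_space1_shift f a : Lp_space 1%:E f -> Lp_space 1%:E (fun x => f (x + a)).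
Proof.
move=> /Lp_space1P[iR iI]; apply/Lp_space1P.
by split; [have := integrable_shift a iR|have := integrable_shift a iI].
Qed.

Lemma Lp_space2_shift f a : Lp_space 2%:E f -> Lp_space 2%:E (fun x => f (x + a)).
Proof.
move=> /Lp_space2P[mf foo]; apply/Lp_space2P.
by rewrite sqnorm_shift//; split => //; exact: measurableC_shift.
Qed.

Lemma CintegralZr f (z : R[i]) : Lp_space 1%:E f ->
  Cintegral (fun x => f x * z) = Cintegral f * z.
Proof.
move=> /Lp_space1P[iR iI]; case: z => a b.
have iaR := integrableZr measurableT a iR; have ibR := integrableZr measurableT b iR.
have iaI := integrableZr measurableT a iI; have ibI := integrableZr measurableT b iI.
have RE : \int[mu]_x Re (f x * (a +i* b)) = \int[mu]_x Re (f x) * a - \int[mu]_x Im (f x) * b.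
  rewrite -RintegralZr// -RintegralZr// -RintegralB//.
  by apply: eq_Rintegral => x _; case: (f x).
have IE : \int[mu]_x Im (f x * (a +i* b)) = \int[mu]_x Re (f x) * b + \int[mu]_x Im (f x) * a.
  rewrite -RintegralZr// -RintegralZr// -RintegralD//.
  by apply: eq_Rintegral => x _; case: (f x).
by rewrite /Cintegral RE IE.
Qed.

Lemma Lp_space1_mul_expi f a : Lp_space 1%:E f -> Lp_space 1%:E (fun x => f x * expi (a * x)).
Proof.
move=> [mR mI foo]; have [mR' mI'] := measurableC_mul_expi a (conj mR mI).
split => //; rewrite /Lp_norm Lnorm1; move: foo; rewrite /Lp_norm Lnorm1.
apply: le_lt_trans; apply: integral_le => x _; first exact: abse_ge0.
by rewrite /= Normc.normcM normc_expi mulr1.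
Qed.

Lemma fourier_shift f a xi : Lp_space 1%:E f ->
  fourier (fun x => f (x + a)) xi = fourier f xi * expi (a * xi).
Proof.
move=> f1; have f1e := Lp_space1_mul_expi (- xi) f1.
have f1' : Lp_space 1%:E (fun x => f x * expi (- (x * xi))).
  rewrite (_ : (fun x => _) = fun x => f x * expi (- xi * x))//.
  by apply/funext => x; rewrite mulNr (mulrC xi).
have mC : measurableC (fun x => f x * expi (- (x * xi)) * expi (a * xi)).
  have /Lp_space1P[iR iI] := f1'.
  have mC' := conj (measurable_integrable iR) (measurable_integrable iI).
  have [mR mI] := mC'.
  split; rewrite /comp.
  - rewrite (_ : (fun x => _) = fun x => Re (f x * expi (- (x * xi))) * cos (a * xi) -
      Im (f x * expi (- (x * xi))) * sin (a * xi)).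
      by apply: measurable_funB; exact: measurable_funM.
    by apply/funext => x; case: (f x * expi (- (x * xi))).
  - rewrite (_ : (fun x => _) = fun x => Re (f x * expi (- (x * xi))) * sin (a * xi) +
      Im (f x * expi (- (x * xi))) * cos (a * xi)).
      by apply: measurable_funD; exact: measurable_funM.
    by apply/funext => x; case: (f x * expi (- (x * xi))).
rewrite /fourier -CintegralZr//.
have E x : f (x + a) * expi (- (x * xi)) =
    (fun y => f y * expi (- (y * xi)) * expi (a * xi)) (x + a).
  by rewrite -mulrA -expiD; congr (_ * expi _); ring.
rewrite /Cintegral; congr (_ +i* _).
- rewrite -[RHS](Rintegral_shift a mC.1).
  by apply: eq_Rintegral => x _; rewrite E.
- rewrite -[RHS](Rintegral_shift a mC.2).
  by apply: eq_Rintegral => x _; rewrite E.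
Qed.

(** The factor exp (i a xi) has modulus 1, so translating the approximants keeps both
    convergences. *)
Lemma L2_fourier_shift f g a : L2_fourier f g ->
  L2_fourier (fun x => f (x + a)) (fun xi => g xi * expi (a * xi)).
Proof.
move=> [Lf Lg [F [LF /Lp_norm2_cvg0P Ff /Lp_norm2_cvg0P Fg]]].
have /Lp_space2P[mf foo] := Lf; have /Lp_space2P[mg goo] := Lg.
split; first exact: Lp_space2_shift.
  by apply/Lp_space2P; split; [exact: measurableC_mul_expi|rewrite sqnorm_mul_expi].
exists (fun n x => F n (x + a)); split.
- by move=> n; split; [apply: Lp_space1_shift; exact: (LF n).1|
    apply: Lp_space2_shift; exact: (LF n).2].
- apply/Lp_norm2_cvg0P; move: Ff; congr vanishing; apply/funext => n /=.
  rewrite -(@sqnorm_shift (fun x => F n x - f x) a)//.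
  by apply: measurableCB => //; have /Lp_space2P[] := (LF n).2.
- apply/Lp_norm2_cvg0P; move: Fg; congr vanishing; apply/funext => n /=.
  rewrite -(sqnorm_mul_expi _ (fun xi => a * xi)); congr sqnorm; apply/funext => xi.
  by rewrite fourier_shift; [rewrite mulrBl|exact: (LF n).1].
Qed.

End L2_fourier_theory.

(** * Uniqueness and inversion *)

Section inversion.
Context {R : realType}.
Local Notation mu := (@lebesgue_measure R).
Local Notation int f := (mu.-integrable [set: R] (EFin \o f)).
Local Notation tr := trig_transform.
Local Notation Re := (@complex.Re R).
Local Notation Im := (@complex.Im R).
Implicit Types (a u v w : R -> R) (f g : R -> R[i]).

Local Notation sqint u := (\int[mu]_x (u x ^+ 2)%:E)%E.

(** A linearised Cauchy-Schwarz inequality. The weight eta is free: a small eta tames a fixed norm,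
    while the large factor 1 / (2 eta) falls on a quantity that tends to 0. *)
Lemma integral_norm_amgm a w (eta : R) : 0 < eta ->
  measurable_fun setT a -> measurable_fun setT w ->
  (\int[mu]_x `|a x * w x|%:E <= (2 * eta)^-1%:E * sqint a + (eta / 2)%:E * sqint w)%E.
Proof.
move=> e0 ma mw.
have p0 (k : R -> R) x : (0 <= (k x ^+ 2)%:E)%E by rewrite lee_fin sqr_ge0.
have m2 (k : R -> R) : measurable_fun setT k -> measurable_fun setT (fun x => (k x ^+ 2)%:E).
  by move=> mk; apply/measurable_EFinP; exact: measurable_funX.
have e20 : 0 <= (2 * eta)^-1 by rewrite invr_ge0 mulr_ge0// ltW.
have e21 : 0 <= eta / 2 by rewrite divr_ge0// ltW.
rewrite -ge0_integralZl//; [|exact: m2].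
rewrite -ge0_integralZl//; [|exact: m2].
rewrite -ge0_integralD//; last 4 first.
- by move=> x _; rewrite mule_ge0.
- by apply: measurable_funeM; exact: m2.
- by move=> x _; rewrite mule_ge0.
- by apply: measurable_funeM; exact: m2.
apply: integral_le => x _; first by rewrite lee_fin.
rewrite -!EFinM -EFinD lee_fin normrM.
rewrite -(real_normK (num_real (a x))) -(real_normK (num_real (w x))).
rewrite -subr_ge0 (_ : _ - _ = (2 * eta)^-1 * (`|a x| - eta * `|w x|) ^+ 2); last first.
  by field; rewrite gt_eqF.
by rewrite mulr_ge0// sqr_ge0.
Qed.

Lemma integrable_mul_L2 a w : measurable_fun setT a -> measurable_fun setT w ->
  (sqint a < +oo)%E -> (sqint w < +oo)%E -> int (fun x => a x * w x).
Proof.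
move=> ma mw aoo woo; apply/integrableP; split.
  by apply/measurable_EFinP; exact: measurable_funM.
apply: (le_lt_trans (integral_norm_amgm ltr01 ma mw)).
by rewrite lte_add_pinfty// lte_mul_pinfty// lee_fin// ?invr_ge0 ?mulr_ge0 ?divr_ge0.
Qed.

Lemma sqint_poisson_fin eps : 0 < eps -> (sqint (@poisson R eps) < +oo)%E.
Proof.
move=> e0; have iP := integrableZl measurableT (2 / eps) (integrable_poisson e0).
move/integrableP : iP => [_]; apply: le_lt_trans; apply: integral_le => x _.
  by rewrite lee_fin sqr_ge0.
have P0 := ltW (poisson_gt0 e0 x).
rewrite -EFinM /= lee_fin ger0_norm; last by apply: mulr_ge0 => //; rewrite divr_ge0// ltW.
by rewrite expr2 ler_wpM2r// poisson_le.
Qed.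

Lemma sqint_exp_weight_fin eps : 0 < eps -> (sqint (@exp_weight R eps) < +oo)%E.
Proof.
move=> e0; have /integrableP[_] := integrable_exp_weight e0.
apply: le_lt_trans; apply: integral_le => x _; first by rewrite lee_fin sqr_ge0.
have P0 := ltW (exp_weight_gt0 eps x).
by rewrite /= lee_fin ger0_norm// expr2 ler_piMl// exp_weight_le1.
Qed.

(* [poisson eps] concentrates at [0]: away from a [delta]-ball it is at most
   [eps (1 + delta^-2)] times [poisson 1]. *)
Lemma poisson_approx_identity u : measurable_fun setT u ->
  int (fun y => u y * poisson 1 y) -> {for 0, continuous u} ->
  \int[mu]_y (u y * poisson n.+1%:R^-1 y) @[n --> \oo] --> 2 * pi * u 0.
Proof.
move=> mu_ iu cu.
have i1 : int (@poisson R 1) by exact: integrable_poisson.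
have id : int (fun y => (u y - u 0) * poisson 1 y).
  have := integrableB measurableT iu (integrableZl measurableT (u 0) i1).
  by apply: eq_integrable => // y _ /=; rewrite mulrBl.
pose K := \int[mu]_y `|(u y - u 0) * poisson 1 y|.
have K0 : 0 <= K by exact: Rintegral_ge0.
apply/cvgrPdist_le => e e0.
(* The part near 0 costs eta times the mass 2 pi of the kernel, that is e / 2; the remaining e / 2
   is left to the tail. *)
pose eta := e / (4 * pi).
have pi0 : 0 < pi :> R by exact: pi_gt0.
have eta0 : 0 < eta by rewrite divr_gt0// mulr_gt0.
have /cvgrPdist_le /(_ eta eta0) [d /= d0 cud] := cu.
pose M := 1 + d ^- 2.
have M0 : 0 < M by rewrite ltr_wpDr// invr_ge0 sqr_ge0.
have bnd (eps y : R) : 0 < eps -> eps <= 1 ->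
    `|(u y - u 0) * poisson eps y| <=
    eta * poisson eps y + eps * M * `|(u y - u 0) * poisson 1 y|.
  move=> ep0 ep1.
  have P0 := poisson_gt0 ep0 y; have P1 := poisson_gt0 (@ltr01 R) y.
  have nM p : 0 < p -> `|(u y - u 0) * p| = `|u y - u 0| * p.
    by move=> p0; rewrite normrM (gtr0_norm p0).
  have [yd|dy] := ltP `|y| d.
    rewrite -[leLHS]addr0 lerD//; last by rewrite !mulr_ge0// ltW.
    rewrite nM// ler_wpM2r// ?(ltW P0)// distrC cud//=.
    by rewrite sub0r normrN.
  rewrite -[leLHS]add0r lerD//; first by rewrite mulr_ge0// ltW.
  rewrite !nM// [leRHS]mulrCA ler_wpM2l//.
  have y20 : 0 < y ^+ 2.
    by rewrite -(real_normK (num_real y)) exprn_gt0// (lt_le_trans d0).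
  have dy2 : 1 <= d ^- 2 * y ^+ 2.
    rewrite mulrC ler_pdivlMr ?exprn_gt0// mul1r -(real_normK (num_real y)).
    by rewrite ler_pXn2r ?nnegrE// ltW.
  rewrite /poisson expr1n mulr1 ler_pdivrMr ?poisson_denom_gt0//.
  rewrite (_ : eps * M * (2 / (1 + y ^+ 2)) * (eps ^+ 2 + y ^+ 2) =
    2 * eps * (M * (eps ^+ 2 + y ^+ 2) / (1 + y ^+ 2))); last first.
    by field; rewrite gt_eqF// ltr_wpDl.
  rewrite ler_peMr ?mulr_ge0 ?(ltW ep0)// ler_pdivlMr ?ltr_wpDl// mul1r /M.
  have : 0 <= d ^- 2 * eps ^+ 2 by rewrite mulr_ge0 ?invr_ge0 ?sqr_ge0.
  have := sqr_ge0 eps; lra.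
have main (eps : R) : 0 < eps -> eps <= 1 ->
   `|2 * pi * u 0 - \int[mu]_y (u y * poisson eps y)| <= eta * (2 * pi) + eps * M * K.
  move=> ep0 ep1.
  have iP := integrable_poisson ep0.
  have idn : int (fun y => `|(u y - u 0) * poisson 1 y|) by have := integrable_norm id.
  have ib : int (fun y => eta * poisson eps y + eps * M * `|(u y - u 0) * poisson 1 y|).
    by have := integrableD measurableT (integrableZl measurableT eta iP)
      (integrableZl measurableT (eps * M) idn).
  have mde : measurable_fun setT (fun y => (u y - u 0) * poisson eps y).
    by apply: measurable_funM; [exact: measurable_funB|exact: measurable_poisson].
  have ide : int (fun y => (u y - u 0) * poisson eps y).
    by apply: (integrable_le ib) => // y; exact: bnd.
  have iuP : int (fun y => u y * poisson eps y).
    have := integrableD measurableT ide (integrableZl measurableT (u 0) iP).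
    by apply: eq_integrable => // y _ /=; rewrite -EFinM -EFinD; congr EFin; ring.
  have IP : \int[mu]_y poisson eps y = 2 * pi by rewrite /Rintegral integral_poisson.
  have -> : 2 * pi * u 0 = \int[mu]_y (u 0 * poisson eps y).
    by rewrite RintegralZl// IP mulrC.
  rewrite distrC -RintegralB//; last by have := integrableZl measurableT (u 0) iP.
  under eq_Rintegral do rewrite -mulrBl.
  apply: (le_trans (le_normr_Rintegral _ ide)) => //.
  apply: (le_trans (le_Rintegral _ _ ib (fun y _ => bnd eps y ep0 ep1))) => //.
    by have := integrable_norm ide.
  rewrite RintegralD//; [|by have := integrableZl measurableT eta iP|
     by have := integrableZl measurableT (eps * M) idn].
  by rewrite RintegralZl// RintegralZl// IP.
have hn : (n.+1%:R^-1 : R) @[n --> \oo] --> 0 by exact: cvg_harmonic.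
(* Adding 1 keeps the denominator positive when [K] is 0. *)
have e1 : 0 < e / (2 * (M * K + 1)).
  by rewrite divr_gt0// mulr_gt0// ltr_wpDl// mulr_ge0// ltW.
have /cvgrPdist_le /(_ _ e1) near1 := hn.
near=> n.
have n0 : 0 < n.+1%:R^-1 :> R by rewrite invr_gt0.
have n1 : n.+1%:R^-1 <= 1 :> R by rewrite invf_le1// ler1n.
have : `|0 - n.+1%:R^-1 : R| <= e / (2 * (M * K + 1)) by near: n.
rewrite sub0r normrN gtr0_norm// => nsmall.
apply: (le_trans (main _ n0 n1)).
have MK0 : 0 <= M * K by rewrite mulr_ge0// ltW.
have : n.+1%:R^-1 * (M * K) <= e / 2.
  apply: (@le_trans _ _ (e / (2 * (M * K + 1)) * (M * K + 1))).
    by apply: ler_pM => //; rewrite lerDl.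
  rewrite le_eqVlt; apply/orP; left; apply/eqP; field.
  by rewrite gt_eqF// ltr_wpDl.
rewrite -mulrA; have -> : eta * (2 * pi) = e / 2.
  have h (p : R) : p != 0 -> e / (4 * p) * (2 * p) = e / 2 by move=> p0; field.
  by apply: h; rewrite gt_eqF.
by move=> ?; rewrite [leRHS]splitr lerD2l.
Unshelve. all: end_near. Qed.

(* Pairing with [exp_weight eps], whose transform is [poisson eps]. *)
Lemma poisson_average_eq0 (u : R -> R) (U V : nat -> R -> R) (s eps : R) :
  0 < eps -> measurable_fun setT u -> (sqint u < +oo)%E ->
  (forall n, [/\ int (U n), int (V n) & (sqint (U n) < +oo)%E]) ->
  vanishing (fun n => sqint (fun x => U n x - u x)) ->
  vanishing (fun n => sqint (fun xi => tr cos (U n) xi + s * tr sin (V n) xi)) ->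
  \int[mu]_x (u x * poisson eps x) = 0.
Proof.
move=> e0 mu_ uoo UV v1 v2.
set I := \int[mu]_x _.
have iw : int (@exp_weight R eps) by exact: integrable_exp_weight.
have mP := measurable_poisson e0; have mW := measurable_exp_weight eps.
have P2 := sqint_poisson_fin e0; have W2 := sqint_exp_weight_fin e0.
pose T := fine (sqint (@poisson R eps)) + fine (sqint (@exp_weight R eps)).
have T0 : 0 <= T by rewrite addr_ge0// fine_ge0// integral_ge0// => x _; rewrite lee_fin sqr_ge0.
have TE : T%:E = (sqint (@exp_weight R eps) + sqint (@poisson R eps))%E.
  rewrite EFinD !fineK ?ge0_fin_numE//; first by rewrite addeC.
  - by apply: integral_ge0 => x _; rewrite lee_fin sqr_ge0.
  - by apply: integral_ge0 => x _; rewrite lee_fin sqr_ge0.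
have key n eta : 0 < eta ->
  (`|I|%:E <= (2 * eta)^-1%:E * (sqint (fun x => U n x - u x)%R +
     sqint (fun xi => tr cos (U n) xi + s * tr sin (V n) xi)%R) + (eta / 2 * T)%:E)%E.
  move=> eta0; have [iU iV Uoo] := UV n.
  have mU := measurable_integrable iU.
  have mc := measurable_trig_transform (@continuous_cos R) (@normr_cos_le1 R) iU.
  have ms := measurable_trig_transform (@continuous_sin R) (@normr_sin_le1 R) iV.
  set d := fun x => U n x - u x; set F := fun xi => tr cos (U n) xi + s * tr sin (V n) xi.
  have md : measurable_fun setT d by exact: measurable_funB.
  have mF : measurable_fun setT F.
    by apply: measurable_funD => //; exact: measurable_funM.
  have iUP : int (fun x => U n x * poisson eps x) by exact: integrable_mul_L2.
  have iuP : int (fun x => u x * poisson eps x) by exact: integrable_mul_L2.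
  have iwc : int (fun x => exp_weight eps x * tr cos (U n) x).
    apply: (@integrable_bounded_mul _ _ _ (\int[mu]_x `|U n x|)) => // x.
    exact: (trig_transform_le (@continuous_cos R) (@normr_cos_le1 R)).
  have iws : int (fun x => exp_weight eps x * tr sin (V n) x).
    apply: (@integrable_bounded_mul _ _ _ (\int[mu]_x `|V n x|)) => // x.
    exact: (trig_transform_le (@continuous_sin R) (@normr_sin_le1 R)).
  have isws : int (fun x => s * (exp_weight eps x * tr sin (V n) x)).
    by have := integrableZl measurableT s iws.
  have iFw : int (fun x => F x * exp_weight eps x).
    have := integrableD measurableT iwc isws.
    by apply: eq_integrable => // x _ /=; rewrite -EFinD /F; congr EFin; ring.
  have idP : int (fun x => d x * poisson eps x).
    have := integrableB measurableT iUP iuP.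
    by apply: eq_integrable => // x _ /=; rewrite -EFinB /d; congr EFin; ring.
  (* The pairing of [U n] with the Poisson kernel is that of its cosine transform with [exp_weight].
     The sine transform of [V n] may be added at no cost, because [exp_weight] is even and its own
     sine transform is 0. *)
  have IE : I = \int[mu]_x (F x * exp_weight eps x) - \int[mu]_x (d x * poisson eps x).
    have -> : \int[mu]_x (F x * exp_weight eps x) = \int[mu]_x (U n x * poisson eps x).
      transitivity (\int[mu]_x (exp_weight eps x * tr cos (U n) x +
                    s * (exp_weight eps x * tr sin (V n) x))).
        by apply: eq_Rintegral => x _; rewrite /F; ring.
      rewrite RintegralD// RintegralZl//.
      rewrite (trig_transform_exchange (@continuous_cos R) (@normr_cos_le1 R))//.
      rewrite (trig_transform_exchange (@continuous_sin R) (@normr_sin_le1 R))//.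
      under eq_Rintegral do rewrite cos_transform_exp_weight//.
      under [X in _ + _ * X]eq_Rintegral do rewrite sin_transform_exp_weight// mulr0.
      by rewrite (_ : \int[mu]_x (0 : R) = 0) ?mulr0 ?addr0// /Rintegral integral0.
    rewrite -RintegralB//; apply: eq_Rintegral => x _; rewrite /d; ring.
  have h1 := integral_norm_amgm eta0 mF mW.
  have h2 := integral_norm_amgm eta0 md mP.
  apply: (@le_trans _ _ (\int[mu]_x `|F x * exp_weight eps x|%:E + \int[mu]_x `|d x * poisson eps x|%:E)%E).
    have iF' : int (fun x => `|F x * exp_weight eps x|) by have := integrable_norm iFw.
    have id' : int (fun x => `|d x * poisson eps x|) by have := integrable_norm idP.
    rewrite -!EFin_Rintegral// -EFinD lee_fin IE (le_trans (ler_normB _ _))//.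
    by apply: lerD; exact: le_normr_Rintegral.
  apply: (le_trans (leeD h1 h2)).
  rewrite addeACA -ge0_muleDr; last 2 first.
  - by apply: integral_ge0 => x _; rewrite lee_fin sqr_ge0.
  - by apply: integral_ge0 => x _; rewrite lee_fin sqr_ge0.
  rewrite [X in (_ * X + _)%E]addeC leeD2l// -ge0_muleDr; last 2 first.
  - by apply: integral_ge0 => x _; rewrite lee_fin sqr_ge0.
  - by apply: integral_ge0 => x _; rewrite lee_fin sqr_ge0.
  by rewrite [in leRHS]EFinM TE.
have : `|I|%:E = 0%E.
  apply: vanishing_cst_eq0; first by rewrite lee_fin.
  move=> e ep.
  (* This keeps the fixed part eta T / 2 below e / 2; [n] is then taken so large that the vanishing
     part, multiplied by 1 / (2 eta), is at most e / 2. *)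
  pose eta := e / (T + 1).
  have eta0 : 0 < eta by rewrite divr_gt0// ltr_wpDl.
  have e'0 : 0 < eta * e / 2 by rewrite divr_gt0// mulr_gt0.
  near \oo => n.
  apply: nearW => _; apply: (le_trans (key n eta eta0)).
  apply: (@le_trans _ _ ((2 * eta)^-1%:E * ((eta * e / 2)%:E + (eta * e / 2)%:E) + (eta / 2 * T)%:E)%E).
    rewrite leeD2r// lee_wpmul2l//; first by rewrite lee_fin invr_ge0; apply: mulr_ge0 => //; exact: ltW.
    by apply: leeD; near: n; [exact: v1|exact: v2].
  rewrite -[leLHS]/(((2 * eta)^-1 * (eta * e / 2 + eta * e / 2) + eta / 2 * T)%:E) lee_fin.
  have -> : (2 * eta)^-1 * (eta * e / 2 + eta * e / 2) = e / 2.
    by field; rewrite gt_eqF.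
  rewrite (_ : eta / 2 * T = e / 2 * (T / (T + 1))); last first.
    by rewrite /eta; field; rewrite gt_eqF// ltr_wpDl.
  have : e / 2 * (T / (T + 1)) <= e / 2.
    rewrite ler_piMr ?divr_ge0 ?(ltW ep)// ler_pdivrMr ?ltr_wpDl// mul1r lerDl//.
  lra.
by move=> -[] /normr0P/eqP.
Unshelve. all: end_near. Qed.

(** Since g is null, the transforms of the approximants tend to 0, so the averages of f against all
    centred Poisson kernels vanish. These averages tend to 2 pi f(0) by continuity at 0. *)
Lemma L2_fourier_at0 f g : L2_fourier f g -> sqnorm g = 0%E ->
  {for 0, continuous (Re \o f)} -> {for 0, continuous (Im \o f)} -> f 0 = 0.
Proof.
move=> [/Lp_space2P[[mR mI] foo] /Lp_space2P[mg _]
  [F [LF /Lp_norm2_cvg0P Ff /Lp_norm2_cvg0P Fg]]] g0 cR cI.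
have mF n : measurableC (F n) by have /Lp_space2P[] := (LF n).2.
have Foo n : (sqnorm (F n) < +oo)%E by have /Lp_space2P[] := (LF n).2.
have mFF n := measurable_fourier (LF n).1.
have FF0 : vanishing (fun n => sqnorm (fourier (F n))).
  apply: (vanishing_le (k := 2) _ _ Fg) => // n /=.
  rewrite -[X in (_ <= _ * X)%E]adde0 -g0 -(sqnormN g).
  apply: sqnormB_le; first exact: measurableCB.
    by apply: measurableCB => //; exact: measurableC_cst.
  by move=> x; ring.
have ReLe (h : R -> R[i]) : (sqint (Re \o h) <= sqnorm h)%E.
  by apply: integral_le => x _; rewrite lee_fin ?sqr_ge0//= lerDl sqr_ge0.
have ImLe (h : R -> R[i]) : (sqint (Im \o h) <= sqnorm h)%E.
  by apply: integral_le => x _; rewrite lee_fin ?sqr_ge0//= lerDr sqr_ge0.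
have L1 n : int (Re \o F n) /\ int (Im \o F n) by exact/Lp_space1P/(LF n).1.
have zero (u : R -> R) : measurable_fun setT u -> (sqint u < +oo)%E -> {for 0, continuous u} ->
    (forall eps, 0 < eps -> \int[mu]_x (u x * poisson eps x) = 0) -> u 0 = 0.
  move=> mu_ uoo cu uP.
  have iu : int (fun y => u y * poisson 1 y).
    by apply: integrable_mul_L2 => //; [exact: measurable_poisson|exact: sqint_poisson_fin].
  have := poisson_approx_identity mu_ iu cu.
  rewrite (_ : (fun n : nat => _) = fun=> 0); last by apply/funext => n; rewrite uP// invr_gt0.
  move=> /(cvg_lim (@Rhausdorff R)); rewrite lim_cst// => /esym/eqP.
  by rewrite !mulf_eq0 pnatr_eq0/= (gt_eqF (pi_gt0 R)) => /eqP.
have R0 : (Re \o f) 0 = 0.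
  apply: zero => //; first exact: le_lt_trans (ReLe f) foo.
  (* The real part of the transform is the cosine transform of the real part plus the sine transform
     of the imaginary part: the sign is 1 here, and -1 for the imaginary part below, where the roles
     are exchanged. *)
  move=> eps e0; apply: (@poisson_average_eq0 _ (fun n => Re \o F n) (fun n => Im \o F n) 1) => //.
  - exact: le_lt_trans (ReLe f) foo.
  - by move=> n; split; [exact: (L1 n).1|exact: (L1 n).2|exact: le_lt_trans (ReLe _) (Foo n)].
  - apply: (vanishing_le (k := 1) _ _ Ff) => // n; rewrite mul1e.
    apply: le_trans (ReLe _); apply: integral_le => x _; first by rewrite lee_fin sqr_ge0.
    by rewrite /= ReB.
  - apply: (vanishing_le (k := 1) _ _ FF0) => // n; rewrite mul1e.
    apply: le_trans (ReLe _); apply: integral_le => x _; first by rewrite lee_fin sqr_ge0.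
    by rewrite [in leRHS]/comp Re_fourier ?mul1r//; exact: (LF n).1.
have I0 : (Im \o f) 0 = 0.
  apply: zero => //; first exact: le_lt_trans (ImLe f) foo.
  move=> eps e0; apply: (@poisson_average_eq0 _ (fun n => Im \o F n) (fun n => Re \o F n) (-1)) => //.
  - exact: le_lt_trans (ImLe f) foo.
  - by move=> n; split; [exact: (L1 n).2|exact: (L1 n).1|exact: le_lt_trans (ImLe _) (Foo n)].
  - apply: (vanishing_le (k := 1) _ _ Ff) => // n; rewrite mul1e.
    apply: le_trans (ImLe _); apply: integral_le => x _; first by rewrite lee_fin sqr_ge0.
    by rewrite /= ImB.
  - apply: (vanishing_le (k := 1) _ _ FF0) => // n; rewrite mul1e.
    apply: le_trans (ImLe _); apply: integral_le => x _; first by rewrite lee_fin sqr_ge0.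
    by rewrite [in leRHS]/comp Im_fourier ?mulN1r//; exact: (LF n).1.
by apply/eqP; rewrite eq_complex; apply/andP; split; apply/eqP.
Qed.

(** A translation moves any point to 0 and only multiplies the transform by a factor of modulus 1,
    so it remains null. *)
Lemma L2_fourier_inj f g : L2_fourier f g -> sqnorm g = 0%E ->
  continuous (Re \o f) -> continuous (Im \o f) -> forall x, f x = 0.
Proof.
move=> fg g0 cR cI x.
have := L2_fourier_at0 (L2_fourier_shift x fg).
rewrite sqnorm_mul_expi => /(_ g0); rewrite add0r; apply.
- apply: (@continuous_comp _ _ _ (fun y => y + x) (Re \o f)); last exact: cR.
  by apply: cvgD; [exact: cvg_id|exact: cvg_cst].
- apply: (@continuous_comp _ _ _ (fun y => y + x) (Im \o f)); last exact: cI.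
  by apply: cvgD; [exact: cvg_id|exact: cvg_cst].
Qed.

End inversion.

(** * The inverse Fourier integral of a real function *)

Section inverse_transform.
Context {R : realType}.
Local Notation mu := (@lebesgue_measure R).
Local Notation int f := (mu.-integrable [set: R] (EFin \o f)).
Local Notation tr := trig_transform.
Local Notation Re := (@complex.Re R).
Local Notation Im := (@complex.Im R).
Local Notation sqint u := (\int[mu]_x (u x ^+ 2)%:E)%E.
Implicit Types (f : R -> R[i]).

Lemma normr_complexE (z : R[i]) : `|z| = (Normc.normc z)%:C.
Proof. by []. Qed.

Lemma continuous_complex f : continuous (Re \o f) -> continuous (Im \o f) ->
  continuous (f : R -> R[i]^o).
Proof.
move=> cR cI x; apply/cvgrPdist_lt => /= -[e e'].
(* In the partial order of [R[i]] a positive element is a positive real. *)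
rewrite ltcE/= => /andP[/eqP -> e0].
have e20 : 0 < e / 2 by rewrite divr_gt0.
have /cvgrPdist_lt /(_ _ e20) nR := cR x.
have /cvgrPdist_lt /(_ _ e20) nI := cI x.
near=> y; rewrite normr_complexE ltcR (le_lt_trans (normc_le_ReIm _))//.
rewrite ReB ImB (splitr e) ltrD//; near: y; [exact: nR|exact: nI].
Unshelve. all: end_near. Qed.

Lemma continuous_Re_Im f : continuous (f : R -> R[i]^o) ->
  continuous (Re \o f) /\ continuous (Im \o f).
Proof.
move=> cf; split=> x; apply/cvgrPdist_lt => e e0.
- have e0' : 0 < (e%:C : R[i]) by rewrite ltcR.
  have /cvgrPdist_lt /(_ _ e0') := cf x.
  apply: filterS => y; rewrite normr_complexE ltcR -ReB.
  exact: le_lt_trans (normr_Re_le _).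
- have e0' : 0 < (e%:C : R[i]) by rewrite ltcR.
  have /cvgrPdist_lt /(_ _ e0') := cf x.
  apply: filterS => y; rewrite normr_complexE ltcR -ImB.
  exact: le_lt_trans (normr_Im_le _).
Qed.

(** (2 pi)^-1 times the integral of g(y) exp (i x y), separated into real and imaginary part. Real g
    suffice, since the transform of a kernel in [Phi] is real on the band. *)
Definition inverse_transform (g : R -> R) x : R[i] :=
  ((2 * pi)^-1 * tr cos g x) +i* ((2 * pi)^-1 * tr sin g x).

Let twopi0 : 0 < (2 * pi)^-1 :> R.
Proof. by rewrite invr_gt0 mulr_gt0// pi_gt0. Qed.

Section integrable.
Variable g : R -> R.
Hypothesis ig : int g.

Let cc : continuous (tr cos g).
Proof. exact: continuous_trig_transform (@continuous_cos R) (@normr_cos_le1 R) _ ig. Qed.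
Let cs : continuous (tr sin g).
Proof. exact: continuous_trig_transform (@continuous_sin R) (@normr_sin_le1 R) _ ig. Qed.

Lemma continuous_inverse_transform :
  continuous (Re \o inverse_transform g) /\ continuous (Im \o inverse_transform g).
Proof.
by split=> x; (apply: cvgM; first exact: cvg_cst); [exact: cc|exact: cs].
Qed.

Lemma measurable_inverse_transform : measurableC (inverse_transform g).
Proof.
have [cR cI] := continuous_inverse_transform.
by split; exact: continuous_measurable_fun.
Qed.

Lemma sqint_trig_scaled (e : R -> R) : continuous e -> (forall x, `|e x| <= 1) ->
  poisson_dominated e ->
  (sqint (fun x => (2 * pi)^-1 * tr e g x)%R <= ((2 * pi)^-1)%:E * sqint g)%E.
Proof.
move=> ce e1 eP.
have mt := measurable_trig_transform ce e1 ig.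
under eq_integral do rewrite exprMn EFinM.
rewrite ge0_integralZl//; last 3 first.
- by apply/measurable_EFinP; exact: measurable_funX.
- by move=> x _; rewrite lee_fin sqr_ge0.
- by rewrite lee_fin sqr_ge0.
apply: (le_trans (lee_wpmul2l _ (trig_transform_bessel ce e1 eP ig))).
  by rewrite lee_fin sqr_ge0.
rewrite muleA -EFinM expr2 -mulrA mulVf ?mulr1//.
by rewrite gt_eqF// mulr_gt0// pi_gt0.
Qed.

Lemma sqnorm_inverse_transform :
  (sqnorm (inverse_transform g) <= (pi^-1)%:E * sqint g)%E.
Proof.
rewrite sqnormE; last exact: measurable_inverse_transform.
have -> : (pi^-1 : R) = (2 * pi)^-1 + (2 * pi)^-1.
  have h (p : R) : p != 0 -> p^-1 = (2 * p)^-1 + (2 * p)^-1 by move=> p0; field.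
  by apply: h; rewrite gt_eqF// pi_gt0.
rewrite EFinD ge0_muleDl ?lee_fin ?(ltW twopi0)//.
apply: leeD.
- exact: (sqint_trig_scaled (@continuous_cos R) (@normr_cos_le1 R) (@poisson_dominated_cos R)).
- exact: (sqint_trig_scaled (@continuous_sin R) (@normr_sin_le1 R) (@poisson_dominated_sin R)).
Qed.

(** After an exchange, the damped cos cos and sin sin transforms appear in a sum, where the kernels
    at y + xi cancel and those at y - xi remain. The mixed cos sin terms are integrals of odd
    functions. The transform of the damped inverse integral is thus a Poisson average of g. *)
Lemma fourier_damped_inverse (eps xi : R) : 0 < eps ->
  let h x := inverse_transform g x * (exp_weight eps x)%:C in
  [/\ Lp_space 1%:E h,
    Re (fourier h xi) = (2 * pi)^-1 * \int[mu]_y (g y * poisson eps (y - xi))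
  & Im (fourier h xi) = 0].
Proof.
move=> e0 h.
have iw : int (@exp_weight R eps) by exact: integrable_exp_weight.
have cos1 := @normr_cos_le1 R; have sin1 := @normr_sin_le1 R.
have ccos := @continuous_cos R; have csin := @continuous_sin R.
have mc : measurable_fun setT (tr cos g) by exact: measurable_trig_transform.
have ms : measurable_fun setT (tr sin g) by exact: measurable_trig_transform.
have bc := trig_transform_le ccos cos1 _ ig.
have bs := trig_transform_le csin sin1 _ ig.
have ReH : Re \o h = fun x => (2 * pi)^-1 * (exp_weight eps x * tr cos g x).
  by apply/funext => x /=; rewrite mulr0 subr0; ring.
have ImH : Im \o h = fun x => (2 * pi)^-1 * (exp_weight eps x * tr sin g x).
  by apply/funext => x /=; rewrite mulr0 add0r; ring.
have iwc : int (fun x => exp_weight eps x * tr cos g x).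
  exact: integrable_bounded_mul iw mc bc.
have iws : int (fun x => exp_weight eps x * tr sin g x).
  exact: integrable_bounded_mul iw ms bs.
have h1 : Lp_space 1%:E h.
  apply/Lp_space1P; rewrite ReH ImH; split.
  - by have := integrableZl measurableT (2 * pi)^-1 iwc.
  - by have := integrableZl measurableT (2 * pi)^-1 iws.
have iwC : int (fun s => exp_weight eps s * cos (s * xi)) by exact: integrable_trig.
have iwS : int (fun s => exp_weight eps s * sin (s * xi)) by exact: integrable_trig.
have swap (e e' : R -> R) : continuous e -> (forall x, `|e x| <= 1) ->
    continuous e' -> (forall x, `|e' x| <= 1) ->
    tr e' (fun x => (2 * pi)^-1 * (exp_weight eps x * tr e g x)) xi =
    (2 * pi)^-1 * \int[mu]_y (g y * tr e (fun s => exp_weight eps s * e' (s * xi)) y).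
  move=> ce e1 ce' e1'.
  have iwe' : int (fun s => exp_weight eps s * e' (s * xi)) by exact: integrable_trig.
  rewrite -(trig_transform_exchange ce e1)// -RintegralZl//; last first.
    apply: integrable_bounded_mul (iwe') _ (fun x => trig_transform_le ce e1 x ig).
    exact: measurable_trig_transform.
  by apply: eq_Rintegral => x _; ring.
have ip : int (fun y => g y * poisson eps (y - xi)).
  apply: (@integrable_bounded_mul _ _ _ (2 / eps)) => //.
    apply: (measurableT_comp (measurable_poisson e0)); exact: measurable_funB.
  by move=> x; rewrite ger0_norm ?poisson_le// ltW// poisson_gt0.
have igt (e e' : R -> R) : continuous e -> (forall x, `|e x| <= 1) ->
    continuous e' -> (forall x, `|e' x| <= 1) ->
    int (fun y => g y * tr e (fun s => exp_weight eps s * e' (s * xi)) y).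
  move=> ce e1 ce' e1'.
  have iwe' : int (fun s => exp_weight eps s * e' (s * xi)) by exact: integrable_trig.
  apply: integrable_bounded_mul ig _ (fun x => trig_transform_le ce e1 x iwe').
  exact: measurable_trig_transform.
split => //.
- rewrite Re_fourier// ReH ImH (swap cos cos)// (swap sin sin)// -mulrDr; congr (_ * _).
  rewrite -RintegralD//; [|exact: igt|exact: igt].
  apply: eq_Rintegral => y _.
  by rewrite cos_transform_weight_cos// sin_transform_weight_sin//; field.
- rewrite Im_fourier// ReH ImH (swap sin cos)// (swap cos sin)// -mulrBr.
  have z1 y : tr sin (fun s => exp_weight eps s * cos (s * xi)) y = 0.
    apply: Rintegral_odd; first exact: integrable_trig.
    by move=> s; rewrite exp_weightN !mulNr cosN sinN mulrN.
  have z2 y : tr cos (fun s => exp_weight eps s * sin (s * xi)) y = 0.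
    apply: Rintegral_odd; first exact: integrable_trig.
    by move=> s; rewrite exp_weightN !mulNr cosN sinN mulrN mulNr.
  rewrite -RintegralB//; [|exact: igt|exact: igt].
  rewrite (_ : \int[mu]_y _ = 0) ?mulr0//.
  transitivity (\int[mu]_y (0 : R)); last by rewrite /Rintegral integral0.
  by apply: eq_Rintegral => y _; rewrite z1 z2 mulr0 subr0.
Qed.

End integrable.
End inverse_transform.

(** * Fourier inversion for a bounded function on a band, continuous off its edges *)

Section band_limited.
Context {R : realType}.
Local Notation mu := (@lebesgue_measure R).
Local Notation int f := (mu.-integrable [set: R] (EFin \o f)).
Local Notation Re := (@complex.Re R).
Local Notation Im := (@complex.Im R).
Local Notation sqint u := (\int[mu]_x (u x ^+ 2)%:E)%E.

Variables (c M : R) (g : R -> R).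
Hypotheses (c0 : 0 < c) (M0 : 0 <= M).
Hypothesis mg : measurable_fun setT g.
Hypothesis gM : forall x, `|g x| <= M.
Hypothesis g0 : forall x, c < `|x| -> g x = 0.
Hypothesis cg : forall x, `|x| != c -> {for x, continuous g}.

(** On the band 1 + x^2 is at most 1 + c^2. Multiples of [poisson 1], that is of 2 / (1 + x^2),
    serve as the common integrable majorants. *)
Lemma band_le x : `|g x| <= M * (1 + c ^+ 2) / 2 * poisson 1 x.
Proof.
have x1 : 0 < 1 + x ^+ 2 by rewrite ltr_wpDr// sqr_ge0.
have -> : M * (1 + c ^+ 2) / 2 * poisson 1 x = M * ((1 + c ^+ 2) / (1 + x ^+ 2)).
  by rewrite /poisson expr1n; field; rewrite gt_eqF.
have [xc|cx] := leP `|x| c; last first.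
  by rewrite g0// normr0 mulr_ge0// divr_ge0 ?(ltW x1)// addr_ge0// sqr_ge0.
apply: (le_trans (gM x)); rewrite ler_peMr// ler_pdivlMr// mul1r lerD2l.
by rewrite -(real_normK (num_real x)) ler_pXn2r ?nnegrE// ltW.
Qed.

Lemma integrable_band : int g.
Proof.
have i1 : int (fun x => M * (1 + c ^+ 2) / 2 * poisson 1 x).
  by have := integrableZl measurableT (M * (1 + c ^+ 2) / 2) (integrable_poisson (@ltr01 R)).
by apply: (integrable_le i1) => //; exact: band_le.
Qed.

Lemma sqint_band_fin : (sqint g < +oo)%E.
Proof.
have := integrableZl measurableT M (integrable_norm integrable_band).
move=> /integrableP[_]; apply: le_lt_trans; apply: integral_le => x _.
  by rewrite lee_fin sqr_ge0.
rewrite -EFinM /= lee_fin ger0_norm ?mulr_ge0// -(real_normK (num_real (g x))) expr2.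
by rewrite ler_wpM2r.
Qed.

Let h := inverse_transform g.
Let w n : R -> R := exp_weight n.+1%:R^-1.
Let hn n x := h x * (w n x)%:C.
Let A n xi := (2 * pi)^-1 * \int[mu]_y (g y * poisson n.+1%:R^-1 (y - xi)).

Let eps0 n : 0 < n.+1%:R^-1 :> R.
Proof. by rewrite invr_gt0. Qed.

Let mh : measurableC h.
Proof. exact: measurable_inverse_transform integrable_band. Qed.

Let hn_sqr n x : Re (hn n x) ^+ 2 + Im (hn n x) ^+ 2 =
  (Re (h x) ^+ 2 + Im (h x) ^+ 2) * w n x ^+ 2.
Proof. by rewrite /hn; case: (h x) => a b /=; ring. Qed.

Let hoo : (sqnorm h < +oo)%E.
Proof.
apply: (le_lt_trans (sqnorm_inverse_transform integrable_band)).
by rewrite lte_mul_pinfty ?sqint_band_fin// lee_fin invr_ge0 pi_ge0.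
Qed.

Let hn1 n : Lp_space 1%:E (hn n).
Proof. by have [] := fourier_damped_inverse integrable_band 0 (eps0 n). Qed.

Let hn2 n : Lp_space 2%:E (hn n).
Proof.
apply/Lp_space2P; split; first by have /Lp_space1P[iR iI] := hn1 n; split; exact: measurable_integrable.
apply: le_lt_trans hoo; apply: integral_le => x _.
  by rewrite lee_fin addr_ge0// sqr_ge0.
rewrite lee_fin hn_sqr ler_piMr ?addr_ge0 ?sqr_ge0//.
by rewrite expr_le1// ?exp_weight_le1// ltW// exp_weight_gt0.
Qed.

Let cvg_w x : w n x @[n --> \oo] --> (1 : R).
Proof.
rewrite /w /exp_weight -[X in _ --> X]expR0.
apply: continuous_cvg; first exact: continuous_expR.
rewrite -[X in _ --> X]oppr0; apply: cvgN.
rewrite -[X in _ --> X](mul0r `|x|); apply: cvgM; last exact: cvg_cst.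
exact: cvg_harmonic.
Qed.

(** Dominated convergence: the squared error is |h|^2 (w - 1)^2, at most |h|^2 because the weight
    lies between 0 and 1. *)
Let hn_cvg : vanishing (fun n => sqnorm (fun x => hn n x - h x)).
Proof.
apply/vanishingP; first by move=> n; exact: sqnorm_ge0.
pose F x := (Re (h x) ^+ 2 + Im (h x) ^+ 2)%:E.
have E n x : Re (hn n x - h x) ^+ 2 + Im (hn n x - h x) ^+ 2 =
    (Re (h x) ^+ 2 + Im (h x) ^+ 2) * (w n x - 1) ^+ 2.
  by rewrite /hn; case: (h x) => a b /=; ring.
have mF : measurable_fun setT F by exact: measurable_sqnorm.
have F0 x : (0 <= F x)%E by rewrite lee_fin addr_ge0// sqr_ge0.
have := @dominated_convergence _ _ R mu setT measurableT
  (fun n x => (Re (hn n x - h x) ^+ 2 + Im (hn n x - h x) ^+ 2)%:E) (cst 0%E) F.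
move=> [].
- move=> n; apply: measurable_sqnorm; apply: measurableCB => //.
  by have /Lp_space2P[] := hn2 n.
- exact: measurable_cst.
- apply: aeW => x _.
  have C : (Re (h x) ^+ 2 + Im (h x) ^+ 2) * (w n x - 1) ^+ 2 @[n --> \oo] --> (0 : R).
    rewrite -[X in _ --> X](mulr0 (Re (h x) ^+ 2 + Im (h x) ^+ 2)).
    apply: cvgM; first exact: cvg_cst.
    rewrite (_ : 0 = (1 - 1) * (1 - 1) :> R); last by rewrite subrr mulr0.
    by apply: cvgM; apply: cvgB; by [exact: cvg_w|exact: cvg_cst].
  rewrite (_ : (fun n => _) = EFin \o (fun n => (Re (h x) ^+ 2 + Im (h x) ^+ 2) * (w n x - 1) ^+ 2)).
    by apply/cvg_EFin; [exact: nearW|exact: C].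
  by apply/funext => n /=; rewrite E.
- by apply/integrableP; split => //; under eq_integral do rewrite gee0_abs//.
- apply: aeW => x n _; rewrite E lee_fin.
  rewrite ger0_norm; last by rewrite mulr_ge0 ?sqr_ge0// addr_ge0// sqr_ge0.
  rewrite ler_piMr ?addr_ge0 ?sqr_ge0// -sqrrN opprB.
  rewrite expr_le1// ?subr_ge0 ?exp_weight_le1// lerBlDr lerDl.
  by rewrite ltW// exp_weight_gt0.
- by move=> _ _; rewrite integral0.
Qed.

Let G : R := \int[mu]_y `|g y|.
(** In the estimate of the Poisson averages, the first summand comes from the bound [M] and the mass
    2 pi of the kernel, the second from z^2 poisson eps z <= 2, valid for eps <= 1. *)
Let K : R := (2 * pi)^-1 * (2 * (1 + c ^+ 2) * M * (2 * pi) + 4 * G).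

Let twopi0 : 0 < 2 * pi :> R.
Proof. by rewrite mulr_gt0// pi_gt0. Qed.

Let K0 : 0 <= K.
Proof.
have p0 := twopi0; have G0 : 0 <= G by exact: Rintegral_ge0.
apply: mulr_ge0; first by rewrite invr_ge0 ltW.
apply: addr_ge0; last exact: mulr_ge0.
apply: mulr_ge0; last exact: ltW.
by rewrite !mulr_ge0// addr_ge0// sqr_ge0.
Qed.

(* [1 + xi^2 <= 2 (1 + y^2) + 2 (y - xi)^2], and [z^2 poisson eps z <= 2 eps]. *)
Let A_le n xi : `|A n xi| <= K / 2 * poisson 1 xi.
Proof.
set e := n.+1%:R^-1 : R; have e0 : 0 < e by exact: eps0.
have e1 : e <= 1 by rewrite invf_le1// ler1n.
have ig := integrable_band; have iP := integrable_poisson e0.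
have iPs : int (fun y => poisson e (y - xi)) by have := integrable_shift (- xi) iP.
have ign : int (fun y => `|g y|) by have := integrable_norm ig.
have mPs := measurable_integrable iPs.
have bP z : `|poisson e z| <= 2 / e by rewrite gtr0_norm ?poisson_le// poisson_gt0.
have igP : int (fun y => g y * poisson e (y - xi)).
  by apply: integrable_bounded_mul ig mPs _ => y; exact: bP.
have x1 : 0 < 1 + xi ^+ 2 by rewrite ltr_wpDr// sqr_ge0.
have IP : \int[mu]_y poisson e (y - xi) = 2 * pi.
  rewrite (@Rintegral_shift R (poisson e)); last exact: measurable_poisson.
  by rewrite /Rintegral integral_poisson.
have iB : int (fun y => 2 * (1 + c ^+ 2) * M * poisson e (y - xi) + 4 * `|g y|).
  by have := integrableD measurableT (integrableZl measurableT (2 * (1 + c ^+ 2) * M) iPs)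
    (integrableZl measurableT 4 ign).
have key : (1 + xi ^+ 2) * `|\int[mu]_y (g y * poisson e (y - xi))| <=
    2 * (1 + c ^+ 2) * M * (2 * pi) + 4 * G.
  have ingP : int (fun y => `|g y * poisson e (y - xi)|) by have := integrable_norm igP.
  have step : `|\int[mu]_y (g y * poisson e (y - xi))| <=
      \int[mu]_y `|g y * poisson e (y - xi)| by exact: le_normr_Rintegral.
  apply: (le_trans (ler_wpM2l (ltW x1) step)).
  rewrite -RintegralZl//.
  have -> : 2 * (1 + c ^+ 2) * M * (2 * pi) + 4 * G =
      \int[mu]_y (2 * (1 + c ^+ 2) * M * poisson e (y - xi) + 4 * `|g y|).
    rewrite RintegralD//; [|by have := integrableZl measurableT (2 * (1 + c ^+ 2) * M) iPs|
      by have := integrableZl measurableT 4 ign].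
    rewrite (@RintegralZl _ _ _ mu setT _ (2 * (1 + c ^+ 2) * M) measurableT iPs) IP.
    by rewrite (@RintegralZl _ _ _ mu setT _ 4 measurableT ign).
  apply: le_Rintegral => //.
    by have := integrableZl measurableT (1 + xi ^+ 2) ingP.
  move=> y _; set z := y - xi; have P0 := poisson_gt0 e0 z.
  have zP : z ^+ 2 * poisson e z <= 2.
    rewrite /poisson mulrA ler_pdivrMr ?poisson_denom_gt0//.
    have : z ^+ 2 * e <= z ^+ 2 by rewrite ler_piMr// sqr_ge0.
    have := sqr_ge0 e; nra.
  have [yc|cy] := leP `|y| c; last first.
    rewrite g0// mul0r normr0 !mulr0 addr0; apply: mulr_ge0; last exact: ltW.
    by apply: mulr_ge0 => //; apply: mulr_ge0 => //; rewrite addr_ge0 ?sqr_ge0.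
  rewrite normrM (gtr0_norm P0).
  have y2 : y ^+ 2 <= c ^+ 2.
    by rewrite -(real_normK (num_real y)) ler_pXn2r ?nnegrE// ltW.
  have xi2 : 1 + xi ^+ 2 <= 2 * (1 + c ^+ 2) + 2 * z ^+ 2.
    have := sqr_ge0 (2 * y - xi); rewrite /z; nra.
  have gP0 : 0 <= `|g y| * poisson e z by rewrite mulr_ge0// ltW.
  apply: (le_trans (ler_wpM2r gP0 xi2)); rewrite mulrDl; apply: lerD.
    rewrite -!mulrA ler_wpM2l// ler_wpM2l//; first by rewrite addr_ge0// sqr_ge0.
    by rewrite ler_wpM2r// ltW.
  rewrite (_ : 2 * z ^+ 2 * (`|g y| * poisson e z) = 2 * `|g y| * (z ^+ 2 * poisson e z)); last by ring.
  rewrite (_ : 4 * `|g y| = 2 * `|g y| * 2); last by ring.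
  by rewrite ler_wpM2l// mulr_ge0.
rewrite /A -/e normrM (gtr0_norm (_ : 0 < (2 * pi)^-1)) ?invr_gt0//.
rewrite (_ : K / 2 * poisson 1 xi = (2 * pi)^-1 * ((2 * (1 + c ^+ 2) * M * (2 * pi) + 4 * G) / (1 + xi ^+ 2))); last first.
  rewrite /K /poisson expr1n; set a := (2 * pi)^-1; set b := (_ + 4 * G); field.
  by rewrite gt_eqF.
by rewrite ler_wpM2l// ?invr_ge0 ?(ltW twopi0)// ler_pdivlMr// mulrC.
Qed.

(** Translated by xi, this is the approximate identity at 0, which asks for continuity of g at xi;
    the edges of the band are therefore excluded. *)
Let A_cvg xi : `|xi| != c -> A n xi @[n --> \oo] --> g xi.
Proof.
move=> xic.
have mgs := measurable_shift xi mg.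
have igs : int (fun y => g (y + xi)) by have := integrable_shift xi integrable_band.
have := @poisson_approx_identity R (fun y => g (y + xi)) mgs.
move=> H.
have {}H : \int[mu]_y (g (y + xi) * poisson n.+1%:R^-1 y) @[n --> \oo] --> 2 * pi * g (0 + xi).
  apply: H.
  - apply: (@integrable_bounded_mul _ _ _ 2) => //; first exact: measurable_poisson.
    move=> x; rewrite gtr0_norm ?poisson_gt0//.
    by have := @poisson_le R 1 ltr01 x; rewrite divr1.
  - apply: (@continuous_comp _ _ _ (fun y => y + xi) g).
      by apply: cvgD; [exact: cvg_id|exact: cvg_cst].
    by rewrite add0r; exact: cg.
move: H; rewrite add0r => H; rewrite (_ : g xi = (2 * pi)^-1 * (2 * pi * g xi)); last first.
  by rewrite mulrA mulVf ?mul1r// gt_eqF.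
rewrite (_ : A ^~ xi = fun n => (2 * pi)^-1 * \int[mu]_y (g (y + xi) * poisson n.+1%:R^-1 y)).
  by apply: cvgM => //; exact: cvg_cst.
apply/funext => n; rewrite /A; congr (_ * _).
rewrite -(@Rintegral_shift R (fun y => g y * poisson n.+1%:R^-1 (y - xi)) xi).
  by apply: eq_Rintegral => y _; rewrite addrK.
apply: measurable_funM => //.
apply: (measurableT_comp (measurable_poisson (eps0 n))); exact: measurable_funB.
Qed.

Let ae_off_edges (P : R -> Prop) : (forall xi, `|xi| != c -> P xi) -> {ae mu, forall xi, P xi}.
Proof.
move=> HP; exists [set c; - c]; split.
- by apply: measurableU.
- by apply: countable_lebesgue_measure0; apply: finite_set_countable; exact: finite_set2.
- move=> xi /= nP; apply: contrapT => nc; apply: nP; apply: HP.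
  apply/eqP => xic; apply: nc; have [x0|x0] := ler0P xi; move: xic.
    by rewrite ler0_norm// => xic; right; rewrite -xic opprK.
  by rewrite gtr0_norm// => xic; left.
Qed.

(** The damped inverse integrals are the approximants. Their transforms, Poisson averages of g,
    converge to g off the two edges and stay below a multiple of [poisson 1] uniformly in n, so
    dominated convergence gives the limit in L^2. *)
Lemma L2_fourier_inverse : L2_fourier (inverse_transform g) (fun xi => (g xi)%:C).
Proof.
have mgC : measurableC (fun xi => (g xi)%:C) by split => //; exact: measurable_cst.
split.
- exact/Lp_space2P.
- apply/Lp_space2P; split => //; rewrite /sqnorm.
  under eq_integral do rewrite /= expr0n addr0.
  exact: sqint_band_fin.
exists hn; split.
- by move=> n; split.
- exact/Lp_norm2_cvg0P.
apply/Lp_norm2_cvg0P/vanishingP; first by move=> n; exact: sqnorm_ge0.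
have E n xi : Re (fourier (hn n) xi - (g xi)%:C) ^+ 2 + Im (fourier (hn n) xi - (g xi)%:C) ^+ 2 =
    (A n xi - g xi) ^+ 2.
  have [_ rE iE] := fourier_damped_inverse integrable_band xi (eps0 n).
  by rewrite ReB ImB rE iE /= subr0 expr0n addr0.
(* The sum of the coefficients of [poisson 1] in the bounds for the averages and for [g]. The
   squared majorant is then handled by [poisson 1] <= 2. *)
pose K' := K / 2 + M * (1 + c ^+ 2) / 2.
have K'0 : 0 <= K'.
  by rewrite /K' addr_ge0 ?divr_ge0// mulr_ge0// addr_ge0// sqr_ge0.
have iF : int (fun xi => K' ^+ 2 * 2 * poisson 1 xi).
  by have := integrableZl measurableT (K' ^+ 2 * 2) (integrable_poisson (@ltr01 R)).
have := @dominated_convergence _ _ R mu setT measurableT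
  (fun n x => (Re (fourier (hn n) x - (g x)%:C) ^+ 2 + Im (fourier (hn n) x - (g x)%:C) ^+ 2)%:E) (cst 0%E) (fun xi => (K' ^+ 2 * 2 * poisson 1 xi)%:E).
move=> [].
- move=> n; apply: measurable_sqnorm; apply: measurableCB => //.
  exact: measurable_fourier.
- exact: measurable_cst.
- apply: ae_off_edges => xi xic _.
  have C : (A n xi - g xi) ^+ 2 @[n --> \oo] --> (0 : R).
    rewrite (_ : 0 = (g xi - g xi) * (g xi - g xi) :> R); last by rewrite subrr mulr0.
    by apply: cvgM; (apply: cvgB; [exact: A_cvg|exact: cvg_cst]).
  rewrite (_ : (fun n => _) = EFin \o (fun n => (A n xi - g xi) ^+ 2)).
    by apply/cvg_EFin; [exact: nearW|exact: C].
  by apply/funext => n /=; rewrite E.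
- exact: iF.
- apply: aeW => xi n _; rewrite E lee_fin.
  have P0 := @poisson_gt0 R 1 ltr01 xi.
  have P2 : poisson 1 xi <= 2 by have := @poisson_le R 1 ltr01 xi; rewrite divr1.
  rewrite ger0_norm ?sqr_ge0//.
  have dK : `|A n xi - g xi| <= K' * poisson 1 xi.
    apply: (le_trans (ler_normB _ _)); rewrite mulrDl; apply: lerD; [exact: A_le|exact: band_le].
  rewrite -(real_normK (num_real _)) (le_trans (_ : _ <= (K' * poisson 1 xi) ^+ 2))//.
    by rewrite ler_pXn2r ?nnegrE// mulr_ge0// ltW.
  rewrite exprMn -mulrA ler_wpM2l ?sqr_ge0// expr2 ler_wpM2r// ltW//.
- by move=> _ _; rewrite integral0.
Qed.

Lemma PW_inverse_transform : PW c (inverse_transform g).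
Proof.
have [cR cI] := continuous_inverse_transform integrable_band.
split; first exact: continuous_complex.
exists (fun xi => (g xi)%:C); first exact: L2_fourier_inverse.
by apply: aeW => xi cx; rewrite g0.
Qed.

End band_limited.

(** * Powers of the kernel applied to sinc *)

Section kernel_powers.
Context {R : realType}.
Local Notation mu := (@lebesgue_measure R).
Local Notation int f := (mu.-integrable [set: R] (EFin \o f)).
Local Notation tr := trig_transform.
Local Notation Re := (@complex.Re R).
Local Notation Im := (@complex.Im R).
Implicit Types (f : R -> R[i]).

Lemma PW_shift c f (a : R) : PW c f -> PW c (fun x => f (x + a)).
Proof.
move=> [cf [g fg gc]]; split.
  move=> x; apply: (@continuous_comp _ _ _ (fun y : R => y + a) (f : R -> R[i]^o)); last exact: cf.
  by apply: cvgD; [exact: cvg_id|exact: cvg_cst].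
exists (fun xi => g xi * expi (a * xi)); first exact: L2_fourier_shift.
have [N [mN N0 sub]] := gc; exists N; split => // xi /= nxi.
by apply: sub => /= gxi; apply: nxi => cxi; rewrite gxi// mul0r.
Qed.

(** The factor [w] may be unbounded, so the argument is pointwise: f vanishes almost everywhere, and
    so does the product. *)
Lemma sqnorm_mul_eq0 f (w : R -> R) : measurableC f -> measurable_fun setT w ->
  sqnorm f = 0%E -> sqnorm (fun x => f x * (w x)%:C) = 0%E.
Proof.
move=> mf mw f0.
pose F x := (Re (f x) ^+ 2 + Im (f x) ^+ 2)%:E.
have F0 x : (0 <= F x)%E by rewrite lee_fin addr_ge0// sqr_ge0.
have mF : measurable_fun setT F by exact: measurable_sqnorm.
have : (\int[mu]_x `|F x|)%E = 0%E.
  by rewrite -f0; apply: eq_integral => x _; rewrite gee0_abs.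
move=> /(ae_eq_integral_abs mu measurableT mF) F0ae.
rewrite /sqnorm -[RHS](integral0 mu setT).
apply: ae_eq_integral => //.
- rewrite (_ : (fun x => _) = fun x => (F x * (w x ^+ 2)%:E)%E).
    by apply: emeasurable_funM => //; apply/measurable_EFinP; exact: measurable_funX.
  by apply/funext => x; rewrite /F -EFinM; congr EFin; case: (f x) => a b /=; ring.
- apply: filterS F0ae => x /(_ I); rewrite /F /= => -[] E _.
  congr EFin; transitivity ((Re (f x) ^+ 2 + Im (f x) ^+ 2) * w x ^+ 2).
    by case: (f x) => a b /=; ring.
  by rewrite E mul0r.
Qed.

Variables (c kappa : R) (phi : R -> R[i]).
Hypotheses (c0 : 0 < c) (k0 : 0 < kappa).
Hypothesis phi1 : Lp_space 1%:E phi.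
Hypothesis phik : kernel_bound c kappa phi.

Let psi xi := Re (fourier phi xi).

Lemma continuous_Re_fourier : continuous psi.
Proof.
have /Lp_space1P[iR iI] := phi1.
rewrite (_ : psi = fun xi => tr cos (Re \o phi) xi + tr sin (Im \o phi) xi); last first.
  by apply/funext => xi; rewrite /psi Re_fourier.
move=> xi; apply: cvgD.
  exact: (continuous_trig_transform (@continuous_cos R) (@normr_cos_le1 R) iR).
exact: (continuous_trig_transform (@continuous_sin R) (@normr_sin_le1 R) iI).
Qed.

Lemma kernel_bound_Re xi : `|xi| <= c -> kappa <= psi xi <= 1.
Proof.
by move=> /phik /andP[]; rewrite /psi !lecE /= => /andP[_ ->] /andP[_ ->].
Qed.

(** The transform of sinc (c .) * phi_t; the height pi / c is that of the transform of sinc (c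
    .). *)
Definition band_power (t xi : R) : R :=
  pi / c * psi xi `^ t * \1_(`[- c, c]%classic) xi.

Lemma band_power_in t xi : `|xi| <= c -> band_power t xi = pi / c * psi xi `^ t.
Proof.
move=> xc; rewrite /band_power indicE mem_set ?mulr1//=.
by rewrite in_itv/= -ler_norml.
Qed.

Lemma band_power_out t xi : c < `|xi| -> band_power t xi = 0.
Proof.
move=> xc; rewrite /band_power indicE memNset ?mulr0//=.
by rewrite in_itv/= -ler_norml; apply/negP; rewrite -ltNge.
Qed.

Let mpsi_pow t : measurable_fun setT (fun xi => psi xi `^ t).
Proof.
apply: (measurableT_comp (measurable_powR t)).
by apply: continuous_measurable_fun; exact: continuous_Re_fourier.
Qed.

Lemma measurable_band_power t : measurable_fun setT (band_power t).
Proof.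
apply: measurable_funM; first exact: measurable_funM.
by apply: measurable_indic.
Qed.

Let pic0 : 0 < pi / c.
Proof. by rewrite divr_gt0// pi_gt0. Qed.

Lemma powR_bounds (x t : R) : 0 <= t -> kappa <= x <= 1 -> kappa `^ t <= x `^ t <= 1.
Proof.
move=> t0 /andP[kx x1]; have x0 : 0 <= x := le_trans (ltW k0) kx.
apply/andP; split; first by apply: ge0_ler_powR => //; rewrite nnegrE// ltW.
by have := ge0_ler_powR t0 x0 (@ler01 R) x1; rewrite powR1.
Qed.

Lemma band_power_le t xi : 0 <= t -> `|band_power t xi| <= pi / c.
Proof.
move=> t0; have [xc|cx] := leP `|xi| c; last by rewrite band_power_out// normr0 ltW.
have /andP[_ p1] := powR_bounds t0 (kernel_bound_Re xc).
rewrite band_power_in// ger0_norm; last first.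
  by apply: mulr_ge0; [exact: ltW|exact: powR_ge0].
by apply: ler_piMr => //; exact: ltW.
Qed.

(** Inside the band psi is at least kappa > 0, where the power is continuous; outside, the function
    is locally 0. Jumps can occur only at the two edges. *)
Lemma continuous_band_power t xi : `|xi| != c -> {for xi, continuous (band_power t)}.
Proof.
rewrite neq_lt => /orP[xc|cx].
- have nearE : \forall y \near xi, pi / c * psi y `^ t = band_power t y.
    have /cvgr_lt /(_ _ xc) := @norm_continuous _ R xi.
    by apply: filterS => y yc; rewrite band_power_in// ltW.
  apply: (cvg_trans (near_eq_cvg nearE)); rewrite band_power_in ?(ltW xc)//.
  apply: cvgM; first exact: cvg_cst.
  have psi0 : 0 < psi xi by have /andP[kx _] := kernel_bound_Re (ltW xc); exact: lt_le_trans kx.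
  apply: (@continuous_comp _ _ _ psi (fun z => z `^ t)); first exact: continuous_Re_fourier.
  apply: differentiable_continuous; apply/derivable1_diffP.
  by apply: derivable_powR; rewrite in_itv/= psi0.
- have nearE : \forall y \near xi, 0 = band_power t y.
    have /cvgr_gt /(_ _ cx) := @norm_continuous _ R xi.
    by apply: filterS => y yc; rewrite band_power_out.
  apply: (cvg_trans (near_eq_cvg nearE)); rewrite band_power_out//.
  exact: cvg_cst.
Qed.

(** The candidate for sinc (c .) * phi_t; at t = 0 it is sinc (c .) itself. *)
Definition kernel_sinc t : R -> R[i] := inverse_transform (band_power t).

Section fixed_time.
Variable t : R.
Hypothesis t0 : 0 <= t.

Lemma integrable_band_power : int (band_power t).
Proof.
exact: integrable_band (ltW pic0) (measurable_band_power t)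
  (fun xi => band_power_le xi t0) (@band_power_out t).
Qed.

Lemma PW_kernel_sinc : PW c (kernel_sinc t).
Proof.
exact: (PW_inverse_transform c0 (ltW pic0) (measurable_band_power t)
  (fun xi => band_power_le xi t0) (@band_power_out t) (@continuous_band_power t)).
Qed.

Lemma L2_fourier_kernel_sinc : L2_fourier (kernel_sinc t) (fun xi => (band_power t xi)%:C).
Proof.
exact: (L2_fourier_inverse c0 (ltW pic0) (measurable_band_power t)
  (fun xi => band_power_le xi t0) (@band_power_out t) (@continuous_band_power t)).
Qed.

End fixed_time.

(** Since [conv_pow] is a choice, both membership and uniqueness are required. A competitor may use
    another representative of the transform of the test function, so two representatives have to be
    compared before injectivity applies. *)
Lemma conv_pow_kernel_sinc t a : 0 <= t ->
  conv_pow c phi (fun x => kernel_sinc 0 (x - a)) t = fun x => kernel_sinc t (x - a).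
Proof.
move=> t0.
pose G xi := (band_power 0 xi)%:C * expi (- a * xi).
have f0G : L2_fourier (fun x => kernel_sinc 0 (x - a)) G.
  exact: L2_fourier_shift (L2_fourier_kernel_sinc (lexx 0)).
pose psit xi := (psi xi `^ t).
have ftG : L2_fourier (fun x => kernel_sinc t (x - a)) (fun xi => G xi * (psit xi)%:C).
  have := L2_fourier_shift (- a) (L2_fourier_kernel_sinc t0).
  congr L2_fourier; apply/funext => xi; rewrite /G mulrAC; congr (_ * _).
  have [xc|cx] := leP `|xi| c; last by rewrite !band_power_out// mul0r.
  by rewrite !band_power_in// powRr0 mulr1 -rmorphM.
apply: xget_unique.
  split; first exact: PW_shift (PW_kernel_sinc t0).
  by exists G.
move=> h [[ch _] [G' fG' hG']]; apply/funext => x; apply/eqP; rewrite -subr_eq0; apply/eqP.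
have [cR cI] := continuous_Re_Im ch.
have [ckR ckI] : continuous (Re \o (fun x => kernel_sinc t (x - a))) /\
    continuous (Im \o (fun x => kernel_sinc t (x - a))).
  by apply: continuous_Re_Im; have [] := PW_shift (- a) (PW_kernel_sinc t0).
(* [G'] and [G] are both transforms of the same function, so their difference is a transform of 0
   and is null. *)
have dG := L2_fourierB fG' f0G.
have dG0 : sqnorm (fun xi => G' xi - G xi) = 0%E.
  apply: (L2_fourier_eq0 dG); rewrite /sqnorm -[RHS](integral0 mu setT).
  by apply: eq_integral => y _; rewrite subrr /= expr0n addr0.
(* The transform of the difference is (G' - G) psi^t, which is null; continuity turns this into
   equality at every point. *)
apply: (@L2_fourier_inj _ (fun x => h x - kernel_sinc t (x - a)) _ (L2_fourierB hG' ftG)).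
- rewrite (_ : (fun xi => _) = fun xi => (G' xi - G xi) * (psit xi)%:C); last first.
    by apply/funext => xi; rewrite mulrBl.
  apply: sqnorm_mul_eq0; [|exact: mpsi_pow|exact: dG0].
  by have [_ /Lp_space2P[]] := dG.
- rewrite (_ : _ \o _ = (Re \o h) \- (Re \o (fun x => kernel_sinc t (x - a)))).
    by move=> y; apply: cvgB; [exact: cR|exact: ckR].
  by apply/funext => y /=; rewrite ReB.
- rewrite (_ : _ \o _ = (Im \o h) \- (Im \o (fun x => kernel_sinc t (x - a)))).
    by move=> y; apply: cvgB; [exact: cI|exact: ckI].
  by apply/funext => y /=; rewrite ImB.
Qed.

End kernel_powers.

(** * Elementary lower bounds for sinc *)

Section sinc_estimates.
Context {R : realType}.
Implicit Types (x y : R).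

Lemma sincN x : sinc (- x) = sinc x :> R.
Proof. by rewrite /sinc oppr_eq0; case: ifP => // _; rewrite sinN invrN mulrNN. Qed.

Lemma sinc_norm x : sinc `|x| = sinc x :> R.
Proof. by have [x0|x0] := ler0P x; rewrite ?sincN. Qed.

Let sin_mvt (a b : R) : a < b -> exists2 z, a < z < b & sin b - sin a = cos z * (b - a).
Proof.
move=> ab; have [z] := @MVT R sin cos a b ab (fun x _ => is_derive_sin x)
  (continuous_subspaceT (@continuous_sin R)).
by rewrite in_itv/= => zab E; exists z.
Qed.

Let pihalf_le_pi : pi / 2 <= pi :> R.
Proof. by have := pi_ge0 R; lra. Qed.

Let cos_le (x y : R) : 0 <= x -> x <= y -> y <= pi -> cos y <= cos x.
Proof.
move=> x0; rewrite le_eqVlt => /predU1P[->//|xy] ypi.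
rewrite ltW// ltr_cos// in_itv/=; apply/andP; split => //; lra.
Qed.

(** By the mean value theorem sin x = x cos z with 0 < z < x, and the cosine decreases. *)
Lemma cos_le_sinc x : `|x| <= pi / 2 -> 0 <= cos x <= sinc x.
Proof.
rewrite -cos_norm -sinc_norm; move: `|x| (normr_ge0 x) => {}x x0 xpi.
have c0 : 0 <= cos x by apply: cos_ge0_pihalf; apply/andP; split => //; have := pi_ge0 R; lra.
rewrite c0/= /sinc; case: eqVneq => [->|xn0]; first by rewrite cos0.
have {x0 xn0}x0 : 0 < x by rewrite lt_neqAle eq_sym xn0.
rewrite ler_pdivlMr//; have [z /andP[z0 zx]] := sin_mvt x0.
rewrite sin0 !subr0 => ->; rewrite ler_wpM2r ?(ltW x0)//.
by apply: cos_le; [exact: ltW|exact: ltW|exact: le_trans pihalf_le_pi].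
Qed.

(** Jordan's inequality, by concavity of the sine: the mean slope on [0, x] is at least that on
    [x, pi / 2], as two applications of the mean value theorem show. *)
Lemma jordan_sinc x : `|x| <= pi / 2 -> 2 / pi <= sinc x.
Proof.
rewrite -sinc_norm; move: `|x| (normr_ge0 x) => {}x x0 xpi.
have p0 : 0 < pi :> R by exact: pi_gt0.
rewrite /sinc; case: eqVneq => [_|xn0].
  by rewrite ler_pdivrMr// mul1r pi_ge2.
have {x0 xn0}x0 : 0 < x by rewrite lt_neqAle eq_sym xn0.
rewrite ler_pdivlMr// mulrAC ler_pdivrMr//.
have [z /andP[z0 zx]] := sin_mvt x0; rewrite sin0 !subr0 => sE.
move: xpi; rewrite le_eqVlt => /predU1P[xE|xpi].
  by rewrite xE sin_pihalf mul1r; lra.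
have [w /andP[w0 wx]] := sin_mvt xpi; rewrite sin_pihalf => sE'.
have wz : cos w <= cos z by apply: cos_le; lra.
have h : (1 - sin x) * x <= sin x * (pi / 2 - x).
  have k : 0 <= (pi / 2 - x) * x by rewrite mulr_ge0//; lra.
  rewrite sE' sE (_ : cos z * x * (pi / 2 - x) = cos z * ((pi / 2 - x) * x)); last by ring.
  by rewrite -mulrA; exact: ler_wpM2r.
lra.
Qed.

End sinc_estimates.

(** * Norm, energy and measurability of the test functions *)

Section kernel_sinc_estimates.
Context {R : realType}.
Local Notation mu := (@lebesgue_measure R).
Local Notation int f := (mu.-integrable [set: R] (EFin \o f)).
Local Notation tr := trig_transform.
Local Notation Re := (@complex.Re R).
Local Notation Im := (@complex.Im R).
Local Notation sqint u := (\int[mu]_x (u x ^+ 2)%:E)%E.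

Variables (c kappa : R) (phi : R -> R[i]).
Hypotheses (c0 : 0 < c) (k01 : 0 < kappa < 1).
Hypothesis phi1 : Lp_space 1%:E phi.
Hypothesis phik : kernel_bound c kappa phi.

Local Notation band := (band_power c phi).
Local Notation K := (kernel_sinc c phi).

Let k0 : 0 < kappa. Proof. by case/andP: k01. Qed.
Let cos1 := @normr_cos_le1 R.
Let sin1 := @normr_sin_le1 R.
Let ccos := @continuous_cos R.
Let csin := @continuous_sin R.
Let iband t : 0 <= t -> int (band t).
Proof. by move=> t0; exact: (integrable_band_power (kappa := kappa)). Qed.

Let twopi0 : 0 < 2 * pi :> R.
Proof. by rewrite mulr_gt0// pi_gt0. Qed.

Lemma band_power0 xi : band 0 xi = pi / c * \1_(`[- c, c]%classic) xi.
Proof. by rewrite /band_power powRr0 mulr1. Qed.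

Lemma kernel_sinc0 y : K 0 y = (sinc (c * y))%:C.
Proof.
have mI : measurable (`[- c, c]%classic : set R) by [].
have E (e : R -> R) : tr e (band 0) y = \int[mu]_(x in `[- c, c]) (pi / c * e (x * y)).
  rewrite Rintegral_mkcond; apply: eq_Rintegral => x _.
  rewrite band_power0 patchE indicE; case: ifPn => xc; first by rewrite mulr1.
  by rewrite mulr0 mul0r.
have cT : tr cos (band 0) y = 2 * pi * sinc (c * y).
  have cc : - c < c by rewrite -subr_gt0 opprK addr_gt0.
  have cf : continuous (fun x : R => pi / c * cos (x * y)).
    move=> x; apply: cvgM; first exact: cvg_cst.
    apply: (@continuous_comp _ _ _ (fun x : R => x * y) cos); last exact: ccos.
    by apply: cvgM; [exact: cvg_id|exact: cvg_cst].
  rewrite E /Rintegral /sinc mulf_eq0 gt_eqF//=; case: eqVneq => [y0|y0].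
    have dF (x : R) : is_derive x (1 : R) (fun x => pi / c * x) (pi / c * cos (x * y)).
      rewrite y0 mulr0 cos0; apply: is_derive_eq.
      by rewrite /GRing.scale/= mulr1.
    rewrite (integral_FTC2 cc cf dF) /= mulr1; move: pi => p; field.
    by rewrite gt_eqF.
  have dF (x : R) : is_derive x (1 : R) (fun x => pi / c * (sin (x * y) / y)) (pi / c * cos (x * y)).
    apply: is_derive_eq.
    rewrite /GRing.scale/=; move: pi (cos _) => p s; field.
    by rewrite y0 gt_eqF.
  rewrite (integral_FTC2 cc cf dF) /= mulNr sinN; move: pi (sin _) => p s; field.
  by rewrite y0 gt_eqF.
have sT : tr sin (band 0) y = 0.
  apply: Rintegral_odd; first exact: (integrable_trig csin sin1 y (iband (lexx 0))).
  move=> x; rewrite mulNr sinN mulrN; congr (- (_ * _)).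
  rewrite !band_power0; congr (_ * _); rewrite !indicE; congr (_ %:R); congr nat_of_bool.
  by apply/idP/idP; rewrite !inE/= !in_itv/= -!ler_norml ?normrN.
rewrite /kernel_sinc /inverse_transform cT sT mulr0; congr (_ +i* _).
by rewrite mulrA mulVf ?mul1r// gt_eqF.
Qed.

Lemma sqnorm_kernel_sinc0_shift a : sqnorm (fun x => K 0 (x - a)) = sqnorm (K 0).
Proof.
apply: sqnorm_shift; apply: measurable_inverse_transform.
exact: iband.
Qed.

Lemma sqint_band0 : (sqint (band 0) = (2 * pi * (pi / c))%:E)%E.
Proof.
transitivity (\int[mu]_x ((pi / c) ^+ 2 * \1_(`[- c, c]%classic) x)%:E)%E.
  apply: eq_integral => x _; congr EFin; rewrite band_power0 indicE.
  by case: (x \in _); rewrite ?mulr1 ?mulr0 ?expr0n.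
under eq_integral do rewrite EFinM.
rewrite ge0_integralZl//; last 2 first.
- by apply: measurableT_comp => //; exact: measurable_indic.
- by rewrite lee_fin sqr_ge0.
rewrite integral_indic// setIT -[X in (_ * X)%E]/(lebesgue_measure `[(- c)%R, c]%classic) lebesgue_measure_itv/= lte_fin ifT; last by rewrite -subr_gt0 opprK addr_gt0.
rewrite -EFinB -EFinM; congr EFin; move: pi => p; field.
by rewrite gt_eqF.
Qed.

Let Re_kernel_sinc t y : Re (K t y) = (2 * pi)^-1 * tr cos (band t) y.
Proof. by []. Qed.

Let Re_kernel_sinc0 y : Re (K 0 y) = sinc (c * y).
Proof. by rewrite kernel_sinc0. Qed.

Let sqnorm_kernel_sinc0E : sqnorm (K 0) = sqint (fun y => Re (K 0 y)).
Proof.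
by apply: eq_integral => y _; rewrite kernel_sinc0 /= expr0n addr0.
Qed.

(** sinc (c .) is real, so only the cosine transform enters, and its Bessel constant 2 pi already
    yields the exact value pi / c. *)
Lemma sqnorm_kernel_sinc0_le : (sqnorm (K 0) <= (pi / c)%:E)%E.
Proof.
rewrite sqnorm_kernel_sinc0E.
apply: (le_trans (sqint_trig_scaled (iband (lexx 0)) ccos cos1 (@poisson_dominated_cos R))).
by rewrite sqint_band0 -EFinM lee_fin mulKf// gt_eqF.
Qed.

(** On |y| <= pi / (2 c) the sinc dominates cos (c y), whose square integrates there to pi / (2 c),
    half of the true squared norm. *)
Lemma sqnorm_kernel_sinc0_ge : ((pi / (2 * c))%:E <= sqnorm (K 0))%E.
Proof.
rewrite sqnorm_kernel_sinc0E.
have p0 : 0 < pi :> R by exact: pi_gt0.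
pose b := pi / (2 * c); have b0 : 0 < b by rewrite divr_gt0// mulr_gt0.
have cb : c * b = pi / 2 by rewrite /b; move: pi => p; field; rewrite gt_eqF.
have cK : continuous (fun y => Re (K 0 y)).
  by have [] := continuous_inverse_transform (iband (lexx 0)).
apply: (@le_trans _ _ (\int[mu]_(x in `[(- b)%R, b]) (cos (c * x) ^+ 2)%:E)%E); last first.
  apply: (@le_trans _ _ (\int[mu]_(x in `[(- b)%R, b]) (Re (K 0 x) ^+ 2)%:E)%E).
    apply: integral_le => x; first by rewrite lee_fin sqr_ge0.
    move=> xb'; have xb : `|x| <= b by move: xb'; rewrite /= in_itv/= -ler_norml.
    rewrite lee_fin Re_kernel_sinc0.
    have : `|c * x| <= pi / 2 by rewrite normrM gtr0_norm// -cb ler_pM2l.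
    by move=> /cos_le_sinc /andP[h1 h2]; rewrite ler_pXn2r ?nnegrE// (le_trans h1).
  apply: ge0_subset_integral => //.
  - apply/measurable_EFinP; apply: measurable_funX; exact: continuous_measurable_fun.
  - by move=> x _; rewrite lee_fin sqr_ge0.
have bb : - b < b by rewrite -subr_gt0 opprK addr_gt0.
have cf : continuous (fun x : R => cos (c * x) ^+ 2).
  move=> x; have cx : continuous_at x (fun x : R => cos (c * x)).
    apply: (@continuous_comp _ _ _ (fun x => c * x) cos); last exact: ccos.
    by apply: cvgM; [exact: cvg_cst|exact: cvg_id].
  by rewrite /continuous_at; under eq_fun do rewrite expr2; rewrite expr2; apply: cvgM.
have dF (x : R) : is_derive x (1 : R) (fun x => x / 2 + sin (c * x) * cos (c * x) / (2 * c)) (cos (c * x) ^+ 2).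
  apply: is_derive_eq.
  rewrite /GRing.scale/=; have := cos2Dsin2 (c * x).
  move: (cos _) (sin _) => C S CS.
  rewrite (_ : C ^+ 2 = (C ^+ 2 + (C ^+ 2 + S ^+ 2) - S ^+ 2) / 2); last by field.
  by rewrite CS; field; rewrite gt_eqF.
rewrite (integral_FTC2 bb cf dF) mulrN cosN cb cos_pihalf !mulr0 !mul0r !addr0 lee_fin /b.
by move: pi => p; rewrite le_eqVlt; apply/orP; left; apply/eqP; field; rewrite gt_eqF.
Qed.

Lemma normc_kernel_sinc_ge t y : 0 <= t -> `|y| <= pi / (2 * c) ->
  (kappa `^ t * (2 / pi)) ^+ 2 <= Normc.normc (K t y) ^+ 2.
Proof.
move=> t0 yc.
have p0 : 0 < pi :> R by exact: pi_gt0.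
have cb : c * (pi / (2 * c)) = pi / 2 by move: pi => p; field; rewrite gt_eqF.
have h1 : kappa `^ t * sinc (c * y) <= Re (K t y).
  rewrite -Re_kernel_sinc0 !Re_kernel_sinc mulrCA ler_wpM2l ?invr_ge0 ?(ltW twopi0)//.
  have i0 := integrable_trig ccos cos1 y (iband (lexx 0)).
  rewrite /trig_transform -RintegralZl//.
  apply: le_Rintegral => //.
  - by have := integrableZl measurableT (kappa `^ t) i0.
  - exact: integrable_trig (iband t0).
  move=> x _; have [xc|cx] := leP `|x| c; last by rewrite !band_power_out// !mul0r mulr0.
  rewrite mulrA ler_wpM2r//.
    apply: cos_ge0_pihalf; rewrite -ler_norml normrM -cb.
    by rewrite ler_pM.
  rewrite !band_power_in// powRr0 mulr1 mulrC ler_pM2l ?divr_gt0//.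
  by have /andP[] := powR_bounds k0 t0 (kernel_bound_Re phik xc).
have cy : `|c * y| <= pi / 2 by rewrite normrM gtr0_norm// -cb ler_pM2l.
have h2 := jordan_sinc cy.
have h3 : 0 <= 2 / pi :> R by rewrite divr_ge0// ltW.
have h4 : kappa `^ t * (2 / pi) <= Re (K t y).
  by apply: le_trans h1; rewrite ler_wpM2l// powR_ge0.
have h5 := le_trans (ler_norm _) (normr_Re_le (K t y)).
rewrite ler_pXn2r ?nnegrE ?normc_ge0//; first exact: le_trans h5.
by rewrite mulr_ge0// powR_ge0.
Qed.

(** The origin of c_phiL: it is the energy over [0, L] of the pointwise lower bound kappa^t 2 /
    pi. *)
Lemma integral_powR_kappa (L : R) : 0 < L ->
  (\int[mu]_(t in `[0%R, L]) ((kappa `^ t * (2 / pi)) ^+ 2)%:E =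
   (2 * (kappa `^ (2 * L) - 1) / (pi ^+ 2 * ln kappa))%:E)%E.
Proof.
move=> L0.
have l0 : ln kappa != 0 by rewrite lt_eqF// ln_lt0.
have p0 : pi != 0 :> R by rewrite gt_eqF// pi_gt0.
have kE t : kappa `^ t = expR (t * ln kappa) by rewrite /powR gt_eqF.
have cf : continuous (fun t : R => (kappa `^ t * (2 / pi)) ^+ 2).
  move=> t; under eq_fun do rewrite kE.
  have ce : continuous_at t (fun t : R => expR (t * ln kappa)).
    apply: (@continuous_comp _ _ _ (fun t : R => t * ln kappa) expR); last exact: continuous_expR.
    by apply: cvgM; [exact: cvg_id|exact: cvg_cst].
  have ct : continuous_at t (fun t : R => expR (t * ln kappa) * (2 / pi)).
    by apply: cvgM => //; exact: cvg_cst.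
  by under eq_fun do rewrite expr2; rewrite expr2; apply: cvgM.
have dF (t : R) : is_derive t (1 : R)
    (fun t => 2 / (pi ^+ 2 * ln kappa) * expR (t * (2 * ln kappa)))
    ((kappa `^ t * (2 / pi)) ^+ 2).
  apply: is_derive_eq; rewrite /GRing.scale/= kE exprMn.
  rewrite (_ : expR (t * ln kappa) ^+ 2 = expR (t * (2 * ln kappa))); last first.
    by rewrite expr2 -expRD; congr expR; ring.
  by move: pi (ln kappa) p0 l0 (expR _) => p l p0 l0 e; field; rewrite p0 l0.
rewrite (integral_FTC2 L0 cf dF); congr EFin.
rewrite mul0r expR0 kE (_ : 2 * L * ln kappa = L * (2 * ln kappa)); last by ring.
by ring.
Qed.

(** Continuity in t under the integral sign. The bounds on psi^t hold for t >= 0, so t is replaced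
    by [Num.max t 0], which is continuous on the whole line and agrees with t on [0, L]. *)
Lemma measurable_normc_kernel_sinc (L y : R) :
  measurable_fun `[0, L]%classic (fun t => (Normc.normc (K t y) ^+ 2)%:E).
Proof.
have cM (e : R -> R) : continuous e -> (forall x, `|e x| <= 1) ->
    continuous (fun t : R => tr e (band (Num.max t 0)) y).
  move=> ce e1 t.
  have tI : t \in `](t - 1), (t + 1)[%classic.
    by rewrite inE/= in_itv/=; apply/andP; split; lra.
  have i1 : int (fun x => pi / c * (1 + c ^+ 2) / 2 * poisson 1 x).
    by have := integrableZl measurableT (pi / c * (1 + c ^+ 2) / 2) (integrable_poisson (@ltr01 R)).
  have max0 (s : R) : 0 <= Num.max s 0 by rewrite le_max lexx orbT.
  apply: (@continuity_under_integral _ _ _ mu (fun (t x : R) => band (Num.max t 0) x * e (x * y)) setT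
    measurableT (t - 1) (t + 1) _ _ _ i1) => //.
  - by move=> s _; apply: integrable_trig => //; exact: iband.
  - apply: aeW => x _ s _; apply: cvgM; last exact: cvg_cst.
    have [xc|cx] := leP `|x| c; last first.
      by rewrite band_power_out//; under eq_fun do rewrite band_power_out//; exact: cvg_cst.
    rewrite band_power_in//; under eq_fun do rewrite band_power_in//.
    apply: cvgM; first exact: cvg_cst.
    have /andP[kp _] := kernel_bound_Re phik xc.
    have px : Re (fourier phi x) != 0 by rewrite gt_eqF// (lt_le_trans k0).
    rewrite /powR (negbTE px).
    have : continuous_at s (fun s : R => expR (Num.max s 0 * ln (Re (fourier phi x)))); last by [].
    apply: (@continuous_comp _ _ _ (fun s : R => Num.max s 0 * ln (Re (fourier phi x))) expR); last exact: continuous_expR.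
    apply: cvgM; last exact: cvg_cst.
    by apply: continuous_max; [exact: cvg_id|exact: cvg_cst].
  - move=> s _; apply: aeW => x _; rewrite normrM.
    have := @band_le R c (pi / c) (band (Num.max s 0)) c0 (ltW (divr_gt0 (pi_gt0 R) c0))
      (fun x => band_power_le c0 k0 phik x (max0 s)) (band_power_out phi _) x.
    by apply: le_trans; rewrite ler_piMr.
pose G (t : R) := (((2 * pi)^-1 * tr cos (band (Num.max t 0)) y) ^+ 2 + ((2 * pi)^-1 * tr sin (band (Num.max t 0)) y) ^+ 2)%:E.
have mG : measurable_fun `[0, L]%classic G.
  apply/measurable_EFinP; apply: measurable_funTS.
  apply: measurable_funD; apply: measurable_funX; apply: measurable_funM => //;
    apply: continuous_measurable_fun.
  - exact: cM.
  - exact: cM.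
apply: eq_measurable_fun mG => t; rewrite inE => tL.
have t0 : 0 <= t by move: tL; rewrite /= in_itv/= => /andP[].
by rewrite normc_sqr /G max_l.
Qed.

End kernel_sinc_estimates.

(** * Counting points and Beurling densities *)

Section counting_points.
Context {R : realType}.
Implicit Types (S : set R) (N : R).

(** A cardinality bound tested on finite lists: it can be proved before the set is known to be
    finite, and it accepts a real bound. *)
Definition at_most S N : Prop :=
  forall s : seq R, uniq s -> (forall x, x \in s -> S x) -> (size s)%:R <= N.

Lemma at_mostS S1 S2 N : S1 `<=` S2 -> at_most S2 N -> at_most S1 N.
Proof. by move=> S12 SN s us sS; apply: SN => // x /sS; exact: S12. Qed.

Lemma at_mostU S1 S2 N1 N2 : at_most S1 N1 -> at_most S2 N2 ->
  at_most (S1 `|` S2) (N1 + N2).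
Proof.
move=> h1 h2 s us sS; pose p := [pred x | `[< S1 x >]].
rewrite -(count_predC p s) natrD -!size_filter; apply: lerD.
- by apply: h1; [exact: filter_uniq|move=> x; rewrite mem_filter => /andP[/asboolP]].
- apply: h2; [exact: filter_uniq|move=> x; rewrite mem_filter => /andP[/= /asboolPn nS /sS]].
  by case.
Qed.

Lemma at_most_finite S N : at_most S N -> finite_set S.
Proof.
move=> SN; apply: contrapT => /(infinite_set_fset (Num.trunc N).+1)[B BS sB].
have := SN (finmap.enum_fset B) (finmap.fset_uniq B) BS.
apply/negP; rewrite -ltNge.
have [N0|N0] := leP 0 N.
  by have /andP[_ /lt_le_trans] := truncn_itv N0; apply; rewrite ler_nat.
by rewrite (lt_le_trans N0).
Qed.

Lemma counting_le S N : at_most S N -> (counting S <= N%:E)%E.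
Proof.
move=> SN; have fS := at_most_finite SN.
rewrite /counting asboolT// lee_fin; apply: SN; first exact: finmap.fset_uniq.
by move=> x; rewrite in_fset_set// inE.
Qed.

Lemma counting_ge S (s : seq R) : uniq s -> (forall x, x \in s -> S x) ->
  ((size s)%:R%:E <= counting S :> \bar R)%E.
Proof.
move=> us sS; rewrite /counting; case: asboolP => [fS|_]; last exact: leey.
rewrite lee_fin ler_nat; apply: uniq_leq_size => // x /sS Sx.
by rewrite in_fset_set// inE.
Qed.

Lemma fsum_at_most S N (F : R -> \bar R) (b : R) : at_most S N -> 0 <= b ->
  (forall x, S x -> (F x <= b%:E)%E) -> (\sum_(x \in S) F x <= (N * b)%:E)%E.
Proof.
move=> SN b0 Fb; have fS := at_most_finite SN.
rewrite fsbig_finite//=; set s := finmap.enum_fset _.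
have sS x : x \in s -> S x by rewrite /s in_fset_set// inE.
apply: (@le_trans _ _ (\sum_(x <- s) b%:E)%E).
  by rewrite big_seq [leRHS]big_seq; apply: lee_sum => x /sS; exact: Fb.
rewrite sumEFin lee_fin big_const_seq count_predT iter_addr addr0 -mulr_natl.
by rewrite ler_wpM2r//; apply: SN => //; exact: finmap.fset_uniq.
Qed.

(** n windows of radius R0 with centres 2 s apart fit into [x - r, x + r]. The strict R0 < s makes
    the closed windows disjoint, so the points picked in them are distinct. *)
Lemma counting_ge_spread S (x r s R0 : R) (n : nat) : 0 < R0 -> R0 < s ->
  n%:R * s <= r ->
  (forall a, `[a - R0, a + R0]%classic `&` S !=set0) ->
  (n%:R%:E <= counting (S `&` `[(x - r)%R, (x + r)%R]%classic) :> \bar R)%E.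
Proof.
move=> R00 R0s nsr HS.
pose a (k : nat) := x - r + s * (2 * k%:R + 1).
have /choice[p pP] : forall k, exists y, (`[a k - R0, a k + R0]%classic `&` S) y.
  by move=> k; have [y] := HS (a k); exists y.
have pS k : S (p k) by have [] := pP k.
have pI k : a k - R0 <= p k <= a k + R0 by have [] := pP k; rewrite /= in_itv.
have plt j k : (j < k)%N -> p j < p k.
  move=> jk; have /andP[_ h1] := pI j; have /andP[h2 _] := pI k.
  apply: (le_lt_trans h1); apply: lt_le_trans h2.
  have : j%:R + 1 <= k%:R :> R by rewrite natr1 ler_nat.
  rewrite /a; nra.
have pinj : {in iota 0 n &, injective p}.
  move=> j k _ _ pjk; apply/eqP; case: ltngtP => // jk.
  - by have := plt _ _ jk; rewrite pjk ltxx.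
  - by have := plt _ _ jk; rewrite pjk ltxx.
have := @counting_ge (S `&` `[x - r, x + r]%classic) (map p (iota 0 n)).
rewrite size_map size_iota; apply.
- by rewrite map_inj_in_uniq// iota_uniq.
- move=> y /mapP[k]; rewrite mem_iota add0n => /andP[_ kn] ->; split => //=.
  rewrite in_itv/=; have /andP[h1 h2] := pI k.
  have k0 : 0 <= k%:R :> R by [].
  have kn' : k%:R + 1 <= n%:R :> R by rewrite natr1 ler_nat.
  by rewrite /a in h1 h2; apply/andP; split; nra.
Qed.

Lemma at_most_cover (S : set R) (h N x : R) (n : nat) :
  (forall m, at_most (S `&` `[m, m + h]%classic) N) ->
  at_most (S `&` `[x, x + n.+1%:R * h]%classic) (n.+1%:R * N).
Proof.
move=> SN; elim: n => [|n IH]; first by rewrite !mul1r.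
have := at_mostU IH (SN (x + n.+1%:R * h)).
have -> : n.+2%:R = n.+1%:R + 1 :> R by rewrite -natr1.
rewrite !mulrDl !mul1r; apply: at_mostS => y [Sy]; rewrite /= !in_itv/= => /andP[xy yx].
have [yn|ny] := leP y (x + n.+1%:R * h).
- by left; rewrite xy.
- by right; rewrite (ltW ny)/= -addrA.
Qed.

(** Once r >= h, a window of length 2 r is covered by at most 2 r / h + 1 <= 4 r / h intervals of
    length h. *)
Lemma upper_density_le (S : set R) (h N : R) : 0 < h -> 0 <= N ->
  (forall m, at_most (S `&` `[m, m + h]%classic) N) ->
  (upper_density S <= (2 * N / h)%:E)%E.
Proof.
move=> h0 N0 SN; rewrite /upper_density /limf_esup.
pose f (r : R) := ereal_sup (range (@point_density R S r)).
apply: (@le_trans _ _ (ereal_sup [set f r | r in [set r | h <= r]])).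
  apply: ereal_inf_lbound; exists [set r | h <= r] => //.
  by exists h; split; [exact: num_real|move=> r; exact: ltW].
apply: ge_ereal_sup => _ [r /= hr <-]; apply: ge_ereal_sup => _ [x _ <-].
have r0 : 0 < r by exact: lt_le_trans hr.
have r20 : 0 <= 2 * r / h by rewrite divr_ge0 ?mulr_ge0 ?ltW.
have /andP[n1 n2] := truncn_itv r20; set n := Num.trunc _ in n1 n2.
have := counting_le (at_most_cover (x := x - r) (n := n) SN).
have sub : S `&` `[x - r, x + r]%classic `<=` S `&` `[x - r, x - r + n.+1%:R * h]%classic.
  move=> y [Sy]; rewrite /= !in_itv/= => /andP[y1 y2]; split => //; rewrite y1/=.
  apply: (le_trans y2); move: n2; rewrite ltr_pdivrMr// => n2; lra.
move=> _; have := counting_le (at_mostS sub (at_most_cover (x := x - r) (n := n) SN)).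
move=> cle; rewrite /point_density.
apply: (@le_trans _ _ ((n.+1%:R * N)%:E * ((2 * r)^-1)%:E)%E).
  by rewrite lee_wpmul2r// lee_fin invr_ge0 mulr_ge0// ltW.
rewrite -EFinM lee_fin ler_pdivrMr ?mulr_gt0//.
have : n.+1%:R <= 4 * r / h.
  rewrite -natr1; have : 1 <= r / h by rewrite ler_pdivlMr// mul1r.
  by move: n1; rewrite -!mulrA; lra.
move=> /(ler_wpM2r N0) /le_trans; apply.
by rewrite le_eqVlt; apply/orP; left; apply/eqP; field; rewrite gt_eqF.
Qed.

(** Windows of radius R0 laid side by side could share an endpoint, and hence a point; the spacing
    is therefore enlarged slightly and the enlargement absorbed in [e]. *)
Lemma lower_density_ge (S : set R) (R0 : R) : 0 < R0 ->
  (forall a, `[a - R0, a + R0]%classic `&` S !=set0) ->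
  (((2 * R0)^-1)%:E <= lower_density S)%E.
Proof.
move=> R00 HS; rewrite /lower_density /limf_einf leeNr /limf_esup.
apply/lee_addgt0Pr => e e0.
(* With this choice 1 / R0 - 1 / s = e R0 / s <= e. Taking r > 1 / e makes the rounding of r / s
   cost at most e as well, so both losses, halved, add up to at most e. *)
pose s := R0 + e * R0 ^+ 2; have R0s : R0 < s by rewrite ltrDl mulr_gt0// exprn_gt0.
have s0 : 0 < s by exact: lt_trans R0s.
pose f (r : R) := ereal_inf (range (@point_density R S r)).
apply: (@le_trans _ _ (ereal_sup [set (- f r)%E | r in [set r | e^-1 < r]])).
  apply: ereal_inf_lbound; exists [set r | e^-1 < r] => //.
  by exists e^-1; split => //; exact: num_real.
apply: ge_ereal_sup => _ [r /= er <-].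
have r0 : 0 < r by apply: lt_trans er; rewrite invr_gt0.
rewrite -EFinD leeNl -EFinN (_ : - (- (2 * R0)^-1 + e) = (2 * R0)^-1 - e); last by rewrite opprD opprK.
apply: le_ereal_inf_tmp => _ [x _ <-]; rewrite /point_density.
have rs0 : 0 <= r / s by rewrite divr_ge0// ltW.
have /andP[n1 n2] := truncn_itv rs0; set n := Num.trunc _ in n1 n2.
have cge : (n%:R%:E <= counting (S `&` `[(x - r)%R, (x + r)%R]%classic) :> \bar R)%E.
  apply: (@counting_ge_spread _ _ _ s R0) => //.
  by rewrite -ler_pdivlMr.
apply: (@le_trans _ _ (n%:R%:E * ((2 * r)^-1)%:E)%E); last first.
  by rewrite lee_wpmul2r// lee_fin invr_ge0 mulr_ge0// ltW.
rewrite -EFinM lee_fin ler_pdivlMr ?mulr_gt0//.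
have h1 : r / s - 1 <= n%:R by move: n2; rewrite -natr1; lra.
apply: le_trans h1.
have re : 1 < r * e by rewrite -ltr_pdivrMr// mul1r.
have h2 : R0^-1 - s^-1 <= e.
  rewrite (_ : R0^-1 - s^-1 = e * (R0 / s)).
    by rewrite ler_piMr ?(ltW e0)// ler_pdivrMr// mul1r ltW.
  rewrite /s; field; rewrite -/s.
  by rewrite !gt_eqF.
rewrite (_ : ((2 * R0)^-1 - e) * (2 * r) = r * R0^-1 - 2 * (r * e)); last first.
  by field; rewrite gt_eqF.
have : r * (R0^-1 - s^-1) <= r * e by rewrite ler_wpM2l// ltW.
rewrite mulrBr; lra.
Qed.

End counting_points.

(** * Summing quadratic decay over distant points *)

Section sums_over_separated_points.
Context {R : realType}.
Local Notation mu := (@lebesgue_measure R).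
Implicit Types (S : set R) (h r N : R).

(** Telescoping: for x >= h, 1 / (1 + x^2) <= 2 / (x (x + h)) = (2 / h) (1 / x - 1 / (x + h)). *)
Lemma sum_inv_sqr_le h r n : 0 < h -> h <= r ->
  \sum_(0 <= k < n) (1 + (r + k%:R * h) ^+ 2)^-1 <=
    2 / h * (r^-1 - (r + n%:R * h)^-1).
Proof.
move=> h0 hr; have r0 : 0 < r by exact: lt_le_trans hr.
elim: n => [|n IH]; first by rewrite big_geq// mul0r addr0 subrr mulr0.
rewrite big_nat_recr//=; apply: (le_trans (lerD IH (lexx _))).
have -> : r + n.+1%:R * h = r + n%:R * h + h by rewrite -natr1 mulrDl mul1r addrA.
set x := r + n%:R * h.
have hx : h <= x by apply: (le_trans hr); rewrite lerDl mulr_ge0// ltW.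
have x0 : 0 < x by exact: lt_le_trans hx.
have xh0 : 0 < x + h by rewrite addr_gt0.
rewrite -lerBrDl -mulrBr (_ : _ - _ - _ = x^-1 - (x + h)^-1); last by rewrite opprB addrC subrKA.
have -> : 2 / h * (x^-1 - (x + h)^-1) = 2 / (x * (x + h)).
  by field; rewrite !gt_eqF.
rewrite ler_pdivlMr ?mulr_gt0// mulrC ler_pdivrMr ?ltr_wpDr ?sqr_ge0//.
have : x * h <= x * x by rewrite ler_pM2l.
by rewrite expr2; lra.
Qed.

(** The first term already obeys the telescoping bound with r^-2 in place of 1 / (1 + r^2). The
    difference is a gain independent of n, so strictness survives the limit of the partial sums. *)
Lemma sum_inv_sqr_le_defect h r n : 0 < h -> h <= r ->
  \sum_(0 <= k < n) (1 + (r + k%:R * h) ^+ 2)^-1 <=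
    2 / (h * r) - (r ^- 2 - (1 + r ^+ 2)^-1).
Proof.
move=> h0 hr; have r0 : 0 < r by exact: lt_le_trans hr.
have rh0 : 0 < r + h by rewrite addr_gt0.
have le2 : r ^- 2 <= 2 / h * (r^-1 - (r + h)^-1).
  have -> : 2 / h * (r^-1 - (r + h)^-1) = 2 / (r * (r + h)).
    by field; rewrite !gt_eqF.
  rewrite ler_pdivlMr ?mulr_gt0// mulrC ler_pdivrMr ?exprn_gt0//.
  have : r * h <= r * r by rewrite ler_pM2l.
  by rewrite expr2; lra.
have i1 : 0 <= (1 + r ^+ 2)^-1 by rewrite invr_ge0 addr_ge0// sqr_ge0.
have E : 2 / (h * r) = 2 / h * (r^-1 - (r + h)^-1) + 2 / h * (r + h)^-1.
  by field; rewrite !gt_eqF.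
case: n => [|n].
  rewrite big_geq// E; have : 0 <= 2 / h * (r + h)^-1.
    by rewrite mulr_ge0 ?invr_ge0 ?ltW// divr_gt0.
  lra.
rewrite big_nat_recl// mul0r addr0.
under eq_bigr do rewrite -natr1 mulrDl mul1r [_ + h]addrC addrA.
have rhh : h <= r + h by rewrite lerDr ltW.
have := sum_inv_sqr_le n h0 rhh.
rewrite mulrBr => S1.
have : 0 <= 2 / h * (r + h + n%:R * h)^-1.
  rewrite mulr_ge0 ?invr_ge0// ?divr_ge0 ?(ltW h0)//.
  by rewrite addr_ge0 ?(ltW rh0)// mulr_ge0// ltW.
rewrite E; lra.
Qed.

(* [S] is cut into shells of width [h] around [a], each holding at most [2 N]
   points; the defect [r ^- 2 - (1 + r ^+ 2)^-1] makes the bound strict. *)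
Lemma integral_esum_far S h r N a C (g : R -> R -> \bar R) (D : set R) :
  0 < h -> h <= r -> 0 < N -> 0 < C -> measurable D ->
  (forall l, measurable_fun D (g l)) -> (forall l t, (0 <= g l t)%E) ->
  (forall l, (\int[mu]_(t in D) g l t <= (C / (1 + (l - a) ^+ 2))%:E)%E) ->
  (forall m, at_most (S `&` `[m, m + h]%classic) N) ->
  (forall l, S l -> r <= `|l - a|) ->
  ((\int[mu]_(t in D) \esum_(l in S) g l t) < (4 * N * C / (h * r))%:E)%E.
Proof.
move=> h0 hr N0 C0 mD mg g0 gC SN Sr; have r0 : 0 < r by exact: lt_le_trans hr.
(* [J k] is the k-th shell: the points whose distance from [a] lies in [r + k h, r + (k + 1) h). *)
pose J k := S `&` [set l | Num.trunc ((`|l - a| - r) / h) = k].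
have SE : S = \bigcup_k J k.
  rewrite eqEsubset; split => [l Sl|l [k _ []]//].
  by exists (Num.trunc ((`|l - a| - r) / h)).
have tJ : trivIset setT J by move=> i j _ _ [l [[_ <-] [_ <-]]].
(* A shell lies in two intervals of length [h], one on each side of [a]. *)
have JN k : at_most (J k) (N + N).
  apply: at_mostS (at_mostU (SN (a + r + k%:R * h)) (SN (a - r - k.+1%:R * h))).
  move=> l [Sl lk].
  have q0 : 0 <= (`|l - a| - r) / h by rewrite divr_ge0 ?(ltW h0)// subr_ge0 Sr.
  have := truncn_itv q0; rewrite lk -natr1 ler_pdivlMr// ltr_pdivrMr//.
  move=> /andP[l1 l2].
  have [la|la] := leP 0 (l - a).
    left; split => //; rewrite /= in_itv/=; rewrite ger0_norm// in l1 l2.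
    by apply/andP; split; lra.
  right; split => //; rewrite /= in_itv/=; rewrite ltr0_norm// in l1 l2.
  by apply/andP; split; lra.
pose b k := 2 * N * C * (1 + (r + k%:R * h) ^+ 2)^-1.
have bk k : ((\int[mu]_(t in D) \esum_(l in J k) g l t) <= (b k)%:E)%E.
  have fJ := at_most_finite (JN k).
  under eq_integral do rewrite esum_fset//.
  rewrite ge0_integral_fsum//.
  rewrite (_ : b k = (N + N) * (C / (1 + (r + k%:R * h) ^+ 2))); last first.
    by rewrite /b mulrA -mulr2n -[N *+ 2]mulr_natl.
  have x0 : 0 <= r + k%:R * h by rewrite addr_ge0 ?(ltW r0)// mulr_ge0// ltW.
  apply: fsum_at_most => //.
    by rewrite divr_ge0 ?(ltW C0)// addr_ge0// sqr_ge0.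
  move=> l [Sl lk]; apply: (le_trans (gC l)); rewrite lee_fin.
  rewrite ler_wpM2l ?(ltW C0)// lef_pV2 ?posrE ?ltr_wpDr ?sqr_ge0//.
  rewrite lerD2l -[(l - a) ^+ 2]real_normK ?num_real//.
  have q0 : 0 <= (`|l - a| - r) / h by rewrite divr_ge0 ?(ltW h0)// subr_ge0 Sr.
  have := truncn_itv q0; rewrite lk ler_pdivlMr// => /andP[l1 _].
  by rewrite lerXn2r ?nnegrE//; lra.
have mJ k : measurable_fun D (fun t => \esum_(l in J k) g l t).
  have fJ := at_most_finite (JN k).
  rewrite (_ : (fun t => _) = fun t => (\sum_(l \in J k) g l t)%E); last first.
    by apply/funext => t; rewrite esum_fset.
  exact: emeasurable_fsum.
rewrite {1}SE.
under eq_integral do rewrite nneseries_sum_bigcup//.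
rewrite integral_nneseries//; last by move=> n t _; exact: esum_ge0.
pose d := 2 / (h * r) - (r ^- 2 - (1 + r ^+ 2)^-1).
apply: (@le_lt_trans _ _ (2 * N * C * d)%:E); last first.
  rewrite lte_fin (_ : 4 * N * C / (h * r) = 2 * N * C * (2 / (h * r))); last first.
    by field; rewrite !gt_eqF.
  rewrite ltr_pM2l ?mulr_gt0// /d gtrBl subr_gt0 ltf_pV2 ?posrE ?exprn_gt0//.
    by rewrite ltrDr.
  by rewrite ltr_wpDr ?sqr_ge0.
apply: lime_le.
  by apply: is_cvg_nneseries => n _ _; apply: integral_ge0 => t _; exact: esum_ge0.
apply: nearW => n; apply: (@le_trans _ _ (\sum_(0 <= k < n) (b k)%:E)%E).
  by apply: lee_sum => k _; exact: bk.
rewrite sumEFin lee_fin -mulr_sumr; apply: ler_wpM2l; last exact: sum_inv_sqr_le_defect.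
by rewrite ltW// !mulr_gt0.
Qed.

End sums_over_separated_points.

(** * Sampling the translated sinc kernels *)

Section kernel_energy.
Context {R : realType}.
Variables (c L kappa : R) (phi : R -> R[i]).
Hypotheses (c0 : 0 < c) (L0 : 0 < L) (k01 : 0 < kappa < 1).
Hypotheses (phi1 : Lp_space 1%:E phi) (phik : kernel_bound c kappa phi).
Local Notation mu := (@lebesgue_measure R).
Local Notation K := (kernel_sinc c phi).
Local Notation energy t y := ((Normc.normc (K t y) ^+ 2)%:E).
Local Notation cphi := (2 * (kappa `^ (2 * L) - 1) / (pi ^+ 2 * ln kappa)).

Let k0 : 0 < kappa. Proof. by case/andP: k01. Qed.

Lemma energy_kernel_sinc_ge y : `|y| <= pi / (2 * c) ->
  (cphi%:E <= \int[mu]_(t in `[0%R, L]) energy t y)%E.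
Proof.
move=> yc; rewrite -integral_powR_kappa//; apply: integral_le => t.
- by move=> _; rewrite lee_fin sqr_ge0.
- rewrite /= in_itv/= => /andP[t0 _]; rewrite lee_fin.
  exact: (normc_kernel_sinc_ge (kappa := kappa)).
Qed.

(** For 0 < kappa < 1 both kappa^(2 L) - 1 and ln kappa are negative. *)
Lemma kernel_constant_gt0 : 0 < cphi.
Proof.
have [_ k1] := andP k01.
have lnk : ln kappa < 0 by rewrite ln_lt0// k0.
rewrite -[ltRHS]opprK oppr_gt0 -mulNr pmulr_rlt0 ?invr_lt0; last first.
  rewrite -mulrN opprB mulr_gt0// subr_gt0 /powR gt_eqF//.
  by rewrite -expR0 ltr_expR pmulr_rlt0 ?mulr_gt0.
by rewrite pmulr_rlt0 ?exprn_gt0 ?pi_gt0.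
Qed.

Section sampling.
Variables (Lambda : set R) (A B C : R).
Hypotheses (A0 : 0 < A) (B0 : 0 < B).
Hypothesis frame : forall f : R -> R[i], PW c f ->
  (A%:E * Lp_norm 2%:E f ^+ 2
     <= (\int[lebesgue_measure]_(t in `[0%R, L])
          \esum_(l in Lambda) (Normc.normc (conv_pow c phi f t l) ^+ 2)%:E)
   /\
   (\int[lebesgue_measure]_(t in `[0%R, L])
          \esum_(l in Lambda) (Normc.normc (conv_pow c phi f t l) ^+ 2)%:E)
     <= B%:E * Lp_norm 2%:E f ^+ 2)%E.
Hypothesis decay : forall y,
  ((\int[mu]_(t in `[0%R, L]) energy t y) <= (C / (1 + y ^+ 2))%:E)%E.

(** Translating the test function keeps it in the Paley-Wiener space with the same norm, and
    [conv_pow] commutes with the translation. *)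
Lemma frame_kernel_sinc a :
  ((A * (pi / (2 * c)))%:E <=
     (\int[mu]_(t in `[0%R, L]) \esum_(l in Lambda) energy t (l - a)) /\
   (\int[mu]_(t in `[0%R, L]) \esum_(l in Lambda) energy t (l - a)) <=
     (B * (pi / c))%:E)%E.
Proof.
have /(PW_shift (- a)) PWa := PW_kernel_sinc c0 k0 phi1 phik (lexx 0).
have [] := frame PWa; rewrite Lp_norm2_sqr.
rewrite (sqnorm_kernel_sinc0_shift c0 k01 phi1 phik).
rewrite (_ : (\int[_]_(t in _) _)%E =
    (\int[mu]_(t in `[0%R, L]) \esum_(l in Lambda) energy t (l - a))%E); last first.
  apply: eq_integral => t; rewrite inE/= in_itv/= => /andP[t0 _].
  by rewrite (conv_pow_kernel_sinc c0 k0 phi1 phik).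
move=> h1 h2; split.
- apply: le_trans h1; rewrite EFinM lee_wpmul2l ?lee_fin ?(ltW A0)//.
  exact: (sqnorm_kernel_sinc0_ge (kappa := kappa)).
- apply: (le_trans h2); rewrite EFinM lee_wpmul2l ?lee_fin ?(ltW B0)//.
  exact: (sqnorm_kernel_sinc0_le (kappa := kappa)).
Qed.

Lemma at_most_sample m :
  at_most (Lambda `&` `[m, m + pi / c]%classic) (B * (pi / c) / cphi).
Proof.
move=> s us sL; rewrite ler_pdivlMr ?kernel_constant_gt0// -lee_fin.
(* Centred at the midpoint, the test function sees the whole interval within distance pi / (2 c),
   where each point contributes energy at least c_phiL. *)
have [_] := frame_kernel_sinc (m + pi / (2 * c)).
apply: le_trans.
apply: (@le_trans _ _ (\int[mu]_(t in `[0%R, L])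
    \sum_(l <- s) energy t (l - (m + pi / (2 * c))))%E); last first.
  apply: integral_le => t _.
    by apply: sume_ge0 => l _; rewrite lee_fin sqr_ge0.
  apply: esum_ge; exists [set` s]; last by rewrite fsbig_seq.
  by split=> [|l ls]; [exact: finite_seq|have [] := sL l ls].
rewrite ge0_integral_sum//; last 2 first.
- by move=> l; exact: (measurable_normc_kernel_sinc (kappa := kappa)).
- by move=> l t _; rewrite lee_fin sqr_ge0.
have -> : (size s)%:R * cphi = \sum_(l <- s) cphi.
  by rewrite big_const_seq count_predT iter_addr addr0 mulr_natl.
rewrite -sumEFin.
rewrite big_seq [leRHS]big_seq; apply: lee_sum => l /sL [_].
rewrite /= in_itv/= => /andP[l1 l2]; apply: energy_kernel_sinc_ge.
have E : pi / c = pi / (2 * c) + pi / (2 * c) :> R.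
  by move: pi => p; field; rewrite gt_eqF.
by rewrite E in l2; rewrite ler_norml; apply/andP; split; lra.
Qed.

(** At 0 the energy is at least c_phiL, so in fact C >= c_phiL. *)
Lemma decay_constant_gt0 : 0 < C.
Proof.
have := decay 0; rewrite (_ : C / _ = C); last by rewrite expr0n addr0 divr1.
rewrite -lte_fin; apply: lt_le_trans.
apply: (@lt_le_trans _ _ cphi%:E); first by rewrite lte_fin kernel_constant_gt0.
by apply: energy_kernel_sinc_ge; rewrite normr0 divr_ge0 ?pi_ge0// mulr_ge0// ltW.
Qed.

(** Were the window empty, all points would be at distance at least r from a, and the shell estimate
    would fall strictly below the lower frame bound. Its strictness is what admits r equal to the
    threshold. *)
Lemma sampling_relatively_dense r a :
  Num.max (pi / c) (8 * c / pi * (B / A) * (C / cphi)) <= r ->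
  `[a - r, a + r]%classic `&` Lambda !=set0.
Proof.
rewrite ge_max => /andP[hr Xr]; apply: contrapT => noL.
have h0 : 0 < pi / c by rewrite divr_gt0// pi_gt0.
have r0 : 0 < r by exact: lt_le_trans hr.
have cphi0 := kernel_constant_gt0; have C0 := decay_constant_gt0.
have N0 : 0 < B * (pi / c) / cphi by rewrite divr_gt0// mulr_gt0.
have far l : Lambda l -> r <= `|l - a|.
  move=> Ll; rewrite leNgt; apply/negP => /ltW; rewrite ler_norml => /andP[l1 l2].
  by apply: noL; exists l; split => //=; rewrite in_itv/=; apply/andP; split; lra.
have [ge _] := frame_kernel_sinc a.
have := le_lt_trans ge (integral_esum_far (g := fun l t => energy t (l - a))
  h0 hr N0 C0 (measurable_itv _) _ _ (fun l => decay (l - a)) at_most_sample far).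
have mE l : measurable_fun `[0%R, L]%classic (fun t => energy t (l - a)).
  exact: (measurable_normc_kernel_sinc (kappa := kappa)).
have E0 l t : (0 <= energy t (l - a))%E by rewrite lee_fin sqr_ge0.
move=> /(_ mE E0); rewrite lte_fin; apply/negP; rewrite -leNgt.
move: Xr h0 cphi0; move: cphi (pi_gt0 R) => d; move: pi => p p0 Xr h0 d0.
(* The interval length pi / c cancels between the count per interval and the shell sum. *)
have -> : 4 * (B * (p / c) / d) * C / (p / c * r) = 4 * B * C / (d * r).
  by field; rewrite !gt_eqF.
rewrite ler_pdivrMr ?mulr_gt0//.
have -> : A * (p / (2 * c)) * (d * r) = A * p * d / (2 * c) * r.
  by field; rewrite !gt_eqF.
have -> : 4 * B * C = A * p * d / (2 * c) * (8 * c / p * (B / A) * (C / d)).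
  by field; rewrite !gt_eqF.
by rewrite ler_wpM2l// divr_ge0 ?mulr_ge0 ?ltW.
Qed.

End sampling.
End kernel_energy.

(** * Gaps and Beurling densities of the sampling set *)

Theorem theorem4p4 (R : realType) (c L : R) (phi : R -> R[i]) (kappa : R)
    (Lambda : set R) (A B C : R)
    (hc : 0 < c) (hL : 0 < L)
    (hphi : Phi c phi)
    (hkappa : 0 < kappa < 1) (hphi_kappa : kernel_bound c kappa phi)
    (hC1 : C1_on c (fourier phi))
    (hA : 0 < A) (hB : 0 < B)
    (hframe : forall f : R -> R[i], PW c f ->
      (A%:E * Lp_norm 2%:E f ^+ 2
         <= (\int[lebesgue_measure]_(t in `[0%R, L])
              \esum_(l in Lambda) (Normc.normc (conv_pow c phi f t l) ^+ 2)%:E)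
       /\
       (\int[lebesgue_measure]_(t in `[0%R, L])
              \esum_(l in Lambda) (Normc.normc (conv_pow c phi f t l) ^+ 2)%:E)
         <= B%:E * Lp_norm 2%:E f ^+ 2)%E)
    (hC : forall x : R,
      (\int[lebesgue_measure]_(t in `[0%R, L])
         (Normc.normc (conv_pow c phi (fun y => (sinc (c * y))%:C) t x)
            ^+ 2)%:E
       <= (C / (1 + x ^+ 2))%:E)%E) :
  let c_phiL := 2 * (kappa `^ (2 * L) - 1) / (pi ^+ 2 * ln kappa) in
  [/\ forall r : R,
        Num.max (pi / c) (8 * c / pi * (B / A) * (C / c_phiL)) <= r ->
        forall a : R, `[a - r, a + r] `&` Lambda !=set0,
      ((Num.min (c / (2 * pi)) (pi / (16 * c) * (A / B) * (c_phiL / C)))%:E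
         <= lower_density Lambda)%E
    & (upper_density Lambda <= (4 * (B / c_phiL))%:E)%E].
Proof.
move=> cphi; have [phi1 _ _] := hphi; have k0 : 0 < kappa by case/andP: hkappa.
have decay y : ((\int[lebesgue_measure]_(t in `[0%R, L])
    (Normc.normc (kernel_sinc c phi t y) ^+ 2)%:E) <= (C / (1 + y ^+ 2))%:E)%E.
  apply: le_trans (hC y); rewrite le_eqVlt; apply/orP; left; apply/eqP.
  apply: eq_integral => t; rewrite inE/= in_itv/= => /andP[t0 _].
  (* Written as a translate by 0 to match the form in which [conv_pow] was computed. *)
  have -> : (fun z => (sinc (c * z))%:C) = fun z => kernel_sinc c phi 0 (z - 0).
    by apply/funext => z; rewrite subr0 (kernel_sinc0 hc hkappa phi1 hphi_kappa).
  by rewrite (conv_pow_kernel_sinc hc k0 phi1 hphi_kappa)// subr0.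
have cphi0 : 0 < cphi by exact: kernel_constant_gt0.
have C0 : 0 < C by exact: (decay_constant_gt0 hc hL hkappa phi1 hphi_kappa decay).
have dense := sampling_relatively_dense hc hL hkappa phi1 hphi_kappa hA hB hframe decay.
have p0 := pi_gt0 R; have h0 : 0 < pi / c by rewrite divr_gt0.
split => [r Rr a||]; first exact: dense.
- set R0 := Num.max (pi / c) (8 * c / pi * (B / A) * (C / cphi)).
  have R00 : 0 < R0 by rewrite lt_max h0.
  apply: (le_trans _ (lower_density_ge R00 (fun a => dense R0 a (lexx _)))).
  (* The density bound is 1 / (2 R0); the two values of the maximum [R0] give the two entries of the
     minimum. *)
  rewrite lee_fin ge_min; have [E|E] : R0 = pi / c \/
      R0 = 8 * c / pi * (B / A) * (C / cphi) by rewrite /R0; case: leP; auto.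
  + apply/orP; left; rewrite E le_eqVlt; apply/orP; left; apply/eqP.
    by move: pi p0 => p p0; field; rewrite !gt_eqF.
  + apply/orP; right; rewrite E le_eqVlt; apply/orP; left; apply/eqP.
    by move: pi p0 (cphi) cphi0 => p p0 d d0; field; rewrite !gt_eqF.
- have N0 : 0 <= B * (pi / c) / cphi by rewrite ltW// divr_gt0// mulr_gt0.
  have := upper_density_le h0 N0
    (at_most_sample hc hL hkappa phi1 hphi_kappa hA hB hframe).
  move=> /le_trans; apply; rewrite lee_fin.
  have BC0 : 0 <= B / cphi by rewrite ltW// divr_gt0.
  (* The covering argument yields 2 B / c_phiL, which is below the stated bound. *)
  have -> : 2 * (B * (pi / c) / cphi) / (pi / c) = 2 * (B / cphi).
    by move: pi p0 (cphi) cphi0 => p p0 d d0; field; rewrite !gt_eqF.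
  by rewrite ler_wpM2r// ler_nat.
Qed.
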